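(* Let $\mathfrak p$ be the standard parabolic subalgebra determined by a subset $I_f\subset I$, let $N=\{n_j\}_{j\in I_f}$ with $n_j\in\mathbb N$, and let $m\in\mathbb N$. The dg-algebra $(R_{\mathfrak b}(m),d_N)$ is formal (i.e. quasi-isomorphic, as a dg-algebra, to its homology equipped with the zero differential), with homology $$H(R_{\mathfrak b}(m),d_N)\cong R_{\mathfrak p}^N(m).$$
   Context: Cartan datum: $I$ is a finite set, $(a_{ij})_{i,j\in I}$ a generalized Cartan matrix with positive integers $d_i$ such that $d_ia_{ij}=d_ja_{ji}$; $Y$ is a free abelian group containing linearly independent simple roots $\alpha_i$, with coroots $\alpha_i^\vee\in\mathrm{Hom}(Y,\mathbb Z)$, $\alpha_i^\vee(\alpha_j)=a_{ij}$, and a symmetric bilinear form with $(\alpha_i|\alpha_j)=d_ia_{ij}$. Put $d_{ij}=-a_{ij}$ for $i\neq j$, $q_i=q^{d_i}$, $X^+=\bigoplus_i\mathbb N\alpha_i$. Scalars: $\Bbbk$ is a commutative unital ring with chosen $r_i\in\Bbbk^\times$ ($i\in I$), $t_{ij}\in\Bbbk^\times$ with $t_{ii}=1$ and $t_{ij}=t_{ji}$ if $d_{ij}=0$, and, for $i\ne j$ and $t,v\in\mathbb N$, elements $s_{ij}^{tv}\in\Bbbk$ with $s_{ij}^{tv}=s_{ji}^{vt}$, $s_{ij}^{d_{ij}0}=t_{ij}$, $s_{ij}^{0d_{ji}}=t_{ji}$, and $s_{ij}^{tv}=0$ unless $t(\alpha_i|\alpha_i)+v(\alpha_j|\alpha_j)=-2(\alpha_i|\alpha_j)$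 (so all sums below are finite). The $\mathfrak b$-KLR algebra $R_{\mathfrak b}(m)$ (algebraic form of the diagrammatic definition: strands are numbered from the left, $ab$ is $a$ stacked on top of $b$, $x_k$ is a dot on strand $k$, $\tau_k$ a crossing of strands $k,k+1$, $\Omega_k^{j,a}$ a floating dot with subscript $j$ and superscript $a$ in the region directly to the right of strand $k$, region $0$ being leftmost) is the $\Bbbk$-algebra generated by $1_{\mathbf i}$ ($\mathbf i\in I^m$), $x_k$ ($1\le k\le m$), $\tau_k$ ($1\le k<m$), $\Omega_k^{j,a}$ ($0\le k\le m$, $j\in I$, $a\in\mathbb N$), with relations: (0) $1_{\mathbf i}1_{\mathbf j}=\delta_{\mathbf i\mathbf j}1_{\mathbf i}$, $\sum_{\mathbf i}1_{\mathbf i}=1$, $x_k$ and $\Omega_k^{j,a}$ commute with the $1_{\mathbf i}$, $\tau_k1_{\mathbf i}=1_{\sigma_k\mathbf i}\tau_k$ ($\sigma_k$ swaps entries $k,k+1$); (1) $x_kx_l=x_lx_k$; $\tau_k\tau_l=\tau_l\tau_k$ if $|k-l|>1$; $\tau_kx_l=x_l\tau_k$ if $l\ne k,k+1$; $\Omega_k^{j,a}x_l=x_l\Omega_k^{j,a}$; $\Omega_k^{j,a}\tau_l=\tau_l\Omega_k^{j,a}$ if $l\neq k$; (2) $\tau_k^21_{\mathbf i}=0$ if $i_k=i_{k+1}$, and $\tau_k^21_{\mathbf i}=\sum_{t,v}s_{i_ki_{k+1}}^{tv}x_k^tx_{k+1}^v1_{\mathbf i}$ otherwise; (3) $x_k\tau_k1_{\mathbf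 i}=\tau_kx_{k+1}1_{\mathbf i}+\delta_{i_ki_{k+1}}r_{i_k}1_{\mathbf i}$ and $\tau_kx_k1_{\mathbf i}=x_{k+1}\tau_k1_{\mathbf i}+\delta_{i_ki_{k+1}}r_{i_k}1_{\mathbf i}$; (4) $(\tau_k\tau_{k+1}\tau_k-\tau_{k+1}\tau_k\tau_{k+1})1_{\mathbf i}$ equals $r_i\sum_{t,v}s_{ij}^{tv}\sum_{u+\ell=t-1}x_k^ux_{k+1}^vx_{k+2}^\ell1_{\mathbf i}$ if $i_k=i_{k+2}=i\neq j=i_{k+1}$, and $0$ otherwise; (5) $\Omega_k^{i,a}\Omega_l^{j,b}=-\Omega_l^{j,b}\Omega_k^{i,a}$ and $(\Omega_k^{i,a})^2=0$; (6) $\Omega_0^{j,a}=0$; (7) $\Omega_k^{j,a}1_{\mathbf i}=\Omega_{k-1}^{j,a-1}1_{\mathbf i}-\Omega_k^{j,a-1}x_k1_{\mathbf i}$ if $i_k=j$, $a>0$; and $\Omega_k^{j,a}1_{\mathbf i}=\sum_{t,v}(-1)^vs_{ij}^{tv}x_k^t\Omega_{k-1}^{j,a+v}1_{\mathbf i}$ if $i_k=i\ne j$; (8) $\tau_k\Omega_k^{j,a}\tau_k1_{\mathbf i}=\Omega_{k+1}^{j,a}1_{\mathbf i}+\sum_{t,v}s_{ij}^{tv}\sum_{u+\ell=v-1}(-1)^u\Omega_{k-1}^{j,a+u}x_k^tx_{k+1}^\ell1_{\mathbf i}$ if $i_k=i\ne j=i_{k+1}$. Homological grading: $\deg_h\Omega_k^{j,a}=1$,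 and $\deg_h=0$ for the other generators. $R_{\mathfrak b}(m)$ is generated by the $1_{\mathbf i},x_k,\tau_k$ and the tight floating dots $\Omega_1^{i_1,0}1_{\mathbf i}$. Differential: $d_N$ is the ($\Bbbk$-linear, $\deg_h=-1$) differential satisfying $d_N(xy)=d_N(x)y+(-1)^{\deg_h x}x\,d_N(y)$, zero on $1_{\mathbf i},x_k,\tau_k$, with $d_N(\Omega_1^{j,0}1_{\mathbf i})=(-1)^{n_j}x_1^{n_j}1_{\mathbf i}$ if $i_1=j\in I_f$, and $=0$ if $i_1=j\notin I_f$. Cyclotomic quotient: $R_{\mathfrak p}(m)$ is the quotient of $R_{\mathfrak b}(m)$ by the two-sided ideal generated by all $\Omega_1^{j,0}1_{\mathbf i}$ with $i_1=j\in I_f$; $R_{\mathfrak p}^N(m)$ is the quotient of $R_{\mathfrak p}(m)$ by the two-sided ideal generated by all $x_1^{n_j}1_{\mathbf i}$ with $i_1=j\in I_f$. Here $\mathfrak p$ stands for the standard parabolic subalgebra corresponding to $I_f$. *)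

(* Defs.v *)
From HB Require Import structures.
From Stdlib Require Import Relations.
From mathcomp Require Import all_boot all_order all_algebra.
From mathcomp Require Import boolp.

Set Implicit Arguments.
Unset Strict Implicit.
Unset Printing Implicit Defensive.

Import Order.TTheory GRing.Theory Num.Theory.
Local Open Scope ring_scope.
Local Open Scope quotient_scope.

(* A unital associative Z-graded algebra over k: a ring A with a central ring
   morphism [ascal : k -> A] (so that c.x is [ascal c * x]), and the grading
   given by the projections [hcomp n] onto the summands A_n.  The library's
   [algType] is not used because it excludes the zero ring, which does occur
   as a cyclotomic quotient. *)
HB.mixin Record PzRing_isGradedAlg (k : comPzRingType) A of GRing.PzRing A := {
  ascal : k -> A;
  ascalD : {morph ascal : x y / x + y};
  ascalM : {morph ascal : x y / x * y};
  ascal1 : ascal 1 = 1;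
  ascalC : forall c x, ascal c * x = x * ascal c;
  hcomp : int -> A -> A;
  hcompD : forall n, {morph hcomp n : x y / x + y};
  hcomp_proj : forall m n x,
    hcomp m (hcomp n x) = if m == n then hcomp n x else 0;
  hcomp_sum : forall x, exists2 s : seq int, uniq s & x = \sum_(n <- s) hcomp n x;
  hcomp_ascal : forall c, hcomp 0 (ascal c) = ascal c;
  hcomp_mul : forall m n x y, hcomp m x = x -> hcomp n y = y ->
    hcomp (m + n) (x * y) = x * y
}.

#[short(type="grAlgType")]
HB.structure Definition GradedAlg (k : comPzRingType) :=
  { A of GRing.PzRing A & PzRing_isGradedAlg k A }.

Arguments ascal {k A} : rename.
Arguments hcomp {k A} : rename.

Definition homog (k : comPzRingType) (A : grAlgType k) (n : int) (x : A) :=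
  hcomp n x = x.

Definition is_gr_hom (k : comPzRingType) (A B : grAlgType k)
    (f : {rmorphism A -> B}) : Prop :=
  (forall c, f (ascal c) = ascal c) /\
  (forall n x, homog n x -> homog n (f x)).

Definition gr_iso (k : comPzRingType) (A B : grAlgType k) : Prop :=
  exists f : {rmorphism A -> B}, is_gr_hom f /\ bijective f.

Section GradedAlgTheory.
Variables (k : comPzRingType) (A : grAlgType k).
Implicit Types (x y : A) (m n : int).

Lemma hcomp0 n : hcomp n (0 : A) = 0.
Proof. by apply: (addIr (hcomp n 0)); rewrite -hcompD !add0r. Qed.

Lemma hcompN n x : hcomp n (- x) = - hcomp n x.
Proof. by apply: (addIr (hcomp n x)); rewrite -hcompD !addNr hcomp0. Qed.

Lemma hcomp_bigsum n (J : Type) (r : seq J) (P : pred J) (F : J -> A) :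
  hcomp n (\sum_(j <- r | P j) F j) = \sum_(j <- r | P j) hcomp n (F j).
Proof. by apply: big_morph; [exact: hcompD | exact: hcomp0]. Qed.

Lemma homog0 n : homog n (0 : A). Proof. exact: hcomp0. Qed.
Lemma homogD n x y : homog n x -> homog n y -> homog n (x + y).
Proof. by rewrite /homog hcompD => -> ->. Qed.
Lemma homogN n x : homog n x -> homog n (- x).
Proof. by rewrite /homog hcompN => ->. Qed.
Lemma homogB n x y : homog n x -> homog n y -> homog n (x - y).
Proof. by move=> hx hy; apply: homogD => //; apply: homogN. Qed.
Lemma homog_sum n (J : Type) (r : seq J) (P : pred J) (F : J -> A) :
  (forall j, P j -> homog n (F j)) -> homog n (\sum_(j <- r | P j) F j).
Proof. by move=> h; rewrite /homog hcomp_bigsum; apply: eq_bigr. Qed.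
Lemma homog_comp n x : homog n (hcomp n x).
Proof. by rewrite /homog hcomp_proj eqxx. Qed.
Lemma homogM m n x y : homog m x -> homog n y -> homog (m + n) (x * y).
Proof. exact: hcomp_mul. Qed.
Lemma homogMl m x y : homog 0 x -> homog m y -> homog m (x * y).
Proof. by move=> hx hy; rewrite -[m]add0r; apply: homogM. Qed.
Lemma homogMr m x y : homog m x -> homog 0 y -> homog m (x * y).
Proof. by move=> hx hy; rewrite -[m]addr0; apply: homogM. Qed.
Lemma homog_ascal c : homog 0 (ascal c : A). Proof. exact: hcomp_ascal. Qed.
Lemma homog1 : homog 0 (1 : A).
Proof. by rewrite -(ascal1 (k := k) (s := A)); apply: homog_ascal. Qed.
Lemma homogX x e : homog 0 x -> homog 0 (x ^+ e).
Proof.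
move=> hx; elim: e => [|e IH]; first by rewrite expr0; apply: homog1.
by rewrite exprS; apply: homogMl.
Qed.

Lemma homog_other m n x : homog n x -> m != n -> hcomp m x = 0.
Proof. by move=> <- /negbTE h; rewrite hcomp_proj h. Qed.

Lemma hcompMl m n x y : homog n x -> hcomp m (x * y) = x * hcomp (m - n) y.
Proof.
move=> hx; have [s us ey] := hcomp_sum y.
rewrite [in LHS]ey [in RHS]ey hcomp_bigsum !mulr_sumr hcomp_bigsum.
apply: eq_bigr => i _; rewrite hcomp_proj.
have hi := homogM hx (homog_comp i y).
have [e|ne] := eqVneq (m - n) i; first by rewrite -e subrKC in hi *; rewrite hi.
by rewrite mulr0 (homog_other hi) //; apply: contraNneq ne => ->; rewrite addrAC subrr add0r.
Qed.

Lemma hcompMr m n x y : homog n y -> hcomp m (x * y) = hcomp (m - n) x * y.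
Proof.
move=> hy; have [s us ex] := hcomp_sum x.
rewrite [in LHS]ex [in RHS]ex hcomp_bigsum !mulr_suml hcomp_bigsum.
apply: eq_bigr => i _; rewrite hcomp_proj.
have hi := homogM (homog_comp i x) hy.
have [e|ne] := eqVneq (m - n) i; first by rewrite -e subrK in hi *; rewrite hi.
by rewrite mul0r (homog_other hi) //; apply: contraNneq ne => ->; rewrite addrK.
Qed.

Lemma ascal0 : ascal 0 = 0 :> A.
Proof. by apply: (addIr (ascal 0)); rewrite -ascalD !add0r. Qed.

Lemma ascalN c : ascal (- c) = - ascal c :> A.
Proof. by apply: (addIr (ascal c)); rewrite -ascalD !addNr ascal0. Qed.

End GradedAlgTheory.

(* Homogeneous two-sided ideals. *)
Record hideal (k : comPzRingType) (A : grAlgType k) := HIdeal {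
  imem :> A -> Prop;
  imem0 : imem 0;
  imemD : forall x y, imem x -> imem y -> imem (x + y);
  imemMl : forall a x, imem x -> imem (a * x);
  imemMr : forall a x, imem x -> imem (x * a);
  imem_hcomp : forall n x, imem x -> imem (hcomp n x)
}.

Section Quotient.
Variables (k : comPzRingType) (A : grAlgType k) (J : hideal A).

Lemma imemN x : J x -> J (- x).
Proof. by move=> Jx; rewrite -mulN1r; apply: imemMl. Qed.

Definition quot_eq : rel A := fun x y => `[< J (x - y) >].

Lemma quot_eq_refl : reflexive quot_eq.
Proof. by move=> x; apply/asboolP; rewrite subrr; apply: imem0. Qed.
Lemma quot_eq_sym : symmetric quot_eq.
Proof.
move=> x y; apply: asbool_equiv_eq.
by split=> /imemN; rewrite opprB.
Qed.
Lemma quot_eq_trans : transitive quot_eq.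
Proof.
move=> y x z /asboolP h1 /asboolP h2; apply/asboolP.
by rewrite -(subrKA y); apply: imemD.
Qed.

Canonical quot_equiv := EquivRel quot_eq quot_eq_refl quot_eq_sym quot_eq_trans.

Definition quot := {eq_quot quot_eq}.
HB.instance Definition _ := Choice.on quot.

Definition qpi (x : A) : quot := \pi_quot x.

Lemma qpiP x y : qpi x = qpi y <-> J (x - y).
Proof.
split; first by move/eqmodP => /asboolP.
by move=> h; apply/eqmodP/asboolP.
Qed.

Lemma quot_repr x : J (repr (qpi x) - x).
Proof. by apply/qpiP; rewrite /qpi reprK. Qed.

Definition quot_add (u v : quot) : quot := qpi (repr u + repr v).
Definition quot_opp (u : quot) : quot := qpi (- repr u).
Definition quot_mul (u v : quot) : quot := qpi (repr u * repr v).
Definition quot_hcomp n (u : quot) : quot := qpi (hcomp n (repr u)).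

Lemma quot_addE x y : quot_add (qpi x) (qpi y) = qpi (x + y).
Proof.
by apply/qpiP; rewrite opprD addrACA; apply: imemD; apply: quot_repr.
Qed.
Lemma quot_oppE x : quot_opp (qpi x) = qpi (- x).
Proof. by apply/qpiP; rewrite -opprD; apply: imemN; apply: quot_repr. Qed.
Lemma quot_mulE x y : quot_mul (qpi x) (qpi y) = qpi (x * y).
Proof.
apply/qpiP; set a := repr _; set b := repr _.
have -> : a * b - x * y = (a - x) * b + x * (b - y).
  by rewrite mulrBl mulrBr addrA subrK.
by apply: imemD; [apply: imemMr|apply: imemMl]; apply: quot_repr.
Qed.
Lemma quot_hcompE n x : quot_hcomp n (qpi x) = qpi (hcomp n x).
Proof.
by apply/qpiP; rewrite -hcompN -hcompD; apply: imem_hcomp; apply: quot_repr.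
Qed.

Lemma quot_ind (P : quot -> Prop) : (forall x, P (qpi x)) -> forall u, P u.
Proof. by move=> h u; rewrite -[u]reprK; apply: h. Qed.

Fact quot_addA : associative quot_add.
Proof.
by do 3![elim/quot_ind=> ?]; rewrite !quot_addE addrA.
Qed.
Fact quot_addC : commutative quot_add.
Proof. by do 2![elim/quot_ind=> ?]; rewrite !quot_addE addrC. Qed.
Fact quot_add0 : left_id (qpi 0) quot_add.
Proof. by elim/quot_ind=> ?; rewrite !quot_addE add0r. Qed.
Fact quot_addN : left_inverse (qpi 0) quot_opp quot_add.
Proof. by elim/quot_ind=> ?; rewrite !quot_oppE !quot_addE addNr. Qed.
Fact quot_mulA : associative quot_mul.
Proof. by do 3![elim/quot_ind=> ?]; rewrite !quot_mulE mulrA. Qed.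
Fact quot_mul1 : left_id (qpi 1) quot_mul.
Proof. by elim/quot_ind=> ?; rewrite !quot_mulE mul1r. Qed.
Fact quot_mulr1 : right_id (qpi 1) quot_mul.
Proof. by elim/quot_ind=> ?; rewrite !quot_mulE mulr1. Qed.
Fact quot_mulDl : left_distributive quot_mul quot_add.
Proof.
by do 3![elim/quot_ind=> ?]; rewrite !(quot_mulE, quot_addE) mulrDl.
Qed.
Fact quot_mulDr : right_distributive quot_mul quot_add.
Proof.
by do 3![elim/quot_ind=> ?]; rewrite !(quot_mulE, quot_addE) mulrDr.
Qed.

HB.instance Definition _ := GRing.isZmodule.Build quot
  quot_addA quot_addC quot_add0 quot_addN.
HB.instance Definition _ := GRing.Zmodule_isPzRing.Build quot
  quot_mulA quot_mul1 quot_mulr1 quot_mulDl quot_mulDr.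

Lemma qpiD : {morph qpi : x y / x + y}.
Proof. by move=> x y; rewrite /GRing.add /= quot_addE. Qed.
Lemma qpiM : {morph qpi : x y / x * y}.
Proof. by move=> x y; rewrite /GRing.mul /= quot_mulE. Qed.
Lemma qpi0 : qpi 0 = 0. Proof. by []. Qed.
Lemma qpi1 : qpi 1 = 1. Proof. by []. Qed.
Lemma qpiN x : qpi (- x) = - qpi x.
Proof. by rewrite /GRing.opp /= quot_oppE. Qed.
Lemma qpi_sum (T : Type) (r : seq T) (P : pred T) (F : T -> A) :
  qpi (\sum_(j <- r | P j) F j) = \sum_(j <- r | P j) qpi (F j).
Proof. by apply: big_morph; [exact: qpiD | exact: qpi0]. Qed.

Definition quot_ascal (c : k) : quot := qpi (ascal c).

Fact quot_ascalD : {morph quot_ascal : x y / x + y}.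
Proof. by move=> x y; rewrite /quot_ascal ascalD qpiD. Qed.
Fact quot_ascalM : {morph quot_ascal : x y / x * y}.
Proof. by move=> x y; rewrite /quot_ascal ascalM qpiM. Qed.
Fact quot_ascal1 : quot_ascal 1 = 1.
Proof. by rewrite /quot_ascal ascal1. Qed.
Fact quot_ascalC c u : quot_ascal c * u = u * quot_ascal c.
Proof. by elim/quot_ind: u => x; rewrite -!qpiM ascalC. Qed.
Fact quot_hcompD n : {morph quot_hcomp n : x y / x + y}.
Proof.
elim/quot_ind=> x; elim/quot_ind=> y.
by rewrite -(qpiD x y) !quot_hcompE hcompD qpiD.
Qed.
Fact quot_hcomp_proj m n u :
  quot_hcomp m (quot_hcomp n u) = if m == n then quot_hcomp n u else 0.
Proof. by elim/quot_ind: u => x; rewrite !quot_hcompE hcomp_proj; case: ifP. Qed.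
Fact quot_hcomp_sum u :
  exists2 s : seq int, uniq s & u = \sum_(n <- s) quot_hcomp n u.
Proof.
elim/quot_ind: u => x; have [s us e] := hcomp_sum x; exists s => //.
by rewrite {1}e qpi_sum; apply: eq_bigr => n _; rewrite quot_hcompE.
Qed.
Fact quot_hcomp_ascal c : quot_hcomp 0 (quot_ascal c) = quot_ascal c.
Proof. by rewrite quot_hcompE hcomp_ascal. Qed.
Fact quot_hcomp_mul m n u v : quot_hcomp m u = u -> quot_hcomp n v = v ->
  quot_hcomp (m + n) (u * v) = u * v.
Proof.
elim/quot_ind: u => x; elim/quot_ind: v => y ex ey.
rewrite quot_hcompE in ex; rewrite quot_hcompE in ey.
have -> : qpi x * qpi y = qpi (hcomp m x * hcomp n y) by rewrite qpiM ex ey.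
by rewrite quot_hcompE (homogM (homog_comp m x) (homog_comp n y)).
Qed.

HB.instance Definition _ := PzRing_isGradedAlg.Build k quot
  quot_ascalD quot_ascalM quot_ascal1 quot_ascalC quot_hcompD
  quot_hcomp_proj quot_hcomp_sum quot_hcomp_ascal quot_hcomp_mul.

Lemma qpi_hcomp n x : hcomp n (qpi x) = qpi (hcomp n x).
Proof. exact: quot_hcompE. Qed.
Lemma homog_qpi n x : homog n x -> homog n (qpi x).
Proof. by rewrite /homog qpi_hcomp => ->. Qed.
Lemma qpi_ascal c : qpi (ascal c) = ascal c. Proof. by []. Qed.

End Quotient.

(* The two-sided ideal generated by a set of homogeneous elements. *)
Section IdealGen.
Variables (k : comPzRingType) (A : grAlgType k) (S : A -> Prop).
Hypothesis S_homog : forall x, S x -> exists n, homog n x.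

Inductive ideal_gen_mem : A -> Prop :=
| ideal_gen_in x : S x -> ideal_gen_mem x
| ideal_gen_0 : ideal_gen_mem 0
| ideal_gen_D x y : ideal_gen_mem x -> ideal_gen_mem y -> ideal_gen_mem (x + y)
| ideal_gen_Ml a x : ideal_gen_mem x -> ideal_gen_mem (a * x)
| ideal_gen_Mr a x : ideal_gen_mem x -> ideal_gen_mem (x * a).

Fact ideal_gen_hcomp n x : ideal_gen_mem x -> ideal_gen_mem (hcomp n x).
Proof.
move=> Jx; elim: Jx n => {x} [x Sx|| x y _ IHx _ IHy|a x _ IH|a x _ IH] n.
- have [m hx] := S_homog Sx; have [->|ne] := eqVneq n m.
    by rewrite hx; apply: ideal_gen_in.
  by rewrite (homog_other hx) //; apply: ideal_gen_0.
- by rewrite hcomp0; apply: ideal_gen_0.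
- by rewrite hcompD; apply: ideal_gen_D.
- have [s _ ->] := hcomp_sum a; rewrite mulr_suml hcomp_bigsum.
  apply: big_ind; [exact: ideal_gen_0|exact: ideal_gen_D|] => i _.
  by rewrite (hcompMl _ _ (homog_comp i a)); apply: ideal_gen_Ml.
- have [s _ ->] := hcomp_sum a; rewrite mulr_sumr hcomp_bigsum.
  apply: big_ind; [exact: ideal_gen_0|exact: ideal_gen_D|] => i _.
  by rewrite (hcompMr _ _ (homog_comp i a)); apply: ideal_gen_Mr.
Qed.

Definition ideal_gen : hideal A :=
  HIdeal ideal_gen_0 ideal_gen_D ideal_gen_Ml ideal_gen_Mr ideal_gen_hcomp.

End IdealGen.

Record is_differential (k : comPzRingType) (A : grAlgType k) (d : A -> A) : Prop :=
  IsDifferential {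
    diffD : {morph d : x y / x + y};
    diffZ : forall c x, d (ascal c * x) = ascal c * d x;
    diff_deg : forall n x, homog n x -> homog (n - 1) (d x);
    diff_sq : forall x, d (d x) = 0;
    diff_leibniz : forall n x y, homog n x ->
      d (x * y) = d x * y + (-1) ^+ `|n|%N * (x * d y)
  }.

Record dgAlg (k : comPzRingType) := DgAlg {
  dg_alg :> grAlgType k;
  dg_d : dg_alg -> dg_alg;
  dg_dP : is_differential dg_d
}.

Arguments dg_d {k d0} : rename.

Record is_dg_hom (k : comPzRingType) (A B : dgAlg k) (f : {rmorphism A -> B}) : Prop :=
  IsDgHom {
    dg_hom_gr : is_gr_hom f;
    dg_hom_d : forall x, f (dg_d x) = dg_d (f x)
  }.

Section Homology.
Variables (k : comPzRingType) (A : dgAlg k).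
Implicit Types x y : A.

Lemma dg_dD x y : dg_d (x + y) = dg_d x + dg_d y.
Proof. exact: (diffD (dg_dP A)). Qed.
Lemma dg_d0 : dg_d (0 : A) = 0.
Proof. by apply: (addIr (dg_d 0)); rewrite -dg_dD !add0r. Qed.
Lemma dg_dN x : dg_d (- x) = - dg_d x.
Proof. by apply: (addIr (dg_d x)); rewrite -dg_dD !addNr dg_d0. Qed.
Lemma dg_d_sum (T : Type) (r : seq T) (P : pred T) (F : T -> A) :
  dg_d (\sum_(j <- r | P j) F j) = \sum_(j <- r | P j) dg_d (F j).
Proof. by apply: big_morph; [exact: dg_dD | exact: dg_d0]. Qed.
Lemma dg_d1 : dg_d (1 : A) = 0.
Proof.
have := diff_leibniz (dg_dP A) 1 (homog1 A).
rewrite !mulr1 expr0 !mul1r => e.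
by apply: (addrI (dg_d 1)); rewrite -e addr0.
Qed.
Lemma dg_d_hcomp n x : dg_d (hcomp n x) = hcomp (n - 1) (dg_d x).
Proof.
have [s us e] := hcomp_sum x; rewrite {2}e dg_d_sum hcomp_bigsum {1}e hcomp_bigsum.
rewrite dg_d_sum; apply: eq_bigr => i _.
have hd := diff_deg (dg_dP A) (homog_comp i x); rewrite hcomp_proj.
have [e'|ne] := eqVneq n i; first by rewrite -e' in hd *; rewrite hd.
by rewrite dg_d0 (homog_other hd) // (inj_eq (addIr _)).
Qed.

Definition is_cycle : pred A := fun x => dg_d x == 0.

Lemma is_cycleP x : reflect (dg_d x = 0) (x \in is_cycle).
Proof. exact: eqP. Qed.
Lemma cycle_hcomp n x : x \in is_cycle -> hcomp n x \in is_cycle.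
Proof. by move/is_cycleP=> e; apply/is_cycleP; rewrite dg_d_hcomp e hcomp0. Qed.

Fact is_cycle_subring : subring_closed is_cycle.
Proof.
split=> [|x y /is_cycleP ex /is_cycleP ey|x y cx /is_cycleP ey].
- by apply/is_cycleP; rewrite dg_d1.
- by apply/is_cycleP; rewrite dg_dD dg_dN ex ey subrr.
- have [s us e] := hcomp_sum x; apply/is_cycleP.
  rewrite e mulr_suml dg_d_sum big1 // => n _.
  rewrite (diff_leibniz (dg_dP A) _ (homog_comp n x)) ey mulr0 mulr0 addr0.
  by rewrite (is_cycleP _ (cycle_hcomp n cx)) mul0r.
Qed.

HB.instance Definition _ := GRing.isSubringClosed.Build A is_cycle is_cycle_subring.

Definition cycles := {x : A | x \in is_cycle}.
HB.instance Definition _ := Choice.on cycles.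
HB.instance Definition _ := SubChoice.on cycles.
HB.instance Definition _ := [SubChoice_isSubZmodule of cycles by <:].
HB.instance Definition _ := 
  GRing.SubZmodule_isSubPzRing.Build A _ cycles is_cycle_subring.

Lemma cycleP (z : cycles) : dg_d (val z) = 0.
Proof. exact/is_cycleP/(valP z). Qed.

Fact ascal_cycle c : (ascal c : A) \in is_cycle.
Proof.
by apply/is_cycleP; rewrite -[ascal c]mulr1 (diffZ (dg_dP A)) dg_d1 mulr0.
Qed.

Definition cyc_ascal (c : k) : cycles := exist _ (ascal c) (ascal_cycle c).
Definition cyc_hcomp n (z : cycles) : cycles :=
  exist _ (hcomp n (val z)) (cycle_hcomp n (valP z)).

Fact cyc_ascalD : {morph cyc_ascal : x y / x + y}.
Proof. by move=> x y; apply: val_inj; rewrite /= ascalD. Qed.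
Fact cyc_ascalM : {morph cyc_ascal : x y / x * y}.
Proof. by move=> x y; apply: val_inj; rewrite /= ascalM. Qed.
Fact cyc_ascal1 : cyc_ascal 1 = 1.
Proof. by apply: val_inj; rewrite /= ascal1. Qed.
Fact cyc_ascalC c u : cyc_ascal c * u = u * cyc_ascal c.
Proof. by apply: val_inj; rewrite /= ascalC. Qed.
Fact cyc_hcompD n : {morph cyc_hcomp n : x y / x + y}.
Proof. by move=> x y; apply: val_inj; rewrite /= hcompD. Qed.
Fact cyc_hcomp_proj m n u :
  cyc_hcomp m (cyc_hcomp n u) = if m == n then cyc_hcomp n u else 0.
Proof. by apply: val_inj; rewrite /= hcomp_proj; case: ifP. Qed.
Fact cyc_hcomp_sum u :
  exists2 s : seq int, uniq s & u = \sum_(n <- s) cyc_hcomp n u.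
Proof.
have [s us e] := hcomp_sum (val u); exists s => //.
by apply: val_inj; rewrite raddf_sum {1}e.
Qed.
Fact cyc_hcomp_ascal c : cyc_hcomp 0 (cyc_ascal c) = cyc_ascal c.
Proof. by apply: val_inj; rewrite /= hcomp_ascal. Qed.
Fact cyc_hcomp_mul m n u v : cyc_hcomp m u = u -> cyc_hcomp n v = v ->
  cyc_hcomp (m + n) (u * v) = u * v.
Proof.
move=> /(congr1 val) eu /(congr1 val) ev; apply: val_inj.
exact: (homogM eu ev).
Qed.

HB.instance Definition _ := PzRing_isGradedAlg.Build k cycles
  cyc_ascalD cyc_ascalM cyc_ascal1 cyc_ascalC cyc_hcompD
  cyc_hcomp_proj cyc_hcomp_sum cyc_hcomp_ascal cyc_hcomp_mul.

Lemma val_hcomp n (z : cycles) : val (hcomp n z) = hcomp n (val z).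
Proof. by []. Qed.

Definition is_boundary (z : cycles) : Prop := exists y : A, val z = dg_d y.

Fact boundary0 : is_boundary 0.
Proof. by exists 0; rewrite dg_d0. Qed.
Fact boundaryD z t : is_boundary z -> is_boundary t -> is_boundary (z + t).
Proof. by move=> [x ex] [y ey]; exists (x + y); rewrite dg_dD -ex -ey. Qed.
Fact boundary_hcomp n z : is_boundary z -> is_boundary (hcomp n z).
Proof.
move=> [x ex]; exists (hcomp (n + 1) x).
by rewrite dg_d_hcomp -ex addrK.
Qed.
Lemma dg_d_sign e x : dg_d ((-1) ^+ e * x) = (-1) ^+ e * dg_d x.
Proof.
by rewrite -signr_odd; case: (odd e); rewrite ?expr1 ?mulN1r ?dg_dN ?expr0 ?mul1r.
Qed.
Fact boundaryMl a z : is_boundary z -> is_boundary (a * z).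
Proof.
move=> [x ex]; have [s _ ->] := hcomp_sum a; rewrite mulr_suml.
apply: big_ind; [exact: boundary0|exact: boundaryD|] => n _.
exists ((-1) ^+ `|n|%N * (val (hcomp n a) * x)).
have hn : homog n (val (hcomp n a)) by rewrite val_hcomp; apply: homog_comp.
rewrite dg_d_sign (diff_leibniz (dg_dP A) _ hn) cycleP mul0r add0r.
by rewrite mulrA -expr2 sqrr_sign mul1r -ex.
Qed.
Fact boundaryMr a z : is_boundary z -> is_boundary (z * a).
Proof.
move=> [x ex]; have [s _ e] := hcomp_sum x; exists (x * val a).
rewrite {1}e mulr_suml dg_d_sum.
under eq_bigr => n _.
  rewrite (diff_leibniz (dg_dP A) _ (homog_comp n x)) cycleP !mulr0 addr0.
  over.
by rewrite -mulr_suml -dg_d_sum -e -ex.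
Qed.

Definition boundaries : hideal cycles :=
  HIdeal boundary0 boundaryD boundaryMl boundaryMr boundary_hcomp.

Definition homology : grAlgType k := quot boundaries.

End Homology.

Section ZeroDifferential.
Variables (k : comPzRingType) (A : grAlgType k).

Fact zero_is_differential : is_differential (fun _ : A => 0).
Proof.
split=> // [x y|c x|n x _|n x y _]; rewrite ?addr0 ?mulr0 //.
  exact: homog0.
by rewrite mul0r addr0.
Qed.

Definition zero_dg : dgAlg k := DgAlg zero_is_differential.

End ZeroDifferential.

Section InducedMap.
Variables (k : comPzRingType) (A B : dgAlg k) (f : {rmorphism A -> B}).
Hypothesis fP : is_dg_hom f.

Fact cyc_map_subproof (z : cycles A) : f (val z) \in @is_cycle k B.
Proof. by apply/is_cycleP; rewrite -(dg_hom_d fP) cycleP rmorph0. Qed.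

Definition cyc_map (z : cycles A) : cycles B :=
  exist _ (f (val z)) (cyc_map_subproof z).

Definition homology_map (h : homology A) : homology B :=
  qpi (boundaries B) (cyc_map (repr h)).

Lemma homology_mapE z :
  homology_map (qpi (boundaries A) z) = qpi (boundaries B) (cyc_map z).
Proof.
apply/qpiP; have [y ey] := quot_repr (boundaries A) z.
exists (f y); rewrite -(dg_hom_d fP) -ey /=.
by rewrite !rmorphB.
Qed.

End InducedMap.

Definition quasi_iso_step (k : comPzRingType) (A B : dgAlg k) : Prop :=
  exists (f : {rmorphism A -> B}) (fP : is_dg_hom f), bijective (homology_map fP).

(* Quasi-isomorphic dg-algebras: connected by a zigzag of quasi-isomorphisms. *)
Definition quasi_isomorphic (k : comPzRingType) : dgAlg k -> dgAlg k -> Prop :=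
  clos_refl_sym_trans (dgAlg k) (@quasi_iso_step k).

Definition formal (k : comPzRingType) (A : dgAlg k) : Prop :=
  quasi_isomorphic A (zero_dg (homology A)).

(* The free k-algebra on G, with g in degree [deg g], as the quotient of formal
   expressions by the axioms of central k-algebras. *)
Inductive fterm (k G : Type) : Type :=
| FGen of G
| FConst of k
| FAdd of fterm k G & fterm k G
| FMul of fterm k G & fterm k G.

Arguments FGen {k G}.
Arguments FConst {k G}.

HB.instance Definition _ (k G : Type) := gen_eqMixin (fterm k G).
HB.instance Definition _ (k G : Type) := gen_choiceMixin (fterm k G).

Inductive feq (k : comPzRingType) (G : Type) : fterm k G -> fterm k G -> Prop :=
| feq_refl s : feq s s
| feq_sym s t : feq s t -> feq t s
| feq_trans s t u : feq s t -> feq t u -> feq s u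
| feq_add s s' t t' : feq s s' -> feq t t' -> feq (FAdd s t) (FAdd s' t')
| feq_mul s s' t t' : feq s s' -> feq t t' -> feq (FMul s t) (FMul s' t')
| feq_addA s t u : feq (FAdd s (FAdd t u)) (FAdd (FAdd s t) u)
| feq_addC s t : feq (FAdd s t) (FAdd t s)
| feq_add0 t : feq (FAdd (FConst 0) t) t
| feq_addN t : feq (FAdd (FMul (FConst (-1)) t) t) (FConst 0)
| feq_mulA s t u : feq (FMul s (FMul t u)) (FMul (FMul s t) u)
| feq_mul1 t : feq (FMul (FConst 1) t) t
| feq_mulDl s t u : feq (FMul (FAdd s t) u) (FAdd (FMul s u) (FMul t u))
| feq_mulDr s t u : feq (FMul s (FAdd t u)) (FAdd (FMul s t) (FMul s u))
| feq_constD a b : feq (FConst (a + b)) (FAdd (FConst a) (FConst b))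
| feq_constM a b : feq (FConst (a * b)) (FMul (FConst a) (FConst b))
| feq_constC a t : feq (FMul (FConst a) t) (FMul t (FConst a)).

Section FreeAlgebra.
Variables (k : comPzRingType) (G : Type) (deg : G -> nat).
Local Notation T := (fterm k G).

Definition feqb : rel T := fun s t => `[< feq s t >].

Lemma feqb_refl : reflexive feqb.
Proof. by move=> s; apply/asboolP; apply: feq_refl. Qed.
Lemma feqb_sym : symmetric feqb.
Proof. by move=> s t; apply: asbool_equiv_eq; split; apply: feq_sym. Qed.
Lemma feqb_trans : transitive feqb.
Proof.
by move=> t s u /asboolP h1 /asboolP h2; apply/asboolP; apply: feq_trans h2.
Qed.

Canonical feq_equiv := EquivRel feqb feqb_refl feqb_sym feqb_trans.

(* [deg] is only used by the grading, but has to be part of the type. *)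
Definition freealg_of of (G -> nat) := {eq_quot feqb}.
Notation F := (freealg_of deg).
HB.instance Definition _ := Choice.on F.

Definition fpi (t : T) : F := \pi_({eq_quot feqb}) t.
Definition frepr (u : F) : T := repr (u : {eq_quot feqb}).

Lemma fpiP s t : fpi s = fpi t <-> feq s t.
Proof.
split; first by move/eqmodP => /asboolP.
by move=> h; apply/eqmodP/asboolP.
Qed.

Lemma freprK u : fpi (frepr u) = u.
Proof. exact: reprK. Qed.

Lemma frepr_feq t : feq (frepr (fpi t)) t.
Proof. by apply/fpiP; rewrite freprK. Qed.

Lemma free_ind (P : F -> Prop) : (forall t, P (fpi t)) -> forall u, P u.
Proof. by move=> h u; rewrite -[u]freprK; apply: h. Qed.

Definition free_add (u v : F) : F := fpi (FAdd (frepr u) (frepr v)).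
Definition free_opp (u : F) : F := fpi (FMul (FConst (-1)) (frepr u)).
Definition free_mul (u v : F) : F := fpi (FMul (frepr u) (frepr v)).

Lemma free_addE s t : free_add (fpi s) (fpi t) = fpi (FAdd s t).
Proof. by apply/fpiP; apply: feq_add; apply: frepr_feq. Qed.
Lemma free_oppE s : free_opp (fpi s) = fpi (FMul (FConst (-1)) s).
Proof. by apply/fpiP; apply: feq_mul; [apply: feq_refl|apply: frepr_feq]. Qed.
Lemma free_mulE s t : free_mul (fpi s) (fpi t) = fpi (FMul s t).
Proof. by apply/fpiP; apply: feq_mul; apply: frepr_feq. Qed.

Fact free_addA : associative free_add.
Proof.
by do 3![elim/free_ind=> ?]; rewrite !free_addE; apply/fpiP; apply: feq_addA.
Qed.
Fact free_addC : commutative free_add.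
Proof.
by do 2![elim/free_ind=> ?]; rewrite !free_addE; apply/fpiP; apply: feq_addC.
Qed.
Fact free_add0 : left_id (fpi (FConst 0)) free_add.
Proof.
by elim/free_ind=> ?; rewrite !free_addE; apply/fpiP; apply: feq_add0.
Qed.
Fact free_addN : left_inverse (fpi (FConst 0)) free_opp free_add.
Proof.
elim/free_ind=> ?; rewrite free_oppE free_addE; apply/fpiP; exact: feq_addN.
Qed.
Fact free_mulA : associative free_mul.
Proof.
by do 3![elim/free_ind=> ?]; rewrite !free_mulE; apply/fpiP; apply: feq_mulA.
Qed.
Fact free_mul1 : left_id (fpi (FConst 1)) free_mul.
Proof.
by elim/free_ind=> ?; rewrite !free_mulE; apply/fpiP; apply: feq_mul1.
Qed.
Fact free_mulr1 : right_id (fpi (FConst 1)) free_mul.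
Proof.
elim/free_ind=> t; rewrite !free_mulE; apply/fpiP.
by apply: feq_trans (feq_mul1 t); apply: feq_sym; apply: feq_constC.
Qed.
Fact free_mulDl : left_distributive free_mul free_add.
Proof.
by do 3![elim/free_ind=> ?]; rewrite !(free_mulE, free_addE); apply/fpiP;
   apply: feq_mulDl.
Qed.
Fact free_mulDr : right_distributive free_mul free_add.
Proof.
by do 3![elim/free_ind=> ?]; rewrite !(free_mulE, free_addE); apply/fpiP;
   apply: feq_mulDr.
Qed.

HB.instance Definition _ := GRing.isZmodule.Build F
  free_addA free_addC free_add0 free_addN.
HB.instance Definition _ := GRing.Zmodule_isPzRing.Build F
  free_mulA free_mul1 free_mulr1 free_mulDl free_mulDr.

Lemma fpiD s t : fpi (FAdd s t) = fpi s + fpi t.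
Proof. by rewrite -free_addE. Qed.
Lemma fpiM s t : fpi (FMul s t) = fpi s * fpi t.
Proof. by rewrite -free_mulE. Qed.

Definition free_const (c : k) : F := fpi (FConst c).

Fact free_constD : {morph free_const : x y / x + y}.
Proof. by move=> a b; rewrite -fpiD; apply/fpiP; apply: feq_constD. Qed.
Fact free_constM : {morph free_const : x y / x * y}.
Proof. by move=> a b; rewrite -fpiM; apply/fpiP; apply: feq_constM. Qed.
Fact free_const1 : free_const 1 = 1. Proof. by []. Qed.
Fact free_const0 : free_const 0 = 0. Proof. by []. Qed.
Fact free_constC c u : free_const c * u = u * free_const c.
Proof.
elim/free_ind: u => t; rewrite -!fpiM; apply/fpiP; exact: feq_constC.
Qed.

Fixpoint tcomp (n : nat) (t : T) : F :=
  match t with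
  | FGen g => if deg g == n then fpi (FGen g) else 0
  | FConst c => if n == 0%N then free_const c else 0
  | FAdd s t => tcomp n s + tcomp n t
  | FMul s t => \sum_(i < n.+1) tcomp i s * tcomp (n - i) t
  end.

Lemma tcomp_constM c n t :
  \sum_(i < n.+1) tcomp i (FConst c) * tcomp (n - i) t = free_const c * tcomp n t.
Proof.
rewrite big_ord_recl /= subn0 big1 ?addr0 // => i _.
by rewrite mul0r.
Qed.

Lemma tcomp_Mconst c n t :
  \sum_(i < n.+1) tcomp i t * tcomp (n - i) (FConst c) = tcomp n t * free_const c.
Proof.
rewrite big_ord_recr /= subnn eqxx big1 ?add0r // => i _.
by rewrite subn_eq0 leqNgt ltn_ord mulr0.
Qed.

Lemma tcomp_mulA n s t u :
  tcomp n (FMul s (FMul t u)) = tcomp n (FMul (FMul s t) u).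
Proof.
pose c i j := tcomp i s * (tcomp j t * tcomp (n - i - j) u).
transitivity (\sum_(l < n.+1) \sum_(i < n.+1 | (i <= l)%N) c i (l - i)%N); last first.
  apply: eq_bigr => l _ /=; rewrite mulr_suml.
  rewrite (big_ord_widen n.+1 (fun i => tcomp i s * tcomp (l - i) t * tcomp (n - l) u)) //.
  apply: eq_bigr => i le_il; rewrite /c mulrA.
  by rewrite -subnDA subnKC.
rewrite (exchange_big_dep xpredT) //=; apply: eq_bigr => i _.
transitivity (\sum_(0 + i <= l < n.+1) c i (l - i)%N); last first.
  by rewrite add0n big_geq_mkord.
rewrite mulr_sumr big_addn big_mkord subSn; last by rewrite -ltnS.
by apply: eq_bigr => j _; rewrite addnK.
Qed.

Lemma tcomp_feq n s t : feq s t -> tcomp n s = tcomp n t.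
Proof.
move=> st; elim: st n => {s t}.
- by [].
- by move=> s t _ IH n.
- by move=> s t u _ IH1 _ IH2 n; rewrite IH1.
- by move=> s s' t t' _ IH1 _ IH2 n /=; rewrite IH1 IH2.
- by move=> s s' t t' _ IH1 _ IH2 n /=; apply: eq_bigr => i _; rewrite IH1 IH2.
- by move=> s t u n /=; rewrite addrA.
- by move=> s t n /=; rewrite addrC.
- by move=> t n /=; case: eqP; rewrite ?free_const0 add0r.
- move=> t n; rewrite [LHS]/= tcomp_constM /=.
  have -> : free_const (-1) = -1.
    by apply: (addIr 1); rewrite addNr -[X in _ + X]free_const1 -free_constD addNr.
  by rewrite mulN1r addNr; case: eqP; rewrite ?free_const0.
- by move=> s t u n; apply: tcomp_mulA.
- by move=> t n; rewrite [LHS]tcomp_constM free_const1 mul1r.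
- move=> s t u n /=; rewrite -big_split /=; apply: eq_bigr => i _.
  by rewrite mulrDl.
- move=> s t u n /=; rewrite -big_split /=; apply: eq_bigr => i _.
  by rewrite mulrDr.
- by move=> a b n /=; case: eqP; rewrite ?addr0 ?free_constD.
- move=> a b n; rewrite [RHS](tcomp_constM a n (FConst b)) /=.
  by case: eqP; rewrite ?mulr0 ?free_constM.
- move=> a t n; rewrite [LHS](tcomp_constM a n t) [RHS](tcomp_Mconst a n t).
  exact: free_constC.
Qed.

Definition free_ncomp (n : nat) (u : F) : F := tcomp n (frepr u).

Definition free_hcomp (n : int) (u : F) : F :=
  if n is Posz n then free_ncomp n u else 0.

Lemma free_ncompE n t : free_ncomp n (fpi t) = tcomp n t.
Proof. by apply: tcomp_feq; apply: frepr_feq. Qed.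

Lemma free_ncompD n u v : free_ncomp n (u + v) = free_ncomp n u + free_ncomp n v.
Proof.
elim/free_ind: u => s; elim/free_ind: v => t.
by rewrite -fpiD !free_ncompE.
Qed.

Lemma free_ncomp0 n : free_ncomp n 0 = 0.
Proof. by apply: (addIr (free_ncomp n 0)); rewrite -free_ncompD !add0r. Qed.

Lemma free_ncomp_sum n (S : Type) (r : seq S) (P : pred S) (E : S -> F) :
  free_ncomp n (\sum_(j <- r | P j) E j) = \sum_(j <- r | P j) free_ncomp n (E j).
Proof. by apply: big_morph; [exact: free_ncompD | exact: free_ncomp0]. Qed.

Lemma free_ncompM n u v :
  free_ncomp n (u * v) = \sum_(i < n.+1) free_ncomp i u * free_ncomp (n - i) v.
Proof.
elim/free_ind: u => s; elim/free_ind: v => t.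
by rewrite -fpiM free_ncompE /=; apply: eq_bigr => i _; rewrite !free_ncompE.
Qed.

Lemma tcomp_proj m n t :
  free_ncomp m (tcomp n t) = if m == n then tcomp n t else 0.
Proof.
elim: t m n => [g|c|s IHs t IHt|s IHs t IHt] m n /=.
- case: (eqVneq (deg g) n) => [<-|_]; last by rewrite free_ncomp0 if_same.
  by rewrite free_ncompE /= eq_sym.
- case: (eqVneq n 0%N) => [->|_]; last by rewrite free_ncomp0 if_same.
  by rewrite free_ncompE.
- by rewrite free_ncompD IHs IHt; case: eqP; rewrite ?addr0.
- rewrite free_ncomp_sum.
  have e (i : 'I_n.+1) : free_ncomp m (tcomp i s * tcomp (n - i) t) =
      if m == n then tcomp i s * tcomp (n - i) t else 0.
    rewrite free_ncompM.
    have lin : (i <= n)%N by rewrite -ltnS.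
    have [lim|lmi] := leqP i m; last first.
      rewrite big1 => [|j _].
        by case: eqP => // emn; rewrite emn ltnNge lin in lmi.
      rewrite IHs; case: eqP => [ji|_]; last by rewrite mul0r.
      by have := ltn_ord j; rewrite ji ltnS leqNgt lmi.
    rewrite (bigD1 (Ordinal (lim : (i < m.+1)%N))) //= big1 ?addr0.
      rewrite IHs IHt eqxx; have -> : (m - i == n - i)%N = (m == n).
        by rewrite -(eqn_add2r i) !subnK.
      by case: eqP; rewrite ?mulr0.
    move=> j ne; rewrite IHs; case: eqP => [ji|_]; last by rewrite mul0r.
    by case/eqP: ne; apply: val_inj.
  rewrite (eq_bigr _ (fun i _ => e i)); case: eqP => // _.
  by rewrite big1.
Qed.

Fact free_hcompD n : {morph free_hcomp n : x y / x + y}.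
Proof. by case: n => n u v /=; rewrite ?free_ncompD ?addr0. Qed.

Fact free_hcomp_proj m n u :
  free_hcomp m (free_hcomp n u) = if m == n then free_hcomp n u else 0.
Proof.
case: n m => n [] m /=; rewrite ?free_ncomp0 ?if_same //.
by rewrite [free_ncomp n u]/free_ncomp tcomp_proj.
Qed.

Fact free_hcomp_const c : free_hcomp 0 (free_const c) = free_const c.
Proof. by rewrite /= free_ncompE. Qed.

Fact free_hcomp_mul m n u v : free_hcomp m u = u -> free_hcomp n v = v ->
  free_hcomp (m + n) (u * v) = u * v.
Proof.
have h0 p : free_hcomp p 0 = 0 by case: p => p //=; rewrite free_ncomp0.
case: m n => m [] n /= eu ev; [|by rewrite -ev mulr0 ?h0|
  by rewrite -eu mul0r ?h0|by rewrite -ev mulr0 ?h0].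
have pr p q w : free_ncomp p (free_ncomp q w) = if p == q then free_ncomp q w else 0.
  exact: tcomp_proj.
rewrite free_ncompM.
have lm : (m < (m + n).+1)%N by rewrite ltnS leq_addr.
rewrite (bigD1 (Ordinal lm)) //= big1 ?addr0.
  by rewrite addKn eu ev.
move=> i ne; rewrite -{1}eu pr; case: eqP => [im|_]; last by rewrite mul0r.
by case/eqP: ne; apply: val_inj.
Qed.

Fact free_hcomp_sum u :
  exists2 s : seq int, uniq s & u = \sum_(n <- s) free_hcomp n u.
Proof.
have pr p q w : free_ncomp p (free_ncomp q w) = if p == q then free_ncomp q w else 0.
  exact: tcomp_proj.
suff [N eN] : exists N, forall M, (N <= M)%N -> u = \sum_(n < M) free_ncomp n u.
  exists [seq Posz i | i <- index_iota 0 N]; first by rewrite map_inj_uniq ?iota_uniq // => i j [].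
  by rewrite big_map big_mkord; apply: eN.
have widen N w : w = \sum_(n < N) free_ncomp n w ->
    forall M, (N <= M)%N -> w = \sum_(n < M) free_ncomp n w.
  move=> e M le; rewrite {1}e (big_ord_widen M (fun n => free_ncomp n w)) //.
  rewrite [RHS](bigID (fun n : 'I_M => (n < N)%N)) /= [X in _ + X]big1 ?addr0 //.
  move=> i Ni; rewrite e free_ncomp_sum big1 // => j _; rewrite pr.
  by case: eqP => // ij; rewrite ij ltn_ord in Ni.
elim/free_ind: u => t; elim: t => [g|c|s [N1 e1] t [N2 e2]|s [N1 e1] t [N2 e2]].
- exists (deg g).+1; apply: widen; rewrite big_ord_recr /= free_ncompE /= eqxx.
  rewrite big1; last by move=> i _; rewrite free_ncompE /= gtn_eqF.
  by rewrite add0r.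
- by exists 1%N; apply: widen; rewrite big_ord1 free_ncompE.
- exists (maxn N1 N2) => M; rewrite geq_max => /andP[l1 l2].
  rewrite fpiD {1}(e1 M l1) {1}(e2 M l2) -big_split /=.
  by apply: eq_bigr => i _; rewrite free_ncompD.
- exists (N1 + N2)%N; apply: widen; rewrite fpiM.
  set x := fpi s; set y := fpi t.
  have hx : x = \sum_(n < N1) free_ncomp n x by apply: e1.
  have hy : y = \sum_(n < N2) free_ncomp n y by apply: e2.
  have main i j : (i < N1)%N -> (j < N2)%N ->
     let z := free_ncomp i x * free_ncomp j y in
     z = \sum_(n < N1 + N2) free_ncomp n z.
    move=> li lj z.
    have hz : free_ncomp (i + j) z = z.
      by apply: (@free_hcomp_mul (Posz i) (Posz j)); rewrite /= pr eqxx.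
    have lij : (i + j < N1 + N2)%N by rewrite -addSn leq_add // ltnW.
    rewrite (bigD1 (Ordinal lij)) //= hz big1 ?addr0 // => l ne.
    rewrite -hz pr; case: eqP => // e; by case/eqP: ne; apply: val_inj.
  have -> : x * y = \sum_(i < N1) \sum_(j < N2) free_ncomp i x * free_ncomp j y.
    by rewrite {1}hx {1}hy mulr_suml; apply: eq_bigr => i _; rewrite mulr_sumr.
  pose z i j := free_ncomp i x * free_ncomp j y.
  rewrite [RHS](eq_bigr (fun n : 'I_(N1 + N2) =>
      \sum_(i < N1) \sum_(j < N2) free_ncomp n (z i j))); last first.
    by move=> n _; rewrite free_ncomp_sum; apply: eq_bigr => i _; rewrite free_ncomp_sum.
  rewrite [RHS]exchange_big /=; apply: eq_bigr => i _.
  by rewrite [RHS]exchange_big /=; apply: eq_bigr => j _; apply: main.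
Qed.

HB.instance Definition _ := PzRing_isGradedAlg.Build k F
  free_constD free_constM free_const1 free_constC free_hcompD
  free_hcomp_proj free_hcomp_sum free_hcomp_const free_hcomp_mul.

Definition fgen (g : G) : F := fpi (FGen g).

Lemma homog_fgen g : homog (deg g) (fgen g).
Proof. by rewrite /homog /hcomp /= free_ncompE /= eqxx. Qed.

End FreeAlgebra.

(* Y has a Z-basis. *)
Definition free_abelian (Y : zmodType) : Prop :=
  exists (B : choiceType) (b : B -> Y),
    (forall (s : seq B) (c : B -> int), uniq s ->
       \sum_(x <- s) b x *~ c x = 0 -> {in s, forall x, c x = 0}) /\
    (forall y, exists (s : seq B) (c : B -> int), y = \sum_(x <- s) b x *~ c x).

Record cartanDatum := CartanDatum {
  cd_I :> finType;
  cd_a : cd_I -> cd_I -> int;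
  cd_d : cd_I -> nat;
  cd_Y : zmodType;
  cd_alpha : cd_I -> cd_Y;
  cd_coroot : cd_I -> {additive cd_Y -> int};
  cd_form : cd_Y -> cd_Y -> int;
  cd_a_diag : forall i, cd_a i i = 2;
  cd_a_off : forall i j, i != j -> cd_a i j <= 0;
  cd_a_zero : forall i j, cd_a i j = 0 -> cd_a j i = 0;
  cd_d_gt0 : forall i, (0 < cd_d i)%N;
  cd_symm : forall i j, (cd_d i)%:Z * cd_a i j = (cd_d j)%:Z * cd_a j i;
  cd_Y_free : free_abelian cd_Y;
  cd_alpha_indep : forall c : cd_I -> int,
    \sum_i cd_alpha i *~ c i = 0 -> forall i, c i = 0;
  cd_corootE : forall i j, cd_coroot i (cd_alpha j) = cd_a i j;
  cd_form_sym : forall x y, cd_form x y = cd_form y x;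
  cd_formD : forall x y z, cd_form (x + y) z = cd_form x z + cd_form y z;
  cd_formE : forall i j,
    cd_form (cd_alpha i) (cd_alpha j) = (cd_d i)%:Z * cd_a i j
}.

(* The numbers d_ij = - a_ij, meaningful for i != j. *)
Definition dnum (C : cartanDatum) (i j : C) : nat := `|- cd_a i j|%N.

Definition invertible (k : comPzRingType) (c : k) : Prop := exists c', c * c' = 1.

Record klrScalars (C : cartanDatum) (k : comPzRingType) := KLRScalars {
  sc_r : C -> k;
  sc_t : C -> C -> k;
  sc_s : C -> C -> nat -> nat -> k;
  sc_r_inv : forall i, invertible (sc_r i);
  sc_t_inv : forall i j, invertible (sc_t i j);
  sc_t_diag : forall i, sc_t i i = 1;
  sc_t_sym : forall i j, i != j -> dnum i j = 0%N -> sc_t i j = sc_t j i;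
  sc_s_sym : forall i j t v, i != j -> sc_s i j t v = sc_s j i v t;
  sc_s_left : forall i j, i != j -> sc_s i j (dnum i j) 0%N = sc_t i j;
  sc_s_right : forall i j, i != j -> sc_s i j 0%N (dnum j i) = sc_t j i;
  sc_s_zero : forall i j t v, i != j ->
    t%:Z * cd_form (cd_alpha i) (cd_alpha i)
      + v%:Z * cd_form (cd_alpha j) (cd_alpha j)
      <> - 2 * cd_form (cd_alpha i) (cd_alpha j) ->
    sc_s i j t v = 0
}.

Section KLR.
Variables (C : cartanDatum) (k : comPzRingType) (Q : klrScalars C k) (m : nat).

Inductive rb_gen : Type :=
| GIdem of m.-tuple C
| GDot of {l : nat | (0 < l <= m)%N}
| GCross of {l : nat | (0 < l < m)%N}
| GFloat of {l : nat | (l <= m)%N} & C & nat.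

Definition rb_deg (g : rb_gen) : nat := if g is GFloat _ _ _ then 1 else 0.

Definition rb_free : grAlgType k := freealg_of k rb_deg.

Definition fe (i : m.-tuple C) : rb_free := fgen k rb_deg (GIdem i).

(* Strands are numbered from 1.  The next three are junk (zero) when the index
   is out of range; the relations below either force their indices to be in
   range through [colour] or read 0 = 0 out of range. *)
Definition fx (l : nat) : rb_free :=
  oapp (fun p => fgen k rb_deg (GDot p)) 0 (insub l).
Definition ftau (l : nat) : rb_free :=
  oapp (fun p => fgen k rb_deg (GCross p)) 0 (insub l).
Definition fom (l : nat) (j : C) (a : nat) : rb_free :=
  oapp (fun p => fgen k rb_deg (GFloat p j a)) 0 (insub l).

(* [colour i l j] says that 1 <= l <= m and that the l-th entry of i is j. *)
Definition colour (i : m.-tuple C) (l : nat) (j : C) : bool :=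
  [exists p : 'I_m, (p.+1 == l) && (tnth i p == j)].

(* Exchanges the entries l and l+1, for 1 <= l < m. *)
Definition swap_pos (l p : nat) : nat :=
  if p == l.-1 then l else if p == l then l.-1 else p.
Definition swap (l : nat) (i : m.-tuple C) : m.-tuple C :=
  [tuple tnth i (insubd p (swap_pos l p)) | p < m].

(* The sum over all t, v in nat of s_ij^tv f(t,v), for i != j: a nonzero
   s_ij^tv forces t d_i + v d_j = d_i d_ij = d_j d_ji, whence the bounds. *)
Definition ssum (i j : C) (f : nat -> nat -> rb_free) : rb_free :=
  \sum_(t < (dnum i j).+1) \sum_(v < (dnum j i).+1) ascal (sc_s Q i j t v) * f t v.

Inductive rb_rel : rb_free -> rb_free -> Prop :=
| rel_idem i i' : rb_rel (fe i * fe i') (if i == i' then fe i else 0)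
| rel_one : rb_rel (\sum_i fe i) 1
| rel_dot_idem l i : rb_rel (fx l * fe i) (fe i * fx l)
| rel_float_idem l j a i : rb_rel (fom l j a * fe i) (fe i * fom l j a)
| rel_cross_idem l i : (0 < l < m)%N ->
    rb_rel (ftau l * fe i) (fe (swap l i) * ftau l)
| rel_dot_dot l l' : rb_rel (fx l * fx l') (fx l' * fx l)
| rel_cross_cross l l' : (l.+1 < l')%N || (l'.+1 < l)%N ->
    rb_rel (ftau l * ftau l') (ftau l' * ftau l)
| rel_cross_dot l l' : l' != l -> l' != l.+1 ->
    rb_rel (ftau l * fx l') (fx l' * ftau l)
| rel_float_dot l j a l' : rb_rel (fom l j a * fx l') (fx l' * fom l j a)
| rel_float_cross l j a l' : l' != l ->
    rb_rel (fom l j a * ftau l') (ftau l' * fom l j a)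
| rel_quad_eq i l j : colour i l j -> colour i l.+1 j ->
    rb_rel (ftau l ^+ 2 * fe i) 0
| rel_quad_neq i l j j' : colour i l j -> colour i l.+1 j' -> j != j' ->
    rb_rel (ftau l ^+ 2 * fe i)
           (ssum j j' (fun t v => fx l ^+ t * fx l.+1 ^+ v * fe i))
| rel_dot_cross_colour i l j j' : colour i l j -> colour i l.+1 j' ->
    rb_rel (fx l * ftau l * fe i)
           (ftau l * fx l.+1 * fe i
            + if j == j' then ascal (sc_r Q j) * fe i else 0)
| rel_cross_dot_colour i l j j' : colour i l j -> colour i l.+1 j' ->
    rb_rel (ftau l * fx l * fe i)
           (fx l.+1 * ftau l * fe i
            + if j == j' then ascal (sc_r Q j) * fe i else 0)
| rel_braid i l j j' j'' :
    colour i l j -> colour i l.+1 j' -> colour i l.+2 j'' ->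
    rb_rel ((ftau l * ftau l.+1 * ftau l - ftau l.+1 * ftau l * ftau l.+1) * fe i)
           (if (j == j'') && (j != j') then
              ascal (sc_r Q j) *
                ssum j j' (fun t v => \sum_(u < t)
                  fx l ^+ u * fx l.+1 ^+ v * fx l.+2 ^+ (t.-1 - u) * fe i)
            else 0)
| rel_float_float l j a l' j' a' :
    rb_rel (fom l j a * fom l' j' a') (- (fom l' j' a' * fom l j a))
| rel_float_sq l j a : rb_rel (fom l j a ^+ 2) 0
| rel_float_left j a : rb_rel (fom 0 j a) 0
| rel_float_same i l j a : colour i l j ->
    rb_rel (fom l j a.+1 * fe i)
           (fom l.-1 j a * fe i - fom l j a * fx l * fe i)
| rel_float_other i l i' j a : colour i l i' -> i' != j ->
    rb_rel (fom l j a * fe i)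
           (ssum i' j (fun t v =>
              (-1) ^+ v * fx l ^+ t * fom l.-1 j (a + v) * fe i))
| rel_float_bubble i l i' j a : colour i l i' -> colour i l.+1 j -> i' != j ->
    rb_rel (ftau l * fom l j a * ftau l * fe i)
           (fom l.+1 j a * fe i
            + ssum i' j (fun t v => \sum_(u < v)
                (-1) ^+ u * fom l.-1 j (a + u) * fx l ^+ t
                  * fx l.+1 ^+ (v.-1 - u) * fe i)).

Lemma homog_fe i : homog 0 (fe i).
Proof. exact: (homog_fgen k rb_deg (GIdem i)). Qed.
Lemma homog_fx l : homog 0 (fx l).
Proof.
rewrite /fx; case: insubP => [p _ _|_] /=; last exact: homog0.
exact: (homog_fgen k rb_deg (GDot p)).
Qed.
Lemma homog_ftau l : homog 0 (ftau l).
Proof.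
rewrite /ftau; case: insubP => [p _ _|_] /=; last exact: homog0.
exact: (homog_fgen k rb_deg (GCross p)).
Qed.
Lemma homog_fom l j a : homog 1 (fom l j a).
Proof.
rewrite /fom; case: insubP => [p _ _|_] /=; last exact: homog0.
exact: (homog_fgen k rb_deg (GFloat p j a)).
Qed.
Lemma homog_ssum n i j f : (forall t v, homog n (f t v)) -> homog n (ssum i j f).
Proof.
move=> h; apply: homog_sum => t _; apply: homog_sum => v _.
by apply: homogMl => //; apply: homog_ascal.
Qed.
Lemma homog_sign e : homog 0 ((-1) ^+ e : rb_free).
Proof. by apply: homogX; apply: homogN; apply: homog1. Qed.

Local Ltac hom0 := repeat first [exact: homog0 | exact: homog1 | exact: homog_fe
  | exact: homog_fx | exact: homog_ftau | exact: homog_ascal | exact: homog_sign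
  | exact: homog_fom
  | apply: homog_sum; intros | apply: homog_ssum; intros | apply: homogB
  | apply: homogX | case: ifP; intros
  | apply: homogD | apply: homogN | apply: homogMl ].
Local Ltac hom1 := repeat first [exact: homog0 | exact: homog_fom
  | apply: homog_sum; intros | apply: homog_ssum; intros | apply: homogB
  | apply: homogD | apply: homogN
  | apply: homogMl; [by hom0 |] | apply: homogMr; [| by hom0]].

Lemma rb_rel_homog x y : rb_rel x y -> exists n, homog n x /\ homog n y.
Proof.
case; try (intros; exists 0; split; by hom0); try (intros; exists 1; split; by hom1).
- move=> l j a l' j' a'; exists (1 + 1).
  by split; [|apply: homogN]; apply: homogM; exact: homog_fom.
- move=> l j a; exists (1 + 1).
  split; last exact: homog0.
  by rewrite expr2; apply: homogM; exact: homog_fom.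
Qed.

Definition rb_rels (z : rb_free) : Prop := exists x y, rb_rel x y /\ z = x - y.

Fact rb_rels_homog z : rb_rels z -> exists n, homog n z.
Proof.
move=> [x [y [/rb_rel_homog [n [hx hy]] ->]]]; exists n; exact: homogB.
Qed.

Definition Rb_ideal : hideal rb_free := ideal_gen rb_rels_homog.

Definition Rb : grAlgType k := quot Rb_ideal.

Definition rb_e (i : m.-tuple C) : Rb := qpi Rb_ideal (fe i).
Definition rb_x (l : nat) : Rb := qpi Rb_ideal (fx l).
Definition rb_tau (l : nat) : Rb := qpi Rb_ideal (ftau l).
Definition rb_om (l : nat) (j : C) (a : nat) : Rb := qpi Rb_ideal (fom l j a).

Lemma homog_rb_e i : homog 0 (rb_e i).
Proof. exact/homog_qpi/homog_fe. Qed.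
Lemma homog_rb_x l : homog 0 (rb_x l).
Proof. exact/homog_qpi/homog_fx. Qed.
Lemma homog_rb_tau l : homog 0 (rb_tau l).
Proof. exact/homog_qpi/homog_ftau. Qed.
Lemma homog_rb_om l j a : homog 1 (rb_om l j a).
Proof. exact/homog_qpi/homog_fom. Qed.

Variables (If : {set C}) (N : C -> nat).

(* [is_dN] determines d: the algebra is generated by the idempotents, dots,
   crossings and the elements [rb_om 1 j 0 * rb_e i] with i_1 = j. *)
Record is_dN (d : Rb -> Rb) : Prop := IsDN {
  dN_diff : is_differential d;
  dN_e : forall i, d (rb_e i) = 0;
  dN_x : forall l, d (rb_x l) = 0;
  dN_tau : forall l, d (rb_tau l) = 0;
  dN_om : forall i j, colour i 1 j ->
    d (rb_om 1 j 0 * rb_e i) =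
      if j \in If then (-1) ^+ N j * rb_x 1 ^+ N j * rb_e i else 0
}.

Definition Rp_gens (z : Rb) : Prop :=
  exists i j, [/\ colour i 1 j, j \in If & z = rb_om 1 j 0 * rb_e i].

Fact Rp_gens_homog z : Rp_gens z -> exists n, homog n z.
Proof.
move=> [i [j [_ _ ->]]]; exists 1.
by apply: homogMr; [exact: homog_rb_om|exact: homog_rb_e].
Qed.

Definition Rp_ideal : hideal Rb := ideal_gen Rp_gens_homog.
Definition Rp : grAlgType k := quot Rp_ideal.

Definition RpN_gens (z : Rp) : Prop :=
  exists i j, [/\ colour i 1 j, j \in If &
    z = qpi Rp_ideal (rb_x 1 ^+ N j * rb_e i)].

Fact RpN_gens_homog z : RpN_gens z -> exists n, homog n z.
Proof.
move=> [i [j [_ _ ->]]]; exists 0; apply: homog_qpi.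
by apply: homogMl; [apply: homogX; exact: homog_rb_x|exact: homog_rb_e].
Qed.

Definition RpN_ideal : hideal Rp := ideal_gen RpN_gens_homog.
Definition RpN : grAlgType k := quot RpN_ideal.

End KLR.

(* Main.v *)
(* R_b(n) acts on functions from the arrangements of n labelled strands to Laurent series in
   variables x_p tensored with an exterior algebra on odd variables zeta_p: crossings act by
   divided differences or by the polynomials Q_ij, floating dots by combinations of the zeta_q,
   and d_N becomes the Koszul differential zeta_p |-> (-1)^N x_p^N.
   Modulo the ideal generated by the tight floating dots with colour in I_f every element is a
   cycle, so everything reduces to showing that a cycle in this ideal is a boundary.
   Elements of R_b(n) 1_i have normal forms along the minimal coset representatives of
   W(B_m) in W(B_(m+1)), the sum theta of the tight floating dots playing the role of the extra
   reflection.  Normal forms are unique because these representatives act triangularly with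
   respect to the position and the parity of strand m, with leading coefficients which become
   invertible once negative powers of x_m are allowed.
   A cycle is then bounded by induction on the number of strands.  If the colour of the last
   strand is in I_f, the contracting homotopy zeta_m x_m^(-N) gives a primitive with negative
   powers of x_m; by uniqueness of normal forms the coefficients of its negative part are
   cycles, so by induction that part can be traded for one without theta, and the remaining
   negative powers are closed and may be dropped. *)

Require Import Defs.
From HB Require Import structures.
From Stdlib Require Import Relations.
From mathcomp Require Import all_boot all_order all_algebra ring zify.
From mathcomp Require Import boolp functions.

Set Implicit Arguments.
Unset Strict Implicit.
Unset Printing Implicit Defensive.

Import Order.TTheory GRing.Theory Num.Theory.
Local Open Scope ring_scope.

(** * Laurent series *)

(** The scalars form an arbitrary commutative ring, so nothing may be inverted merely for being
    nonzero and no dimension count is available. Invertibility always comes from monicity: x_p - x_q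
    is monic up to sign in the variable with the larger label, and Q_ij has a unit as leading
    coefficient in each variable. Taking one variable at a time, the largest label outermost, fits
    the induction on the number of strands. The primitive built with zeta_m x_m^(-N) leaves the
    image of the algebra, and the difficulty is to return to it. This is why decompositions along
    the chain are proved for any subspace stable under the operators on m strands: they are applied
    at once to the image of the algebra and to the span of the monomials containing some zeta_p with
    colour in I_f. The second subspace enters because a cycle such as 1 need not be a boundary. It
    is not a subcomplex in general, so it is carried along as a side condition on cycles. *)

Section Laurent.
Variables (k : comPzRingType) (W : lmodType k).

(* Bounding the degree from above rather than from below makes every operator that is
   monic in the variable invertible. *)
Definition bounded_above : {pred int -> W} :=
  fun f => `[< exists M : int, forall n, M < n -> f n = 0 >].

Fact bounded_above_submod : submod_closed bounded_above.
Proof.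
split; first by apply/asboolP; exists 0.
move=> a f g /asboolP[M hM] /asboolP[M' hM']; apply/asboolP.
exists (Num.max M M') => n; rewrite gt_max => /andP[h h'].
by rewrite /GRing.add /= /GRing.scale /= hM // hM' // scaler0 addr0.
Qed.

HB.instance Definition _ := GRing.isSubmodClosed.Build k (int -> W) bounded_above
  (GRing.submod_closed_semi bounded_above_submod).

Definition laurent := {f : int -> W | f \in bounded_above}.
HB.instance Definition _ := Choice.on laurent.
HB.instance Definition _ := SubChoice.on laurent.
HB.instance Definition _ := [SubChoice_isSubLmodule of laurent by <:].

Definition lcoef (n : int) (f : laurent) : W := val f n.

Lemma lcoefP (f g : laurent) : (forall n, lcoef n f = lcoef n g) -> f = g.
Proof. by move=> h; apply/val_inj/funext. Qed.

Fact lcoef_linear n : linear (lcoef n).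
Proof. by []. Qed.
HB.instance Definition _ n :=
  GRing.isLinear.Build k laurent W _ (lcoef n) (lcoef_linear n).

Lemma lcoef_bound (f : laurent) :
  exists M : int, forall n, M < n -> lcoef n f = 0.
Proof. exact/asboolP/(valP f). Qed.

Lemma laurent_build (f : int -> W) (M : int) :
  (forall n, M < n -> f n = 0) -> exists g : laurent, forall n, lcoef n g = f n.
Proof.
move=> h; have hf : f \in bounded_above by apply/asboolP; exists M.
by exists (exist _ f hf).
Qed.

(** The junk value 0 is returned when the support of f is not bounded above; [lcoef_of_fun] asks for
    a bound. *)
Definition of_fun (f : int -> W) : laurent :=
  insubd (0 : laurent) f.

Lemma lcoef_of_fun (f : int -> W) (M : int) n :
  (forall n, M < n -> f n = 0) -> lcoef n (of_fun f) = f n.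
Proof.
move=> h; rewrite /of_fun /lcoef insubdK //.
by apply/asboolP; exists M.
Qed.

Definition lshift (e : int) (f : laurent) := of_fun (fun n => lcoef (n - e) f).
Lemma lcoef_shift e f n : lcoef n (lshift e f) = lcoef (n - e) f.
Proof.
have [M hM] := lcoef_bound f.
apply: (@lcoef_of_fun _ (M + e)) => {}n hn; apply: hM.
by rewrite ltrBrDr.
Qed.
Fact lshift_linear e : linear (lshift e).
Proof. by move=> a f g; apply: lcoefP => n; rewrite lcoef_shift !linearP /= !lcoef_shift. Qed.
HB.instance Definition _ e :=
  GRing.isLinear.Build k laurent laurent _ (lshift e) (lshift_linear e).

Lemma lshift0 f : lshift 0 f = f.
Proof. by apply: lcoefP => n; rewrite lcoef_shift subr0. Qed.
Lemma lshiftD a b f : lshift a (lshift b f) = lshift (a + b) f.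
Proof. by apply: lcoefP => n; rewrite !lcoef_shift; congr lcoef; ring. Qed.

Definition ltrunc (P : pred int) (f : laurent) :=
  of_fun (fun n => if P n then lcoef n f else 0).
Lemma lcoef_trunc P f n : lcoef n (ltrunc P f) = if P n then lcoef n f else 0.
Proof.
have [M hM] := lcoef_bound f.
by apply: (@lcoef_of_fun _ M) => {}n hn; rewrite hM ?if_same.
Qed.

Definition lmon (e : int) (w : W) := of_fun (fun n => if n == e then w else 0).
Lemma lcoef_mon e w n : lcoef n (lmon e w) = if n == e then w else 0.
Proof.
by apply: (@lcoef_of_fun _ e) => {}n hn; rewrite gt_eqF.
Qed.
Fact lmon_linear e : linear (lmon e).
Proof.
move=> a f g; apply: lcoefP => n; rewrite lcoef_mon linearP /= !lcoef_mon.
by case: eqP; rewrite ?scaler0 ?addr0.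
Qed.
HB.instance Definition _ e :=
  GRing.isLinear.Build k W laurent _ (lmon e) (lmon_linear e).

Lemma lshift_mon a e w : lshift a (lmon e w) = lmon (a + e) w.
Proof.
by apply: lcoefP => n; rewrite lcoef_shift !lcoef_mon (addrC a) subr_eq.
Qed.

Lemma laurent_poly (g : laurent) P :
  (forall n : int, n < 0 \/ P%:Z <= n -> lcoef n g = 0) ->
  g = \sum_(p < P) lmon p%:Z (lcoef p%:Z g).
Proof.
move=> h; apply: lcoefP => n; rewrite linear_sum /=.
under eq_bigr do rewrite lcoef_mon.
case: n h => n h; last by rewrite h ?big1; auto.
have [lt|le] := ltnP n P; last first.
  rewrite h ?big1 => // [i _|]; last by right.
  by case: eqP => // -[e]; have := ltn_ord i; rewrite -e ltnNge le.
rewrite (bigD1 (Ordinal lt)) //= eqxx big1 ?addr0 // => i ne.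
by case: eqP => // -[e]; case/eqP: ne; apply: val_inj.
Qed.

Definition allc (X : W -> Prop) (f : laurent) := forall n, X (lcoef n f).

End Laurent.

Section LaurentMap.
Variables (k : comPzRingType) (W W' : lmodType k).

Definition lmap (phi : W -> W') (f : laurent W) : laurent W' :=
  of_fun (fun n => phi (lcoef n f)).
Lemma lcoef_map (phi : W -> W') f n :
  phi 0 = 0 -> lcoef n (lmap phi f) = phi (lcoef n f).
Proof.
have [M hM] := lcoef_bound f => h0.
by apply: (@lcoef_of_fun _ _ _ M) => {}n hn; rewrite hM.
Qed.
Fact lmap_linear (phi : {linear W -> W'}) : linear (lmap phi).
Proof.
by move=> a f g; apply: lcoefP => n; rewrite lcoef_map ?linear0 // !linearP /= !lcoef_map ?linear0.
Qed.
HB.instance Definition _ (phi : {linear W -> W'}) :=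
  GRing.isLinear.Build k (laurent W) (laurent W') _ (lmap phi) (lmap_linear phi).

Lemma lmap_shift (phi : {linear W -> W'}) e f :
  lmap phi (lshift e f) = lshift e (lmap phi f).
Proof.
by apply: lcoefP => n; rewrite lcoef_shift !lcoef_map ?linear0 // lcoef_shift.
Qed.
Lemma lmap_mon (phi : {linear W -> W'}) e w : lmap phi (lmon e w) = lmon e (phi w).
Proof.
apply: lcoefP => n; rewrite lcoef_map ?linear0 // !lcoef_mon.
by case: ifP; rewrite ?linear0.
Qed.
End LaurentMap.

Section Monic.
Variables (k : comPzRingType) (W : lmodType k).
Variables (d : nat) (c : nat -> {linear W -> W}).

Definition monic_op (g : laurent W) : laurent W :=
  lshift d%:Z g + \sum_(v < d) lmap (c v) (lshift v%:Z g).

(** In degree n + d the equation expresses the coefficient of g in degree n by coefficients in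
    higher degrees, and these vanish far enough up. *)
Lemma monic_op_inj g : monic_op g = 0 -> g = 0.
Proof.
move=> e; have [M hM] := lcoef_bound g.
suff h t n : M - t%:Z < n -> lcoef n g = 0.
  apply: lcoefP => n; rewrite linear0; apply: (h (`|M - n|.+1)%N); lia.
elim: t n => [|t IH] n hn; first by apply: hM; lia.
move/(congr1 (lcoef (n + d%:Z))): e.
rewrite !linearD linear_sum linear0 /= lcoef_shift addrK big1 ?addr0 //.
move=> v _; rewrite lcoef_map ?linear0 // lcoef_shift IH ?linear0 //.
have := ltn_ord v; lia.
Qed.

(* The coefficients of a solution are determined recursively, from the top degree downwards. *)
Lemma monic_op_solve (X : W -> Prop) (f : laurent W) :
    X 0 -> (forall x y, X x -> X y -> X (x - y)) -> (forall v x, X x -> X (c v x)) ->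
  allc X f -> exists2 g, allc X g & monic_op g = f.
Proof.
move=> X0 XB Xc Xf; have [M hM] := lcoef_bound f.
have XD x y : X x -> X y -> X (x + y).
  by move=> hx hy; rewrite -[y]opprK -[- y]sub0r; apply: (XB) => //; apply: XB.
(* [h t] below is the coefficient of the solution in degree M - d - t; [bld t] lists the first t of
   them, so that [step] can refer to all earlier values. *)
pose step t (s : seq W) := lcoef (M - t%:Z) f -
  \sum_(v < d) if (d - v <= t)%N then c v (nth 0 s (t - (d - v))) else 0.
pose fix bld t := if t is t'.+1 then rcons (bld t') (step t' (bld t')) else [::].
have size_bld t : size (bld t) = t by elim: t => //= t IH; rewrite size_rcons IH.
pose h t := nth 0 (bld t.+1) t.
have nth_bld t t' : (t < t')%N -> nth 0 (bld t') t = h t.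
  elim: t' => // t' IH; rewrite ltnS leq_eqVlt => /orP[/eqP->//|lt].
  by rewrite -IH //= nth_rcons size_bld lt.
have hE t : h t = step t (bld t) by rewrite /h /= nth_rcons size_bld ltnn eqxx.
have Xh t : X (h t).
  have [q] := ubnP t; elim: q t => // q IH t lt; rewrite hE; apply: XB; first exact: Xf.
  apply: (big_ind X) => // v _; case: ifP => // le; apply: Xc.
  rewrite nth_bld; last by have := ltn_ord v; lia.
  by apply: IH; have := ltn_ord v; lia.
have [|g hg] := @laurent_build k W (fun n => if n <= M - d%:Z then h `|(M - d%:Z - n)%R|%N else 0) (M - d%:Z).
  by move=> n; rewrite ltNge => /negbTE->.
exists g => [n|]; first by rewrite hg; case: ifP.
apply: lcoefP => n; rewrite linearD linear_sum /= lcoef_shift hg.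
under eq_bigr => v _ do rewrite lcoef_map ?linear0 // lcoef_shift hg.
case: ifP => le; last first.
  rewrite hM; last lia.
  rewrite big1 ?addr0 // => v _.
  case: ifP => [|_]; last by rewrite linear0.
  have := ltn_ord v; lia.
set t := `|_|%N; have et : n = M - t%:Z by rewrite /t; lia.
rewrite hE /step et addrAC -addrA -[RHS]addr0; congr (_ + _).
apply/eqP; rewrite subr_eq0; apply/eqP/eq_bigr => v _.
have ltv := ltn_ord v.
case: leqP => le2.
  rewrite ifT; last lia.
  by rewrite nth_bld; [congr (c _ (h _)); lia|lia].
rewrite ifF ?linear0 //; lia.
Qed.
End Monic.

Lemma linear_at0 (k : pzRingType) (W W' : lmodType k) (psi : W -> W') :
  linear psi -> psi 0 = 0.
Proof. by move=> h; rewrite -{1}[0](addNr 0) -scaleN1r h scaleN1r addNr. Qed.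

(** * Bicommutants of commuting operators *)

Section Bicommutant.
Variables (k : comPzRingType) (W : lmodType k) (X : nat -> W -> W).

Definition in_commutant (psi : W -> W) :=
  linear psi /\ forall p x, psi (X p x) = X p (psi x).

(** The double commutant contains the polynomials in the [X p] and the inverses of its bijective
    members. Its elements commute with the odd variables and with the differential as soon as these
    commute with each [X p], so denominators need no separate verification. *)
Definition in_bicommutant : {pred W -> W} := fun phi =>
  `[< linear phi /\ forall psi, in_commutant psi ->
      forall x, psi (phi x) = phi (psi x) >].

Fact in_bicommutant_zmod : zmod_closed in_bicommutant.
Proof.
split.
  apply/asboolP; split=> [a x y|psi [lpsi _] x]; first by rewrite scaler0 addr0.
  exact: linear_at0.
move=> f g /asboolP[lf hf] /asboolP[lg hg]; apply/asboolP; split.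
  move=> a x y; rewrite /GRing.add /= /GRing.opp /= lf lg scalerBr opprD.
  by rewrite addrACA.
move=> psi hpsi x; have [lpsi _] := hpsi.
rewrite /GRing.add /= /GRing.opp /= -hf // -hg //.
by rewrite addrC -scaleN1r lpsi scaleN1r addrC.
Qed.
HB.instance Definition _ := GRing.isZmodClosed.Build (W -> W) in_bicommutant
  in_bicommutant_zmod.

Definition bicommutant := {phi : W -> W | phi \in in_bicommutant}.
HB.instance Definition _ := Choice.on bicommutant.
HB.instance Definition _ := SubChoice.on bicommutant.
HB.instance Definition _ := [SubChoice_isSubZmodule of bicommutant by <:].

Definition bmk phi (h : phi \in in_bicommutant) : bicommutant :=
  exist (fun phi => phi \in in_bicommutant) phi h.

Definition bact (phi : bicommutant) : W -> W := val phi.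

Lemma bicommutantP (f g : bicommutant) : bact f =1 bact g -> f = g.
Proof. by move=> h; apply/val_inj/funext. Qed.

Fact bact_linear phi : linear (bact phi).
Proof. by case/asboolP: (valP phi). Qed.
HB.instance Definition _ phi :=
  GRing.isLinear.Build k W W _ (bact phi) (bact_linear phi).

Lemma bact_comm phi psi : in_commutant psi ->
  forall x, psi (bact phi x) = bact phi (psi x).
Proof. by case/asboolP: (valP phi) => _; apply. Qed.

Hypothesis X_linear : forall p, linear (X p).
Hypothesis X_comm : forall p q x, X p (X q x) = X q (X p x).

Lemma commutant_X p : in_commutant (X p).
Proof. by split. Qed.

Lemma bicommutant_commutant phi : phi \in in_bicommutant -> in_commutant phi.
Proof.
by case/asboolP=> lphi h; split=> // p x; rewrite h //; apply: commutant_X.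
Qed.

Fact in_bicommutant_comp phi psi :
  phi \in in_bicommutant -> psi \in in_bicommutant -> phi \o psi \in in_bicommutant.
Proof.
move=> /asboolP[lf hf] /asboolP[lg hg]; apply/asboolP; split=> [a x y|h hh x] /=.
  by rewrite lg lf.
by rewrite hf // hg.
Qed.
Fact in_bicommutant_id : id \in in_bicommutant.
Proof. by apply/asboolP. Qed.
Fact in_bicommutant_X p : X p \in in_bicommutant.
Proof. by apply/asboolP; split=> // psi [_ h] x; rewrite h. Qed.
Fact in_bicommutant_scale (c : k) : ( *:%R c : W -> W) \in in_bicommutant.
Proof.
apply/asboolP; split=> [a x y|psi [lpsi _] x].
  by rewrite scalerDr !scalerA mulrC.
by have := lpsi c x 0; rewrite addr0 linear_at0 // addr0.
Qed.
Lemma in_bicommutant_inv (phi inv : W -> W) :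
  phi \in in_bicommutant -> cancel phi inv -> cancel inv phi ->
  inv \in in_bicommutant.
Proof.
move=> hphi fK Kf; have [lf hf] := asboolP _ hphi.
apply/asboolP; split=> [a x y|psi hpsi x]; apply: (can_inj fK).
  by rewrite lf !Kf.
by rewrite -hf // !Kf.
Qed.

Definition bmul (f g : bicommutant) : bicommutant :=
  bmk (in_bicommutant_comp (valP f) (valP g)).
Definition bone : bicommutant := bmk in_bicommutant_id.
Fact bmulA : associative bmul. Proof. by move=> f g h; apply: val_inj. Qed.
(** Since the [X p] commute with each other they lie in the commutant, so the bicommutant lies in
    the commutant and hence commutes with itself. *)
Fact bmulC : commutative bmul.
Proof.
move=> f g; apply: bicommutantP => x; apply: bact_comm.
exact/bicommutant_commutant/(valP f).
Qed.
Fact bmul1 : left_id bone bmul. Proof. by move=> f; apply: val_inj. Qed.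
Fact bmulDl : left_distributive bmul +%R.
Proof. by move=> f g h; apply: val_inj. Qed.
End Bicommutant.

Lemma lmap0 (k : comPzRingType) (W W' : lmodType k) (phi : W -> W') :
  phi 0 = 0 -> lmap phi 0 = 0.
Proof. by move=> h; apply: lcoefP => n; rewrite lcoef_map // !linear0. Qed.

(** * Iterated Laurent series with odd variables and their Koszul differential *)

Section Scalars.
Variable k : comPzRingType.

(* An element (f, g) of [Wt m.+1] stands for f + zeta_m g, with zeta_m an odd variable. *)
Fixpoint Wt (m : nat) : lmodType k :=
  if m is m'.+1 then (laurent (Wt m') * laurent (Wt m'))%type else k^o.

Definition both (L L' : Type) (f : L -> L') (u : L * L) : L' * L' := (f u.1, f u.2).

Fixpoint wX (m p : nat) : Wt m -> Wt m :=
  match m return Wt m -> Wt m with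
  | 0 => id
  | m'.+1 => both (if p == m' then lshift 1 else lmap (@wX m' p))
  end.

(** As zeta_m is written to the left of its coefficient, a zeta_p of smaller label passes it with a
    sign. *)
Fixpoint wZ (m p : nat) : Wt m -> Wt m :=
  match m return Wt m -> Wt m with
  | 0 => fun _ => 0
  | m'.+1 => fun u =>
    if p == m' then (0, u.1) else (lmap (@wZ m' p) u.1, - lmap (@wZ m' p) u.2)
  end.

Lemma both_linear (U U' : lmodType k) (f : U -> U') : linear f -> linear (both f).
Proof. by move=> lf a [u1 u2] [v1 v2]; rewrite /both /= !lf. Qed.

Lemma lmap_is_linear (U U' : lmodType k) (f : U -> U') : linear f -> linear (lmap f).
Proof.
move=> lf a u v; have f0 := linear_at0 lf.
by apply: lcoefP => n; rewrite lcoef_map // !linearP /= !lcoef_map // lf.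
Qed.

Fact wX_linear m p : linear (@wX m p).
Proof.
elim: m => [|m IH] //=; apply: both_linear; case: eqP => _.
  exact: lshift_linear.
exact: lmap_is_linear.
Qed.
HB.instance Definition _ m p := GRing.isLinear.Build k (Wt m) (Wt m) _ (@wX m p)
  (@wX_linear m p).

Fact wZ_linear m p : linear (@wZ m p).
Proof.
elim: m => [|m IH] a u v; first by apply/esym/eqP; rewrite addr0 [_ == _]eq_sym scaler0.
rewrite /=; case: eqP => _; first by congr pair; rewrite /= scaler0 addr0.
by rewrite !(lmap_is_linear IH) opprD -scalerN.
Qed.
HB.instance Definition _ m p := GRing.isLinear.Build k (Wt m) (Wt m) _ (@wZ m p)
  (@wZ_linear m p).

Lemma lmap_comm (U : lmodType k) (f g h i : U -> U) :
    f 0 = 0 -> g 0 = 0 -> h 0 = 0 -> i 0 = 0 -> (forall x, f (g x) = h (i x)) ->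
  forall u, lmap f (lmap g u) = lmap h (lmap i u).
Proof. by move=> *; apply: lcoefP => n; rewrite !lcoef_map. Qed.

Lemma wX_comm m p q (x : Wt m) : wX p (wX q x) = wX q (wX p x).
Proof.
elim: m x => [|m IH] //= x; rewrite /both /=.
case: eqP => _; case: eqP => _ //; rewrite ?lmap_shift //.
by congr pair; apply: lmap_comm; rewrite ?linear0.
Qed.

Lemma wXZ m p q (x : Wt m) : wX p (wZ q x) = wZ q (wX p x).
Proof.
elim: m x => [|m IH] /= x; first by [].
case: (q == m); rewrite /both /=.
  by case: eqP => _ //; rewrite ?lmap0 ?linear0.
case: (p == m); rewrite ?lmap_shift -?linearN ?lmap_shift //=.
by congr pair; rewrite ?linearN /=; congr (- _) || idtac; apply: lmap_comm; rewrite ?linear0.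
Qed.

Lemma wZZ m p q (x : Wt m) : wZ p (wZ q x) = - wZ q (wZ p x).
Proof.
elim: m x => [|m IH] /= x; first by rewrite oppr0.
have h (u : laurent (Wt m)) :
    lmap (@wZ m p) (lmap (@wZ m q) u) = - lmap (@wZ m q) (lmap (@wZ m p) u).
  by apply: lcoefP => n; rewrite linearN /= !lcoef_map ?linear0.
have pN (a b : laurent (Wt m)) : - (a, b) = (- a, - b) by [].
have l0 r : lmap (@wZ m r) 0 = 0 by rewrite linear0.
case: eqP => _; case: eqP => _ /=; rewrite ?l0 pN ?oppr0 ?opprK //.
congr pair; first exact: h.
by rewrite !(linearN (lmap _)) /= (h x.2) !opprK.
Qed.

Lemma wZ2 m p (x : Wt m) : wZ p (wZ p x) = 0.
Proof.
elim: m x => [|m IH] //= x; case: eqP => _ //=.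
have h (u : laurent (Wt m)) : lmap (@wZ m p) (lmap (@wZ m p) u) = 0.
  by apply: lcoefP => n; rewrite !lcoef_map ?linear0.
by rewrite linearN /= !h !oppr0.
Qed.

Definition wK (m : nat) : Type := bicommutant (@wX m).
HB.instance Definition _ m := GRing.Zmodule.on (wK m).
HB.instance Definition _ m := GRing.Zmodule_isComPzRing.Build (wK m)
  (@bmulA _ _ (@wX m))
  (@bmulC _ _ (@wX m) (@wX_linear m) (@wX_comm m))
  (@bmul1 _ _ (@wX m)) (@bmulDl _ _ (@wX m)).

Variables (C : finType) (If : {set C}) (N : C -> nat) (c : nat -> C).

Definition wtop (m : nat) (U : lmodType k) (g : laurent U) : laurent U :=
  if c m \in If then (-1) ^+ N (c m) *: lshift (N (c m))%:Z g else 0.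

(** Multiplication by the differential of zeta_p; [wtop] is the case of the outermost variable, on a
    single Laurent series. *)
Definition wtopX (m p : nat) (x : Wt m) : Wt m :=
  if c p \in If then (-1) ^+ N (c p) *: iter (N (c p)) (@wX m p) x else 0.

Fixpoint wd (m : nat) : Wt m -> Wt m :=
  match m return Wt m -> Wt m with
  | 0 => fun _ => 0
  | m'.+1 => fun u => (lmap (@wd m') u.1 + wtop m' u.2, - lmap (@wd m') u.2)
  end.

Lemma wtop_linear m (U : lmodType k) : linear (@wtop m U).
Proof.
move=> a u v; rewrite /wtop; case: ifP => _; last by rewrite scaler0 addr0.
by rewrite linearP /= scalerDr !scalerA mulrC.
Qed.
HB.instance Definition _ m (U : lmodType k) :=
  GRing.isLinear.Build k (laurent U) (laurent U) _ (@wtop m U) (@wtop_linear m U).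

Fact wd_linear m : linear (@wd m).
Proof.
elim: m => [|m IH] a u v.
  by apply/esym/eqP; rewrite addr0 [_ == _]eq_sym scaler0.
rewrite /= !(lmap_is_linear IH) linearP /=; congr pair => /=.
  by rewrite scalerDr addrACA.
by rewrite opprD -scalerN.
Qed.
HB.instance Definition _ m := GRing.isLinear.Build k (Wt m) (Wt m) _ (@wd m)
  (@wd_linear m).

Lemma wtop_map m (U U' : lmodType k) (f : U -> U') u :
  linear f -> wtop m (lmap f u) = lmap f (wtop m u).
Proof.
move=> lf; have f0 := linear_at0 lf.
have fZ a x : f (a *: x) = a *: f x by have := lf a x 0; rewrite !addr0 f0 addr0.
rewrite /wtop; case: ifP => _; last by rewrite lmap0.
by apply: lcoefP => n; rewrite lcoef_map // !linearZ /= !lcoef_shift lcoef_map.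
Qed.

Lemma wtop_shift m (U : lmodType k) e (u : laurent U) :
  wtop m (lshift e u) = lshift e (wtop m u).
Proof.
rewrite /wtop; case: ifP => _; last by rewrite linear0.
by rewrite linearZ /= !lshiftD addrC.
Qed.

Lemma wdX m p (x : Wt m) : wd (wX p x) = wX p (wd x).
Proof.
elim: m x => [|m IH] //= x; rewrite /both /=.
have lX := @wX_linear m p.
case: (p == m); first by rewrite !lmap_shift wtop_shift !linearD !linearN.
rewrite wtop_map // linearD linearN; congr pair => /=.
  by congr (_ + _); apply: lmap_comm; rewrite ?linear0.
by congr (- _); apply: lmap_comm; rewrite ?linear0.
Qed.

Lemma iter_linear0 (U : lmodType k) (f : {linear U -> U}) e : iter e f 0 = 0.
Proof. by elim: e => //= e ->; rewrite linear0. Qed.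

Lemma iter_lshift (U : lmodType k) e (u : laurent U) :
  iter e (lshift 1) u = lshift e%:Z u.
Proof. by elim: e => [|e IH]; rewrite ?lshift0 //= IH lshiftD intS. Qed.

Lemma iter_lmap (U : lmodType k) (f : {linear U -> U}) e u :
  iter e (lmap f) u = lmap (iter e f) u.
Proof.
elim: e u => [|e IH] u /=; first by apply: lcoefP => n; rewrite lcoef_map.
by rewrite IH; apply: lcoefP => n; rewrite !lcoef_map /= ?iter_linear0 ?linear0.
Qed.

Lemma iter_both (U : Type) (f : U -> U) e u : iter e (both f) u = both (iter e f) u.
Proof. by elim: e => [|e /= ->] //; case: u. Qed.

Lemma wtopX_top m (x : Wt m.+1) : wtopX m x = both (wtop m (U := _)) x.
Proof.
rewrite /wtopX /both /wtop; case: ifP => // _ /=.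
by rewrite eqxx iter_both /both !iter_lshift.
Qed.

Lemma wtopX_lower m p (x : Wt m.+1) :
  p != m -> wtopX p x = both (lmap (@wtopX m p)) x.
Proof.
move=> /negbTE ne; rewrite /wtopX /both; case: ifP => _ /=.
  rewrite ne iter_both /both !iter_lmap.
  by congr pair; apply: lcoefP => n; rewrite linearZ /= !lcoef_map ?iter_linear0 ?scaler0.
by congr pair; apply: lcoefP => n; rewrite lcoef_map // linear0.
Qed.

Lemma wtopX0 m p : wtopX p (0 : Wt m) = 0.
Proof. by rewrite /wtopX iter_linear0 scaler0 if_same. Qed.

(** This is what makes [wd] the Koszul differential: an odd derivation whose value on zeta_p is
    multiplication by [wtopX p]. *)
Lemma wdZ m p (x : Wt m) : (p < m)%N -> wd (wZ p x) + wZ p (wd x) = wtopX p x.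
Proof.
elim: m x => [|m IH] // x lt.
have pD (a b a' b' : laurent (Wt m)) : (a, b) + (a', b') = (a + a', b + b') by [].
have [->|ne] := eqVneq p m.
  rewrite wtopX_top /both /= eqxx /= linear0 add0r.
  by rewrite pD addr0 addKr.
have ltm : (p < m)%N by rewrite ltn_neqAle ne -ltnS.
rewrite wtopX_lower // /= (negbTE ne) /both /=.
have h (u : laurent (Wt m)) :
    lmap (@wd m) (lmap (@wZ m p) u) + lmap (@wZ m p) (lmap (@wd m) u)
      = lmap (@wtopX m p) u.
  by apply: lcoefP => n; rewrite linearD /= !lcoef_map ?linear0 ?wtopX0 // IH.
rewrite pD; congr pair.
  rewrite !(linearD (lmap _)) !(linearN (@wtop m _)) /=.
  by rewrite (wtop_map m x.2 (@wZ_linear m p)) addrACA addNr addr0 h.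
by rewrite !(linearN (lmap _)) /= !opprK h.
Qed.

(** The series all of whose monomials contain some zeta_p with c p in I_f. The ideal defining R_p
    maps vectors into this space. In general the differential does not preserve it: it sends zeta_p
    to a power of x_p. *)
Fixpoint wF (m : nat) : Wt m -> Prop :=
  match m return Wt m -> Prop with
  | 0 => fun u => u = 0
  | m'.+1 => fun u => allc (@wF m') u.1 /\ (c m' \in If \/ allc (@wF m') u.2)
  end.

Lemma wF0 m : @wF m 0.
Proof. by elim: m => //= m IH; split; [|right]; move=> n; rewrite linear0. Qed.
Lemma wFD m (x y : Wt m) : wF x -> wF y -> wF (x + y).
Proof.
elim: m x y => [|m IH] x y /=; first by move=> -> ->; rewrite addr0.
move=> [h1 h2] [h3 h4]; have e (f g : laurent (Wt m)) :
    allc (@wF m) f -> allc (@wF m) g -> allc (@wF m) (f + g).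
  by move=> hf hg n; rewrite linearD; apply: IH; [exact: hf|exact: hg].
split; first exact: e.
case: h2 => h2; first by left.
case: h4 => h4; first by left.
by right; apply: e.
Qed.
Lemma wFZ m a (x : Wt m) : wF x -> wF (a *: x).
Proof.
elim: m x => [|m IH] x; first by move=> ->; rewrite /= scaler0.
move=> [h1 h2]; have e (f : laurent (Wt m)) :
    allc (@wF m) f -> allc (@wF m) (a *: f).
  by move=> hf n; rewrite linearZ; apply: IH; exact: hf.
by split; [apply: e|case: h2 => h2; [left|right; apply: e]].
Qed.
Lemma wFN m (x : Wt m) : wF x -> wF (- x).
Proof. by rewrite -scaleN1r; apply: wFZ. Qed.
Lemma wF_sum m (J : Type) (r : seq J) (P : pred J) (F : J -> Wt m) :
  (forall j, P j -> wF (F j)) -> wF (\sum_(j <- r | P j) F j).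
Proof. by move=> h; apply: (big_ind (@wF m)) => //; [exact: wF0|exact: wFD]. Qed.
Lemma wFX m p (x : Wt m) : wF x -> wF (wX p x).
Proof.
elim: m x => [|m IH] // x [h1 h2]; rewrite /= /both /=.
have h f : allc (@wF m) f -> allc (@wF m) ((if p == m then lshift 1 else lmap (@wX m p)) f).
  move=> hf n; case: ifP => _; first by rewrite lcoef_shift; exact: hf.
  by rewrite lcoef_map ?linear0 //; apply: IH; exact: hf.
by split; [apply: h|case: h2 => h2; [left|right; apply: h]].
Qed.
Lemma wFZp m p (x : Wt m) : wF x -> wF (wZ p x).
Proof.
elim: m x => [|m IH] // x [h1 h2] /=.
have h f : allc (@wF m) f -> allc (@wF m) (lmap (@wZ m p) f).
  by move=> hf n; rewrite lcoef_map ?linear0 //; apply: IH; exact: hf.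
case: eqP => _ /=; split.
- by move=> n; rewrite linear0; apply: wF0.
- by right.
- exact: h.
- case: h2 => h2; [by left|right=> n; rewrite linearN; apply: wFN; exact: h].
Qed.
Lemma wF_wZ m p (x : Wt m) : (p < m)%N -> c p \in If -> wF (wZ p x).
Proof.
elim: m x => [|m IH] // x lt cp /=.
have [e|ne] := eqVneq p m.
  by split; [move=> n; rewrite linear0; apply: wF0|left; rewrite -e].
have ltm : (p < m)%N by rewrite ltn_neqAle ne -ltnS.
have h f : allc (@wF m) (lmap (@wZ m p) f).
  by move=> n; rewrite lcoef_map ?linear0 //; apply: IH.
by split; [apply: h|right=> n; rewrite linearN; apply: wFN; apply: h].
Qed.

Lemma wX_lift_inj m (f : Wt m -> Wt m) : linear f ->
  (forall x, f x = 0 -> x = 0) -> forall u, lmap f u = 0 -> u = 0.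
Proof.
move=> lf h u e; apply: lcoefP => n; rewrite linear0; apply: h.
by rewrite -lcoef_map ?e ?linear0 // linear_at0.
Qed.

Lemma lmap_solve (U : lmodType k) (f : U -> U) (X : U -> Prop) : linear f ->
    (forall x, f x = 0 -> x = 0) ->
    (forall y, exists2 x, f x = y & X y -> X x) ->
  forall v, exists2 u, lmap f u = v & allc X v -> allc X u.
Proof.
move=> lf inj h v; have f0 := linear_at0 lf.
have [g hg] : {g & forall y, f (g y) = y /\ (X y -> X (g y))}.
  apply: (@choice _ _ (fun y x => f x = y /\ (X y -> X x))) => y.
  by have [x ex hx] := h y; exists x.
have fg y : f (g y) = y by case: (hg y).
have gX y : X y -> X (g y) by case: (hg y).
(* [lmap] is meaningful only for maps fixing 0; injectivity of f forces this on the chosen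
   solutions. *)
have g0 : g 0 = 0 by apply: inj.
exists (lmap g v); first by apply: lcoefP => n; rewrite !lcoef_map.
by move=> Xv n; rewrite lcoef_map //; apply: gX; exact: Xv.
Qed.

Definition wdiff m p q (x : Wt m) := wX p x - wX q x.
Fact wdiff_linear m p q : linear (@wdiff m p q).
Proof.
by move=> a x y; rewrite /wdiff !wX_linear scalerBr opprD addrACA.
Qed.
HB.instance Definition _ m p q := GRing.isLinear.Build k (Wt m) (Wt m) _
  (@wdiff m p q) (@wdiff_linear m p q).

(** If one of the labels is the outermost one, x_p - x_q is up to sign monic of degree 1 in that
    variable, with coefficients preserving [wF]. Otherwise it acts coefficientwise and induction
    applies. *)
Lemma wdiff_bij m p q : (p < m)%N -> (q < m)%N -> p != q ->
  (forall x : Wt m, wdiff p q x = 0 -> x = 0) /\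
  (forall y : Wt m, exists2 x, wdiff p q x = y & wF y -> wF x).
Proof.
elim: m p q => [|m IH] // p q.
have pair_case (f : laurent (Wt m) -> laurent (Wt m)) :
    (forall x : Wt m.+1, wdiff p q x = both f x) ->
    (forall x, f x = 0 -> x = 0) ->
    (forall y, exists2 x, f x = y & allc (@wF m) y -> allc (@wF m) x) ->
  (forall x : Wt m.+1, wdiff p q x = 0 -> x = 0) /\
  (forall y : Wt m.+1, exists2 x, wdiff p q x = y & wF y -> wF x).
  move=> e inj solve; split=> [x|y].
    by rewrite e => -[/inj h1 /inj h2]; case: x h1 h2 => a b /= -> ->.
  have [a ea ha] := solve y.1; have [b eb hb] := solve y.2.
  exists (a, b); first by rewrite e /both /= ea eb -surjective_pairing.
  move=> [h1 h2]; split; first exact: ha.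
  by case: h2 => h2; [left|right; apply: hb].
have top r (x : laurent (Wt m)) :
    lshift 1 x - lmap (@wX m r) x
      = monic_op 1 (fun _ => [the {linear Wt m -> Wt m} of \- (@wX m r)]) x.
  rewrite /monic_op big_ord1 lshift0; congr (_ + _).
  by apply: lcoefP => n; rewrite linearN /= !lcoef_map ?linear0 ?oppr0.
have topF r (y : laurent (Wt m)) : exists2 x, lshift 1 x - lmap (@wX m r) x = y &
    allc (@wF m) y -> allc (@wF m) x.
  have [Fy|nFy] := pselect (allc (@wF m) y).
    have [||||x hx ex] := @monic_op_solve _ _ 1
      (fun _ => [the {linear Wt m -> Wt m} of \- (@wX m r)]) (@wF m) y.
    - exact: wF0.
    - by move=> u v hu hv; apply: wFD => //; apply: wFN.
    - by move=> _ u hu; apply: wFN; apply: wFX.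
    - exact: Fy.
    - by exists x => //; rewrite top.
  have [||||x hx ex] := @monic_op_solve _ _ 1
      (fun _ => [the {linear Wt m -> Wt m} of \- (@wX m r)]) (fun=> True) y => //.
  by exists x; rewrite ?top.
rewrite !ltnS leq_eqVlt (leq_eqVlt q).
move=> /orP[/eqP ep|ltp] /orP[/eqP eq|ltq] ne; subst.
- by rewrite eqxx in ne.
- apply: (pair_case (fun x => lshift 1 x - lmap (@wX m q) x)) => // [x|x].
    by rewrite /wdiff /= eqxx (ltn_eqF ltq).
  by rewrite top => /monic_op_inj.
- apply: (pair_case (fun x => - (lshift 1 x - lmap (@wX m p) x))) => // [x|x|y].
  + rewrite /wdiff /= eqxx (ltn_eqF ltp) /both.
    by rewrite !opprB.
  + by rewrite top => /eqP; rewrite oppr_eq0 => /eqP /monic_op_inj.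
  + have [x ex hx] := topF p (- y); exists x; first by rewrite ex opprK.
    by move=> hy; apply: hx => n; rewrite linearN; apply: wFN; exact: hy.
- have [inj solve] := IH p q ltp ltq ne.
  apply: (pair_case (lmap (@wdiff m p q))) => [x||].
  + rewrite {1}/wdiff /= (ltn_eqF ltp) (ltn_eqF ltq) /both.
    have h (u : laurent (Wt m)) :
        lmap (@wX m p) u - lmap (@wX m q) u = lmap (@wdiff m p q) u.
      by apply: lcoefP => n; rewrite linearB /= !lcoef_map ?linear0.
    by rewrite -!h.
  + by apply: wX_lift_inj => //; apply: wdiff_linear.
  + by apply: lmap_solve => //; apply: wdiff_linear.
Qed.

End Scalars.

(** * Variables and inverse differences as elements of a commutative ring *)

Section Denominators.
Variable k : comPzRingType.
Local Notation Wt := (Wt k).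
Local Notation wK := (wK k).

Definition wD m p q (y : Wt m) : Wt m :=
  if pselect (exists x, wdiff p q x = y) is left e then projT1 (cid e) else 0.

Lemma wdiffK m p q : (p < m)%N -> (q < m)%N -> p != q ->
  cancel (@wdiff k m p q) (@wD m p q) /\ cancel (@wD m p q) (@wdiff k m p q).
Proof.
(* Bijectivity does not involve colours, so arbitrary colour data is supplied for the clause about
   [wF]. *)
move=> lp lq ne; have [inj solve] := @wdiff_bij k unit set0 (fun=> tt) m p q lp lq ne.
have K (y : Wt m) : wdiff p q (wD p q y) = y.
  rewrite /wD; case: pselect => [e|[]]; first by case: cid.
  by have [x ex _] := solve y; exists x.
split; last exact: K.
move=> x; apply/eqP; rewrite -subr_eq0; apply/eqP/inj.
by rewrite linearB /= K subrr.
Qed.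

Lemma wD_lower m p q (y : Wt m.+1) : (p < m)%N -> (q < m)%N -> p != q ->
  wD p q y = both (lmap (@wD m p q)) y.
Proof.
move=> lp lq ne.
have [K _] := wdiffK (ltnW lp : p < m.+1)%N (ltnW lq : q < m.+1)%N ne.
have [K1 K2] := wdiffK lp lq ne.
apply: (canLR K).
have D0 : @wD m p q 0 = 0 by rewrite -[X in wD _ _ X](linear0 (@wdiff k m p q)) K1.
have h (u : laurent (Wt m)) :
    u = lmap (@wX k m p) (lmap (@wD m p q) u) - lmap (@wX k m q) (lmap (@wD m p q) u).
  by apply: lcoefP => n; rewrite linearB /= !lcoef_map ?linear0 // -{1}[lcoef n u]K2.
rewrite /wdiff /= (ltn_eqF lp) (ltn_eqF lq) /both /=.
by case: y => a b; rewrite {1}(h a) {1}(h b).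
Qed.

Definition kX m p : wK m := bmk (in_bicommutant_X (@wX_linear k m) p).
Definition kS m (a : k) : wK m := bmk (in_bicommutant_scale (@wX k m) a).
Definition kD m p q : wK m := insubd 0 (@wD m p q).

Lemma bactM m (a b : wK m) x : bact (a * b) x = bact a (bact b x).
Proof. by []. Qed.
Lemma bactD m (a b : wK m) x : bact (a + b) x = bact a x + bact b x.
Proof. by []. Qed.
Lemma bactN m (a : wK m) x : bact (- a) x = - bact a x.
Proof. by []. Qed.
Lemma bact1 m x : bact (1 : wK m) x = x.
Proof. by []. Qed.
Lemma bact0 m x : bact (0 : wK m) x = 0.
Proof. by []. Qed.
Lemma bact_sum m (J : Type) (r : seq J) (P : pred J) (F : J -> wK m) x :
  bact (\sum_(j <- r | P j) F j) x = \sum_(j <- r | P j) bact (F j) x.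
Proof. by apply: (big_morph (fun a : wK m => bact a x)). Qed.
Lemma bact_kX m p x : bact (kX m p) x = wX p x. Proof. by []. Qed.
Lemma bact_kS m a x : bact (kS m a) x = a *: x. Proof. by []. Qed.

Lemma kSD m a b : kS m (a + b) = kS m a + kS m b.
Proof. by apply: bicommutantP => x; rewrite bactD !bact_kS scalerDl. Qed.
Lemma kSM m a b : kS m (a * b) = kS m a * kS m b.
Proof. by apply: bicommutantP => x; rewrite bactM !bact_kS scalerA. Qed.
Lemma kS0 m : kS m 0 = 0.
Proof. by apply: bicommutantP => x; rewrite bact_kS scale0r. Qed.
Lemma kS1 m : kS m 1 = 1.
Proof. by apply: bicommutantP => x; rewrite bact_kS scale1r. Qed.

Section KD.
Variables (m p q : nat).
Hypotheses (lp : (p < m)%N) (lq : (q < m)%N) (ne : p != q).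

Lemma bact_kD x : bact (kD m p q) x = wD p q x.
Proof.
have [K1 K2] := wdiffK lp lq ne.
have hd : @wdiff k m p q \in in_bicommutant (@wX k m) by apply: (valP (kX m p - kX m q)).
by rewrite /bact /kD insubdK //; apply: (in_bicommutant_inv hd).
Qed.

Lemma kDK : kD m p q * (kX m p - kX m q) = 1.
Proof.
by apply: bicommutantP => x; rewrite bactM bact_kD; case: (wdiffK lp lq ne) => + _; apply.
Qed.
End KD.

Lemma kDN m p q : (p < m)%N -> (q < m)%N -> p != q -> kD m q p = - kD m p q.
Proof.
move=> lp lq ne; have h := kDK lp lq ne.
have h' := kDK lq lp; rewrite eq_sym in h'; move/(_ ne): h' => h'.
rewrite -[LHS]mulr1 -h -[in RHS](mul1r (kD m p q)) -h'; ring.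
Qed.

Lemma commutant_wZ m p : in_commutant (@wX k m) (@wZ k m p).
Proof. by split=> [|q x]; [apply: wZ_linear|rewrite wXZ]. Qed.
Lemma bact_wZ m p (a : wK m) x : wZ p (bact a x) = bact a (wZ p x).
Proof. exact: (bact_comm _ (commutant_wZ m p)). Qed.

Section Differential.
Variables (C : finType) (If : {set C}) (N : C -> nat) (c : nat -> C).

Lemma wFD_inv m p q (y : Wt m) : (p < m)%N -> (q < m)%N -> p != q ->
  wF If c y -> wF If c (wD p q y).
Proof.
move=> lp lq ne Fy; have [_ solve] := @wdiff_bij k C If c m p q lp lq ne.
have [x ex hx] := solve y; have [K _] := wdiffK lp lq ne.
by rewrite -ex K; apply: hx.
Qed.

Lemma commutant_wd m : in_commutant (@wX k m) (@wd k C If N c m).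
Proof. by split=> [|q x]; [apply: wd_linear|rewrite wdX]. Qed.
Lemma bact_wd m (a : wK m) x : wd If N c (bact a x) = bact a (wd If N c x).
Proof. exact: (bact_comm _ (commutant_wd m)). Qed.

End Differential.
End Denominators.
Arguments kDN {k m p q}.
Arguments kDK {k m p q}.

(** * Operators on arrangements of strands *)

Definition swp (l : nat) (s : seq nat) : seq nat :=
  take l.-1 s ++ rev (take 2 (drop l.-1 s)) ++ drop l.+1 s.

Lemma swpE a p q b : swp (size a).+1 (a ++ p :: q :: b) = a ++ q :: p :: b.
Proof.
rewrite /swp /= take_size_cat // drop_size_cat //= take0.
by rewrite (_ : (size a).+2 = 2 + size a)%N // -drop_drop drop_size_cat //= drop0.
Qed.

Lemma seq_split2 l (s : seq nat) : (0 < l < size s)%N ->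
  exists a p q b, s = a ++ p :: q :: b /\ l = (size a).+1.
Proof.
case: l => // l /= lt; exists (take l s), (nth 0%N s l), (nth 0%N s l.+1), (drop l.+2 s).
rewrite size_takel; last exact: ltnW (ltnW lt).
split=> //; rewrite -{1}(cat_take_drop l s); congr (_ ++ _).
by rewrite (drop_nth 0%N (ltnW lt)) (drop_nth 0%N lt).
Qed.

Lemma seq_split3 l (s : seq nat) : (0 < l)%N -> (l.+1 < size s)%N ->
  exists a p q r b, s = a ++ p :: q :: r :: b /\ l = (size a).+1.
Proof.
move=> l0 lt; have [|a [p [q [b [es el]]]]] := @seq_split2 l s.
  by rewrite l0 ltnW.
rewrite es in lt *; case: b lt {es} => [|r b] lt; last by exists a, p, q, r, b.
by move: lt; rewrite size_cat /= el; lia.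
Qed.

Lemma perm_swp l s : (0 < l < size s)%N -> perm_eq (swp l s) s.
Proof.
move=> /seq_split2 [a [p [q [b [-> ->]]]]]; rewrite swpE perm_cat2l.
by rewrite -[_ :: _ :: b]/([:: q; p] ++ b) -[p :: _ :: b]/([:: p; q] ++ b)
  perm_cat2r (perm_catC [:: q] [:: p]).
Qed.

Lemma size_swp l s : (0 < l < size s)%N -> size (swp l s) = size s.
Proof. by move=> lt; rewrite (perm_size (perm_swp lt)). Qed.

Lemma swpK l s : (0 < l < size s)%N -> swp l (swp l s) = s.
Proof. by move=> /seq_split2 [a [p [q [b [-> ->]]]]]; rewrite !swpE. Qed.

Lemma nth_swp l s p : (0 < l < size s)%N ->
  nth 0%N (swp l s) p = nth 0%N s (swap_pos l p).
Proof.
move=> /seq_split2 [a [x [y [b [-> ->]]]]]; rewrite swpE /swap_pos /=.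
rewrite !nth_cat; case: eqP => [->|ne].
  by rewrite ltnn subnn ltnNge leqnSn /= subSnn.
case: eqP => [->|ne2]; first by rewrite ltnn ltnNge leqnSn subnn subSnn.
case: ltnP => // le; case: (p - size a)%N (subnKC le) => [|[|d]] e //=; lia.
Qed.

Lemma swp_comm l l' s : (0 < l)%N -> (l.+1 < l')%N -> (l' < size s)%N ->
  swp l (swp l' s) = swp l' (swp l s).
Proof.
move=> l0 ll' lt; have [h h'] : (0 < l < size s)%N /\ (0 < l' < size s)%N by lia.
have [e e'] := (size_swp h, size_swp h').
apply: (@eq_from_nth _ 0%N); first by rewrite !size_swp ?e ?e'.
move=> i _; rewrite !nth_swp ?e ?e' //.
rewrite /swap_pos; congr nth.
case: (i =P l.-1) => ?; case: (i =P l) => ?; case: (i =P l'.-1) => ?; case: (i =P l') => ?;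
  repeat case: eqP => ?; lia.
Qed.

Lemma swp_braid l s : (0 < l)%N -> (l.+1 < size s)%N ->
  swp l (swp l.+1 (swp l s)) = swp l.+1 (swp l (swp l.+1 s)).
Proof.
move=> l0 /(seq_split3 l0) [a [p [q [r [b [-> ->]]]]]].
have E x y z : swp (size a).+2 (a ++ x :: y :: z :: b) = a ++ x :: z :: y :: b.
  by rewrite -cat_rcons -(size_rcons a x) swpE cat_rcons.
by rewrite !(swpE, E).
Qed.

Lemma perm_take_swp l l' s : (0 < l < size s)%N -> l' != l ->
  perm_eq (take l' (swp l s)) (take l' s).
Proof.
move=> /seq_split2 [a [p [q [b [-> ->]]]]] ne; rewrite swpE !take_cat.
case: ltnP => // le; rewrite perm_cat2l.
case: (l' - size a)%N (subnKC le) => [|[|d]] e //=; first by case/eqP: ne; lia.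
by rewrite -[_ :: _ :: _]/([:: q; p] ++ _) -[p :: _ :: _]/([:: p; q] ++ _)
  perm_cat2r (perm_catC [:: q] [:: p]).
Qed.

(** The labels of the strands read from left to right. Colours, variables and odd variables are
    attached to labels, so a strand carries them along when it moves. *)
Definition arr (n : nat) := {s : seq nat | perm_eq s (iota 0 n)}.

Lemma size_arr n (w : arr n) : size (val w) = n.
Proof. by rewrite (perm_size (valP w)) size_iota. Qed.
Lemma uniq_arr n (w : arr n) : uniq (val w).
Proof. by rewrite (perm_uniq (valP w)) iota_uniq. Qed.
Lemma mem_arr n (w : arr n) p : (p \in val w) = (p < n)%N.
Proof. by rewrite (perm_mem (valP w)) mem_iota add0n. Qed.

Definition arr_swp n (l : nat) (w : arr n) : arr n := insubd w (swp l (val w)).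

Lemma val_arr_swp n l (w : arr n) : (0 < l < n)%N ->
  val (arr_swp l w) = swp l (val w).
Proof.
move=> lt; rewrite insubdK // -topredE /=.
by apply: perm_trans (valP w); apply: perm_swp; rewrite size_arr.
Qed.

Definition st n (w : arr n) (l : nat) : nat := nth 0%N (val w) l.-1.

Lemma st_lt n (w : arr n) l : (0 < l <= n)%N -> (st w l < n)%N.
Proof.
by move=> lt; rewrite -(mem_arr w) mem_nth // size_arr; lia.
Qed.

Lemma st_neq n (w : arr n) l l' :
  (0 < l <= n)%N -> (0 < l' <= n)%N -> l != l' -> st w l != st w l'.
Proof.
move=> h h' ne; rewrite /st nth_uniq ?size_arr ?uniq_arr //; lia.
Qed.

Lemma st_swp n (w : arr n) l l' : (0 < l < n)%N ->
  st (arr_swp l w) l' = nth 0%N (val w) (swap_pos l l'.-1).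
Proof. by move=> lt; rewrite /st val_arr_swp // nth_swp // size_arr. Qed.
Lemma st_swp_l n (w : arr n) l : (0 < l < n)%N -> st (arr_swp l w) l = st w l.+1.
Proof. by move=> lt; rewrite st_swp // /swap_pos eqxx. Qed.
Lemma st_swp_r n (w : arr n) l : (0 < l < n)%N -> st (arr_swp l w) l.+1 = st w l.
Proof.
by move=> lt; rewrite st_swp // /swap_pos /= eqxx ifF //; apply/eqP; lia.
Qed.
Lemma st_swp_o n (w : arr n) l l' : (0 < l < n)%N -> (0 < l')%N ->
  l' != l -> l' != l.+1 -> st (arr_swp l w) l' = st w l'.
Proof.
by move=> lt l0 ne ne'; rewrite st_swp // /swap_pos !ifF //; apply/eqP; lia.
Qed.
Lemma arr_swpK n l (w : arr n) : (0 < l < n)%N -> arr_swp l (arr_swp l w) = w.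
Proof.
by move=> lt; apply: val_inj; rewrite !val_arr_swp // swpK // size_arr.
Qed.
Lemma arr_swp_comm n l l' (w : arr n) : (0 < l < n)%N -> (0 < l' < n)%N ->
  (l.+1 < l')%N || (l'.+1 < l)%N ->
  arr_swp l (arr_swp l' w) = arr_swp l' (arr_swp l w).
Proof.
move=> lt lt' /orP[h|h]; apply: val_inj; rewrite !val_arr_swp //.
  by rewrite swp_comm ?size_arr //; lia.
by rewrite [RHS]swp_comm ?size_arr //; lia.
Qed.
Lemma arr_swp_braid n l (w : arr n) : (0 < l)%N -> (l.+1 < n)%N ->
  arr_swp l (arr_swp l.+1 (arr_swp l w)) = arr_swp l.+1 (arr_swp l (arr_swp l.+1 w)).
Proof.
move=> l0 lt; apply: val_inj; rewrite !val_arr_swp; try lia.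
by rewrite swp_braid ?size_arr.
Qed.

(** * Operators for dots, crossings and floating dots, and their relations *)

Section Operators.
Variables (C : cartanDatum) (k : comPzRingType) (Q : klrScalars C k).
Variables (c : nat -> C) (n : nat).

Local Notation K := (wK k n).
Local Notation X := (kX k n).
Local Notation D := (kD k n).
Local Notation S := (kS n).
Local Notation V := (arr n -> Wt k n).

Definition kQ (i j : C) (a b : K) : K :=
  \sum_(t < (dnum i j).+1) \sum_(v < (dnum j i).+1)
    S (sc_s Q i j t v) * a ^+ t * b ^+ v.

Lemma kQ_sym i j a b : i != j -> kQ i j a b = kQ j i b a.
Proof.
move=> ne; rewrite /kQ exchange_big; apply: eq_bigr => v _; apply: eq_bigr => t _.
by rewrite (sc_s_sym Q) // mulrAC.
Qed.

(* A crossing of the strands p, q acts by [ta p q] plus [tb p q] composed with the swap: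
   a divided difference for equal colours, and for distinct colours the polynomial Q_ij
   or 1 according to the order of the labels, so that the square is always Q_ij. *)
Definition ta (p q : nat) : K := if c p == c q then S (sc_r Q (c p)) * D p q else 0.
Definition tb (p q : nat) : K :=
  if c p == c q then - ta p q
  else if (p < q)%N then kQ (c p) (c q) (X p) (X q) else 1.
Definition tq (p q : nat) : K :=
  if c p == c q then 0 else kQ (c p) (c q) (X p) (X q).

Section Coef.
Variables p q r : nat.
Hypotheses (lp : (p < n)%N) (lq : (q < n)%N) (lr : (r < n)%N).
Hypotheses (pq : p != q) (qr : q != r) (pr : p != r).

Lemma taN : ta q p = - ta p q.
Proof.
rewrite /ta eq_sym; case: eqP => [->|_]; last by rewrite oppr0.
by rewrite (kDN lp lq pq) mulrN.
Qed.
Lemma ta_diff : ta p q * (X p - X q) = if c p == c q then S (sc_r Q (c p)) else 0.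
Proof.
by rewrite /ta; case: eqP => _; rewrite ?mul0r // -mulrA kDK ?mulr1.
Qed.
Lemma tbtb : tb p q * tb q p = tq p q - ta p q * ta p q.
Proof.
rewrite /tb /tq (eq_sym (c q)); case: eqP => [e|ne].
  by rewrite taN sub0r opprK mulNr.
rewrite /ta; case: eqP => // _; rewrite mul0r subr0.
have cn : c p != c q by apply/eqP.
case: (ltngtP p q) => [lt|lt|e]; rewrite ?mulr1 ?mul1r //; last by move: pq; rewrite e eqxx.
by rewrite kQ_sym // eq_sym.
Qed.
Lemma ta_tb : ta p q * tb p q + tb p q * ta q p = 0.
Proof. by rewrite taN; ring. Qed.
(** For three equal colours this is the partial fraction identity 1/((x_p - x_q)(x_q - x_r)) =
    (1/(x_p - x_r)) (1/(x_p - x_q) + 1/(x_q - x_r)); for all other colourings both sides vanish. *)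
Lemma taC : ta p q * ta q r = ta p r * (ta p q + ta q r).
Proof.
rewrite /ta; case: (c p =P c q) => [e1|n1]; case: (c q =P c r) => [e2|n2].
- rewrite -e1; case: (c p =P c r) => [_|n3]; last by case: n3; rewrite e1.
  have E : D p q * D q r = D p r * (D p q + D q r).
    have h1 := kDK lp lq pq; have h2 := kDK lq lr qr; have h3 := kDK lp lr pr.
    transitivity (D p q * D q r * (D p r * (X p - X r))); first by rewrite h3 mulr1.
    transitivity (D p r * (D q r * (D p q * (X p - X q)) + D p q * (D q r * (X q - X r)))).
      ring.
    by rewrite h1 h2; ring.
  transitivity (S (sc_r Q (c p)) * S (sc_r Q (c p)) * (D p q * D q r)); first by ring.
  by rewrite E; ring.
- by case: (c p =P c r) => [e3|_]; [case: n2; rewrite -e1|rewrite mulr0 mul0r].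
- by case: (c p =P c r) => [e3|_]; [case: n1; rewrite e3|rewrite !mul0r].
- by rewrite addr0 !mulr0.
Qed.
End Coef.

Definition vX (l : nat) (u : V) : V := fun w => wX (st w l) (u w).
Definition vE (i : n.-tuple C) (u : V) : V :=
  fun w => if [tuple c (nth 0%N (val w) p) | p < n] == i then u w else 0.
Definition vT (l : nat) (u : V) : V := fun w =>
  bact (ta (st w l) (st w l.+1)) (u w) + bact (tb (st w l) (st w l.+1)) (u (arr_swp l w)).

(* A floating dot acts by the sum over the strands q of colour j on its left of
   (-x_q)^a prod_(p <> q) F(p, q) zeta_q, with F = (x_p - x_q)^-1 for equal colours and
   F = Q_pj(x_p, x_q) otherwise. *)
Definition odd_sum (A : nat -> K) (s : seq nat) (y : Wt k n) : Wt k n :=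
  \sum_(q <- s) bact (A q) (wZ q y).
Definition kF (j : C) (p q : nat) : K :=
  if c p == j then D p q else kQ (c p) j (X p) (X q).
Definition om_coef (s : seq nat) (j : C) (a q : nat) : K :=
  if c q == j then (- X q) ^+ a * \prod_(p <- s | p != q) kF j p q else 0.
Definition vO (l : nat) (j : C) (a : nat) (u : V) : V :=
  fun w => odd_sum (om_coef (take l (val w)) j a) (take l (val w)) (u w).

Lemma vDE (u v : V) w : (u + v) w = u w + v w. Proof. by []. Qed.
Lemma vZE a (u : V) w : (a *: u) w = a *: u w. Proof. by []. Qed.

Fact vX_linear l : linear (vX l).
Proof. by move=> a u v; apply/funext => w; rewrite /vX linearP. Qed.
Fact vE_linear i : linear (vE i).
Proof.
move=> a u v; apply/funext => w; rewrite vDE vZE /vE vDE vZE.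
by case: ifP; rewrite ?scaler0 ?addr0.
Qed.
Fact vT_linear l : linear (vT l).
Proof.
move=> a u v; apply/funext => w; rewrite vDE vZE /vT !vDE !vZE !linearP /=.
by rewrite scalerDr addrACA.
Qed.
Fact odd_sum_linear A s : linear (odd_sum A s).
Proof.
move=> a u v; rewrite /odd_sum scaler_sumr -big_split /=; apply: eq_bigr => q _.
by rewrite linearP /= linearP.
Qed.
HB.instance Definition _ A s := GRing.isLinear.Build k (Wt k n) (Wt k n) _
  (odd_sum A s) (odd_sum_linear A s).
Fact vO_linear l j a : linear (vO l j a).
Proof. by move=> b u v; apply/funext => w; rewrite /vO linearP. Qed.
HB.instance Definition _ l := GRing.isLinear.Build k V V _ (vX l) (vX_linear l).
HB.instance Definition _ l := GRing.isLinear.Build k V V _ (vT l) (vT_linear l).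
HB.instance Definition _ i := GRing.isLinear.Build k V V _ (vE i) (vE_linear i).
HB.instance Definition _ l j a := GRing.isLinear.Build k V V _ (vO l j a) (vO_linear l j a).

Lemma odd_sum_anti A B s t y : odd_sum A s (odd_sum B t y) = - odd_sum B t (odd_sum A s y).
Proof.
have h A' B' s' t' : odd_sum A' s' (odd_sum B' t' y) =
    \sum_(q <- s') \sum_(p <- t') bact (A' q * B' p) (wZ q (wZ p y)).
  rewrite /odd_sum; apply: eq_bigr => q _; rewrite !linear_sum /=.
  by apply: eq_bigr => p _; rewrite bactM bact_wZ.
rewrite !h [in RHS]exchange_big -sumrN; apply: eq_bigr => q _.
rewrite -sumrN; apply: eq_bigr => p _.
by rewrite wZZ linearN mulrC.
Qed.

(** Anticommutation alone would only give that twice the square vanishes; splitting off one summand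
    at a time avoids dividing by 2. *)
Lemma odd_sum_sq A s y : odd_sum A s (odd_sum A s y) = 0.
Proof.
elim: s y => [|q s IH] y; first by rewrite /odd_sum big_nil.
have E z : odd_sum A (q :: s) z = odd_sum A [:: q] z + odd_sum A s z.
  by rewrite /odd_sum big_cons big_seq1.
rewrite !E !linearD /= (odd_sum_anti A A s [:: q]) IH addr0.
rewrite [X in X + _ - _](_ : _ = 0).
  by rewrite add0r subrr.
by rewrite /odd_sum !big_seq1 bact_wZ wZ2 !linear0.
Qed.

(** A floating dot depends only on the set of strands to its left, so it commutes with every
    crossing that does not change this set. *)
Lemma odd_sum_perm j a s t y : perm_eq s t ->
  odd_sum (om_coef s j a) s y = odd_sum (om_coef t j a) t y.
Proof.
move=> e; rewrite /odd_sum (perm_big _ e) /=; apply: eq_bigr => q _.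
by rewrite /om_coef; case: ifP => // _; rewrite (perm_big _ e).
Qed.
Lemma bact_odd_sum (a : K) A s y : odd_sum A s (bact a y) = bact a (odd_sum A s y).
Proof.
rewrite /odd_sum linear_sum /=; apply: eq_bigr => q _.
by rewrite bact_wZ -!bactM mulrC.
Qed.

Lemma bactK (a b : K) x : bact a (bact b x) = bact (a * b) x. Proof. by []. Qed.

Lemma bact_eq (a b : K) x : a = b -> bact a x = bact b x. Proof. by move->. Qed.

Lemma vT_sq l (u : V) w : (0 < l < n)%N ->
  vT l (vT l u) w = bact (tq (st w l) (st w l.+1)) (u w).
Proof.
move=> h; rewrite /vT st_swp_l // st_swp_r // arr_swpK //.
set p := st w l; set q := st w l.+1.
have lp : (p < n)%N by apply: st_lt; lia.
have lq : (q < n)%N by apply: st_lt; lia.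
have pq : p != q by apply: st_neq; lia.
rewrite !linearD /= !bactK (AC (2*2) ((1*4)*(2*3))) /= -!bactD.
by rewrite ta_tb // tbtb // bact0 addr0 addrCA subrr addr0.
Qed.

Lemma vX_vT l (u : V) w : (0 < l < n)%N ->
  vX l (vT l u) w = vT l (vX l.+1 u) w
    + (if c (st w l) == c (st w l.+1) then sc_r Q (c (st w l)) *: u w else 0).
Proof.
move=> h; rewrite /vT /vX st_swp_r //.
set p := st w l; set q := st w l.+1.
have lp : (p < n)%N by apply: st_lt; lia.
have lq : (q < n)%N by apply: st_lt; lia.
have pq : p != q by apply: st_neq; lia.
rewrite -!bact_kX !linearD /= !bactK [kX _ _ p * tb _ _]mulrC addrAC.
congr (_ + _); apply/eqP; rewrite -subr_eq0 opprD addrA -[- bact _ _]bactN.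
rewrite -bactD (_ : X p * ta p q + - (ta p q * X q) = ta p q * (X p - X q)); last by ring.
by rewrite ta_diff //; case: ifP; rewrite ?subrr // subr0.
Qed.

Lemma vT_vX l (u : V) w : (0 < l < n)%N ->
  vT l (vX l u) w = vX l.+1 (vT l u) w
    + (if c (st w l) == c (st w l.+1) then sc_r Q (c (st w l)) *: u w else 0).
Proof.
move=> h; rewrite /vT /vX st_swp_l //.
set p := st w l; set q := st w l.+1.
have lp : (p < n)%N by apply: st_lt; lia.
have lq : (q < n)%N by apply: st_lt; lia.
have pq : p != q by apply: st_neq; lia.
rewrite -!bact_kX !linearD /= !bactK [kX _ _ q * tb _ _]mulrC addrAC.
congr (_ + _); apply/eqP; rewrite -subr_eq0 opprD addrA -[- bact _ _]bactN.
rewrite -bactD (_ : ta p q * X p + - (X q * ta p q) = ta p q * (X p - X q)); last by ring.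
by rewrite ta_diff //; case: ifP; rewrite ?subrr // subr0.
Qed.

Lemma vT_vX_comm l l' (u : V) : (0 < l < n)%N -> (0 < l' <= n)%N ->
  l' != l -> l' != l.+1 -> vT l (vX l' u) = vX l' (vT l u).
Proof.
move=> h h' ne ne'; apply/funext => w; rewrite /vT /vX st_swp_o //; last lia.
by rewrite -!bact_kX linearD /= !bactK ![kX _ _ _ * _]mulrC.
Qed.

Lemma vT_vT_comm l l' (u : V) : (0 < l < n)%N -> (0 < l' < n)%N ->
  (l.+1 < l')%N || (l'.+1 < l)%N -> vT l (vT l' u) = vT l' (vT l u).
Proof.
move=> h h' hl; apply/funext => w; rewrite /vT.
rewrite !(@st_swp_o n _ (l) (l')) //; try lia.
rewrite !(@st_swp_o n _ (l) (l'.+1)) //; try lia.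
rewrite !(@st_swp_o n _ (l') (l)) //; try lia.
rewrite !(@st_swp_o n _ (l') (l.+1)) //; try lia.
rewrite (arr_swp_comm w h h') // !linearD /= !bactK.
by rewrite addrACA; congr (_ + _ + (_ + _)); congr (bact _ _); rewrite mulrC.
Qed.

(** Both triple products expand over the six permutations of the three strands. By [taC] all
    coefficients agree except that of the identity. For colours i, j, i the remaining difference is
    the divided difference of Q_ij in the variables of the outer strands. *)
Lemma vT_braid l (u : V) w : (0 < l)%N -> (l.+1 < n)%N ->
  let p := st w l in let q := st w l.+1 in let r := st w l.+2 in
  vT l (vT l.+1 (vT l u)) w - vT l.+1 (vT l (vT l.+1 u)) w
    = bact (ta p r * (tq p q - tq q r)) (u w).
Proof.
move=> l0 lt p q r.
have [h h'] : (0 < l < n)%N /\ (0 < l.+1 < n)%N by lia.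
have [lp [lq lr]] : (p < n)%N /\ (q < n)%N /\ (r < n)%N.
  by split; [|split]; apply: st_lt; lia.
have [pq [qr pr]] : p != q /\ q != r /\ p != r.
  by split; [|split]; apply: st_neq; lia.
have e1 (w' : arr n) : st (arr_swp l w') l = st w' l.+1 by rewrite st_swp_l.
have e2 (w' : arr n) : st (arr_swp l w') l.+1 = st w' l by rewrite st_swp_r.
have e3 (w' : arr n) : st (arr_swp l w') l.+2 = st w' l.+2 by rewrite st_swp_o //; lia.
have e4 (w' : arr n) : st (arr_swp l.+1 w') l = st w' l by rewrite st_swp_o //; lia.
have e5 (w' : arr n) : st (arr_swp l.+1 w') l.+1 = st w' l.+2 by rewrite st_swp_l.
have e6 (w' : arr n) : st (arr_swp l.+1 w') l.+2 = st w' l.+1 by rewrite st_swp_r.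
rewrite /vT !(e1, e2, e3, e4, e5, e6) -/p -/q -/r.
rewrite !arr_swpK // arr_swp_braid //.
set u0 := u w; set u1 := u (arr_swp l w); set u2 := u (arr_swp l.+1 w).
set u3 := u (arr_swp l.+1 (arr_swp l w)); set u4 := u (arr_swp l (arr_swp l.+1 w)).
set u5 := u _.
have I := taC lp lq lr pq qr pr.
have tqp := taN lp lq pq; have trq := taN lq lr qr.
have B1 := tbtb lp lq pq; have B2 := tbtb lq lr qr.
pose A := bact (ta p q * ta q r * ta p q + tb p q * ta p r * tb q p) u0
  + bact (ta p q * ta q r * tb p q + tb p q * ta p r * ta q p) u1
  + bact (ta p q * tb q r * ta p r) u2 + bact (ta p q * tb q r * tb p r) u4
  + bact (tb p q * tb p r * ta q r) u3 + bact (tb p q * tb p r * tb q r) u5.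
pose B := bact (ta q r * ta p q * ta q r + tb q r * ta p r * tb r q) u0
  + bact (ta q r * ta p q * tb q r + tb q r * ta p r * ta r q) u2
  + bact (ta q r * tb p q * ta p r) u1 + bact (ta q r * tb p q * tb p r) u3
  + bact (tb q r * tb p r * ta p q) u4 + bact (tb q r * tb p r * tb p q) u5.
transitivity (A - B).
  congr (_ - _); rewrite !linearD /= !bactK.
    rewrite (AC ((2*2)*(2*2)) ((1*6)*(2*5)*3*4*7*8)) /= -!bactD ?mulrA.
    by rewrite /A.
  rewrite (AC ((2*2)*(2*2)) ((1*6)*(2*5)*3*4*7*8)) /= -!bactD ?mulrA.
  by rewrite /B.
have c1 : ta p q * ta q r * tb p q + tb p q * ta p r * ta q p
    = ta q r * tb p q * ta p r.
  rewrite tqp; transitivity (tb p q * (ta p q * ta q r - ta p r * ta p q)); first by ring.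
  by rewrite I; ring.
have c2 : ta q r * ta p q * tb q r + tb q r * ta p r * ta r q
    = ta p q * tb q r * ta p r.
  rewrite trq; transitivity (tb q r * (ta p q * ta q r - ta p r * ta q r)); first by ring.
  by rewrite I; ring.
have c0 : ta p q * ta q r * ta p q + tb p q * ta p r * tb q p
    = ta q r * ta p q * ta q r + tb q r * ta p r * tb r q
      + ta p r * (tq p q - tq q r).
  transitivity (ta p q * ta q r * ta p q + ta p r * (tb p q * tb q p)); first by ring.
  transitivity (ta q r * ta p q * ta q r + ta p r * (tb q r * tb r q)
    + ta p r * (tq p q - tq q r)); last by ring.
  apply/eqP; rewrite B1 B2 -subr_eq0; apply/eqP.
  transitivity ((ta p q - ta q r) * (ta p q * ta q r - ta p r * (ta p q + ta q r))).
    by ring.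
  by rewrite I subrr mulr0.
rewrite {}/A {}/B c1 c2 c0 bactD.
rewrite (_ : ta q r * tb p q * tb p r = tb p q * tb p r * ta q r); last by ring.
rewrite (_ : tb q r * tb p r * ta p q = ta p q * tb q r * tb p r); last by ring.
rewrite (_ : tb q r * tb p r * tb p q = tb p q * tb p r * tb q r); last by ring.
apply/eqP; rewrite subr_eq; apply/eqP.
by rewrite [LHS](AC (((((2*1)*1)*1)*1)*1) (2*(1*4*3*6*5*7))).
Qed.

Lemma vX_comm l l' (u : V) : vX l (vX l' u) = vX l' (vX l u).
Proof. by apply/funext => w; rewrite /vX wX_comm. Qed.

Lemma vO_vX l j a l' (u : V) : vO l j a (vX l' u) = vX l' (vO l j a u).
Proof. by apply/funext => w; rewrite /vX /vO -!bact_kX bact_odd_sum. Qed.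

Lemma vO_vT l j a l' (u : V) : (0 < l' < n)%N -> l' != l ->
  vO l j a (vT l' u) = vT l' (vO l j a u).
Proof.
move=> h ne; apply/funext => w; rewrite /vO /vT linearD /= !bact_odd_sum.
congr (_ + bact _ _); apply: odd_sum_perm; rewrite val_arr_swp // perm_sym.
by apply: perm_take_swp; rewrite ?size_arr // eq_sym.
Qed.

Lemma vO_anti l j a l' j' a' (u : V) :
  vO l j a (vO l' j' a' u) = - vO l' j' a' (vO l j a u).
Proof. by apply/funext => w; rewrite /vO odd_sum_anti. Qed.

Lemma vO_sq l j a (u : V) : vO l j a (vO l j a u) = 0.
Proof. by apply/funext => w; rewrite /vO odd_sum_sq. Qed.

Lemma vO_0 j a (u : V) : vO 0 j a u = 0.
Proof. by apply/funext => w; rewrite /vO take0 /odd_sum big_nil. Qed.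

Lemma take_arr (w : arr n) l : (0 < l <= n)%N ->
  take l (val w) = rcons (take l.-1 (val w)) (st w l).
Proof.
case: l => // l lt; rewrite /st (take_nth 0%N) //.
by rewrite size_arr.
Qed.

Lemma arr_sub (w : arr n) l q : q \in take l (val w) -> (q < n)%N.
Proof. by move/mem_take; rewrite mem_arr. Qed.

Lemma notin_arr (w : arr n) l : (0 < l <= n)%N -> st w l \notin take l.-1 (val w).
Proof.
move=> lt; have : uniq (take l (val w)) by rewrite take_uniq ?uniq_arr.
by rewrite take_arr // rcons_uniq => /andP[].
Qed.

Lemma kS_sign v : S ((-1) ^+ v) = (-1) ^+ v :> K.
Proof.
elim: v => [|e IH]; first by rewrite !expr0 kS1.
rewrite !exprS kSM IH; congr (_ * _); apply: bicommutantP => x.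
by rewrite bactN bact_kS scaleN1r.
Qed.

Section AddStrand.
Variables (s : seq nat) (p : nat) (j : C).
Hypotheses (ps : p \notin s) (lp : (p < n)%N) (ls : forall q, q \in s -> (q < n)%N).

Lemma om_coef_rcons a q : q \in s ->
  om_coef (rcons s p) j a q = kF j p q * om_coef s j a q.
Proof.
move=> qs; have pq : p != q by apply: contraNneq ps => ->.
rewrite /om_coef; case: ifP => _; last by rewrite mulr0.
by rewrite -cats1 big_cat /= big_cons big_nil pq; ring.
Qed.

(** The summand of an old strand q uses (x_p - x_q) F(p, q) = 1; the two summands of the new strand
    p cancel, since (-x_p)^(a+1) + (-x_p)^a x_p = 0. *)
Lemma om_same a y : c p = j ->
  odd_sum (om_coef (rcons s p) j a.+1) (rcons s p) y
    = odd_sum (om_coef s j a) s y - odd_sum (om_coef (rcons s p) j a) (rcons s p) (wX p y).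
Proof.
move=> cp; apply/eqP; rewrite -bact_kX bact_odd_sum eq_sym subr_eq eq_sym.
rewrite /odd_sum -!cats1 !big_cat !big_cons !big_nil /= !addr0 !linearD /= linear_sum /=.
rewrite addrACA -big_split /=.
rewrite [X in _ + X](_ : _ = 0) ?addr0.
  apply/eqP/eq_big_seq => q qs; rewrite cats1 !bactK -bactD !om_coef_rcons //.
  have pq : p != q by apply: contraNneq ps => ->.
  rewrite /kF cp eqxx; apply: bact_eq; rewrite /om_coef; case: ifP => _; last by rewrite !mulr0 addr0.
  transitivity ((D p q * (X p - X q)) * ((- X q) ^+ a * \prod_(p0 <- s | p0 != q) kF j p0 q)).
    by rewrite exprS; ring.
  by rewrite kDK ?mul1r // ls.
rewrite bactK -bactD -[RHS](@bact0 k n (wZ p y)); apply: bact_eq.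
rewrite /om_coef cp eqxx exprS; ring.
Qed.

(** A strand of another colour adds no summand, only the factor Q(x_p, x_q) in each of them; the
    sign (-1)^v turns the v extra factors -x_q into x_q^v. *)
Lemma om_other a y : c p != j ->
  odd_sum (om_coef (rcons s p) j a) (rcons s p) y
    = \sum_(t < (dnum (c p) j).+1) \sum_(v < (dnum j (c p)).+1)
        sc_s Q (c p) j t v *: ((-1) ^+ v *: bact (X p ^+ t) (odd_sum (om_coef s j (a + v)) s y)).
Proof.
move=> cp.
have scal b x : b *: x = bact (S b) x by [].
rewrite /odd_sum -cats1 big_cat big_cons big_nil /= !addr0 cats1.
rewrite [X in _ + X](_ : _ = 0) ?addr0; last first.
  by rewrite /om_coef (negbTE cp) bact0.
under [RHS]eq_bigr => t _.
  under eq_bigr => v _ do rewrite !linear_sum /=.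
  rewrite exchange_big /=.
  over.
rewrite exchange_big /=; apply: eq_big_seq => q qs.
rewrite om_coef_rcons // /kF (negbTE cp).
under eq_bigr => t _ do under eq_bigr => v _ do rewrite !scal !bactK.
under eq_bigr => t _ do rewrite -bact_sum.
rewrite -bact_sum; apply: bact_eq; rewrite /kQ mulr_suml; apply: eq_bigr => t _.
rewrite mulr_suml; apply: eq_bigr => v _.
rewrite /om_coef; case: ifP => _; last by rewrite !mulr0.
have sg : (-1) ^+ v * (-1) ^+ v = 1 :> K by rewrite -expr2 sqrr_sign.
rewrite kS_sign exprD (exprNn (X q) v) -[LHS]mul1r -{1}sg; ring.
Qed.
End AddStrand.

Lemma iter_vX l t (u : V) w : iter t (vX l) u w = bact (X (st w l) ^+ t) (u w).
Proof. by elim: t => //= t; rewrite exprS bactM => <-. Qed.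

Lemma om_coefD s j a i q : om_coef s j (a + i) q = (- X q) ^+ i * om_coef s j a q.
Proof. by rewrite /om_coef; case: ifP; rewrite ?mulr0 // exprD => _; ring. Qed.

(** The two crossings together contribute Q(x_p, x_q), with p, q the strands l and l+1. For a strand
    r further left, Omega_(l+1) has Q(x_p, x_r) in its place; the difference times 1/(x_q - x_r) is
    a divided difference of Q, which gives the correction sum. *)
Lemma vO_bubble l j a (u : V) w : (0 < l < n)%N ->
    c (st w l) != j -> c (st w l.+1) = j ->
  vT l (vO l j a (vT l u)) w = vO l.+1 j a u w
    + \sum_(t < (dnum (c (st w l)) j).+1) \sum_(v < (dnum j (c (st w l))).+1)
        sc_s Q (c (st w l)) j t v *: \sum_(i < v) (-1) ^+ i *:
          vO l.-1 j (a + i) (iter t (vX l) (iter (v.-1 - i) (vX l.+1) u)) w.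
Proof.
move=> h cp cq.
set s := take l.-1 (val w); set u0 := u w.
have tl : take l (val w) = rcons s (st w l) by rewrite take_arr //; lia.
have tl1 : take l.+1 (val w) = rcons (rcons s (st w l)) (st w l.+1).
  by rewrite take_arr /= ?tl //; lia.
have tls : take l (val (arr_swp l w)) = rcons s (st w l.+1).
  rewrite take_arr; last lia.
  rewrite st_swp_l //; congr rcons; rewrite val_arr_swp // /swp take_cat.
  rewrite size_takel ?size_arr ?ltnn ?subnn ?take0 ?cats0 //; lia.
have ps : st w l \notin s by apply: notin_arr; lia.
have qs : st w l.+1 \notin rcons s (st w l) by rewrite -tl; apply: (@notin_arr w l.+1); lia.
have qs' : st w l.+1 \notin s by apply: contraNN qs; rewrite mem_rcons inE => ->; rewrite orbT.
have lq : (st w l.+1 < n)%N by apply: st_lt; lia.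
have lp : (st w l < n)%N by apply: st_lt; lia.
have ls r : r \in s -> (r < n)%N by apply: arr_sub.
have pq : st w l != st w l.+1 by apply: st_neq; lia.
rewrite {1}/vT [vO l.+1 _ _ _ _]/vO [vO l _ _ _ (arr_swp l w)]/vO [vO l _ _ _ w]/vO.
rewrite /vT tls tl1 st_swp_l // st_swp_r // arr_swpK //.
set p := st w l in cp tl tl1 ps qs lp pq *; set q := st w l.+1 in cq tl1 tls qs qs' lq pq *.
have npq : (c p == c q) = false by rewrite cq; apply/negbTE.
have ta0 : ta p q = 0 by rewrite /ta npq.
have ta0' : ta q p = 0 by rewrite /ta eq_sym npq.
rewrite ta0 ta0' !bact0 !add0r bact_odd_sum bactK tbtb // ta0 mulr0 subr0.
rewrite /tq npq cq.
under [X in _ + X]eq_bigr => t _.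
  under eq_bigr => v _.
    under eq_bigr => i _ do rewrite /vO !iter_vX bact_odd_sum -/p -/q -/s -/u0 bact_odd_sum.
    over.
  over.
rewrite /odd_sum -[in LHS]cats1 big_cat big_cons big_nil /= addr0 linearD /=.
rewrite -[in RHS]cats1 big_cat big_cons big_nil /= addr0.
rewrite -[in RHS]cats1 big_cat big_cons big_nil /= addr0 !cats1.
rewrite [X in _ + X + _ + _](_ : _ = 0) ?addr0; last by rewrite /om_coef (negbTE cp) bact0.
rewrite -addrA [X in _ = _ + X]addrC addrA; congr (_ + _); last first.
  rewrite bactK; apply: bact_eq; rewrite /om_coef cq eqxx.
  rewrite -!cats1 !big_cat !big_cons !big_nil /= eqxx pq /= /kF (negbTE cp); ring.
have scal b x : b *: x = bact (S b) x by [].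
under [X in _ = _ + X]eq_bigr => t _.
  under eq_bigr => v _.
    under eq_bigr => i _ do rewrite scal !bactK !linear_sum /=.
    rewrite exchange_big /= scaler_sumr.
    over.
  rewrite exchange_big /=.
  over.
rewrite linear_sum exchange_big /= -big_split /=; apply: eq_big_seq => r rs.
have qr : q != r by apply: contraNneq qs' => ->.
have rsp : r \in rcons s p by rewrite mem_rcons inE rs orbT.
under eq_bigr => t _.
  under eq_bigr => v _.
    under eq_bigr => i _ do rewrite bactK.
    rewrite -bact_sum scal bactK.
    over.
  rewrite -bact_sum.
  over.
rewrite -bact_sum -bactD bactK; apply: bact_eq.
rewrite (om_coef_rcons j qs' a rs) (om_coef_rcons j qs a rsp) (om_coef_rcons j ps a rs).
have -> : kF j q r = D q r by rewrite /kF cq eqxx.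
rewrite {1}/kF (negbTE cp).
transitivity (kQ (c p) j (X p) (X q) * D q r * om_coef s j a r); first by ring.
apply/eqP; rewrite addrC -subr_eq; apply/eqP.
transitivity ((kQ (c p) j (X p) (X q) - kQ (c p) j (X p) (X r)) * (D q r * om_coef s j a r)).
  by ring.
rewrite /kQ -sumrB mulr_suml; apply: eq_bigr => t _.
rewrite -sumrB mulr_suml; apply: eq_bigr => v _.
transitivity (S (sc_s Q (c p) j t v) * X p ^+ t * om_coef s j a r
   * ((X q ^+ v - X r ^+ v) * D q r)); first by ring.
rewrite subrXX; set Sg := \sum_(i < v) _.
transitivity (S (sc_s Q (c p) j t v) * X p ^+ t * om_coef s j a r
   * (D q r * (X q - X r)) * Sg); first by ring.
rewrite (kDK lq (ls r rs) qr) mulr1 {}/Sg.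
rewrite !mulr_sumr; apply: eq_bigr => i _.
have sg : (-1) ^+ i * (-1) ^+ i = 1 :> K by rewrite -expr2 sqrr_sign.
rewrite om_coefD kS_sign (exprNn (X r) i) -[LHS]mul1r -{1}sg -(subn1 v) subnAC subn1; ring.
Qed.

End Operators.

(** * The representation of the algebra *)

Section Representation.
Variables (C : cartanDatum) (k : comPzRingType) (Q : klrScalars C k).
Variables (n : nat) (c : nat -> C).

Local Notation V := (arr n -> Wt k n).
Local Notation uX := (@vX k n).
Local Notation vE := (@vE C k c n).
Local Notation uT := (vT Q c).
Local Notation uO := (vO Q c).
Local Notation T := (fterm k (rb_gen C n)).
Local Notation F := (rb_free C k n).

Definition gact (g : rb_gen C n) : V -> V :=
  match g with
  | GIdem i => vE i
  | GDot p => uX (val p)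
  | GCross p => uT (val p)
  | GFloat p j a => uO (val p) j a
  end.

Fact gact_linear g : linear (gact g).
Proof.
case: g => [i|p|p|p j a].
- exact: vE_linear.
- exact: vX_linear.
- exact: vT_linear.
- exact: vO_linear.
Qed.

Fixpoint tact (t : T) : V -> V :=
  match t with
  | FGen g => gact g
  | FConst a => *:%R a
  | FAdd s t => fun u => tact s u + tact t u
  | FMul s t => fun u => tact s (tact t u)
  end.

Fact tact_linear t : linear (tact t).
Proof.
elim: t => [g|b|s IHs t IHt|s IHs t IHt] /= a u v.
- exact: gact_linear.
- by rewrite scalerDr !scalerA mulrC.
- by rewrite IHs IHt scalerDr addrACA.
- by rewrite IHt IHs.
Qed.
HB.instance Definition _ t := GRing.isLinear.Build k V V _ (tact t) (tact_linear t).

Lemma tact_feq s t : feq s t -> forall u, tact s u = tact t u.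
Proof.
elim=> {s t}.
- by [].
- by move=> s t _ IH u.
- by move=> s t u _ IH1 _ IH2 v; rewrite IH1.
- by move=> s s' t t' _ IH1 _ IH2 u /=; rewrite IH1 IH2.
- by move=> s s' t t' _ IH1 _ IH2 u /=; rewrite IH1 IH2.
- by move=> s t u v /=; rewrite addrA.
- by move=> s t u /=; rewrite addrC.
- by move=> t u /=; rewrite scale0r add0r.
- by move=> t u /=; rewrite scaleN1r addNr scale0r.
- by [].
- by move=> t u /=; rewrite scale1r.
- by [].
- by move=> s t u v /=; rewrite linearD.
- by move=> a b u /=; rewrite scalerDl.
- by move=> a b u /=; rewrite scalerA.
- by move=> a t u /=; rewrite linearZ.
Qed.

Definition fact (z : F) : V -> V := tact (frepr z).

Lemma fact_pi t u : fact (fpi (rb_deg (m:=n)) t) u = tact t u.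
Proof. by apply: tact_feq; apply: frepr_feq. Qed.
Lemma factD (y z : F) u : fact (y + z) u = fact y u + fact z u.
Proof. by elim/free_ind: y => s; elim/free_ind: z => t; rewrite -fpiD !fact_pi. Qed.
Lemma factM (y z : F) u : fact (y * z) u = fact y (fact z u).
Proof. by elim/free_ind: y => s; elim/free_ind: z => t; rewrite -fpiM !fact_pi. Qed.
Lemma fact_ascal a u : fact (ascal a) u = a *: u.
Proof. exact: fact_pi. Qed.
Fact fact_linear z : linear (fact z).
Proof. exact: tact_linear. Qed.
HB.instance Definition _ z := GRing.isLinear.Build k V V _ (fact z) (fact_linear z).
Lemma fact0 u : fact 0 u = 0.
Proof. by rewrite -(ascal0 (rb_free C k n)) fact_ascal scale0r. Qed.
Lemma fact1 u : fact 1 u = u.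
Proof. by rewrite -(ascal1 (s := rb_free C k n)) fact_ascal scale1r. Qed.
Lemma factN z u : fact (- z) u = - fact z u.
Proof. by apply: (addIr (fact z u)); rewrite -factD !addNr fact0. Qed.
Lemma fact_sum (J : Type) (r : seq J) (P : pred J) (E : J -> F) u :
  fact (\sum_(j <- r | P j) E j) u = \sum_(j <- r | P j) fact (E j) u.
Proof. by apply: (big_morph (fun z => fact z u)) => [y z|]; rewrite ?factD ?fact0. Qed.
Lemma factX z e u : fact (z ^+ e) u = iter e (fact z) u.
Proof. by elim: e u => [|e IH] u; rewrite ?fact1 // exprS factM IH. Qed.
Lemma fact_sign e u : fact ((-1) ^+ e) u = (-1) ^+ e *: u.
Proof.
elim: e => [|e IH]; first by rewrite fact1 scale1r.
by rewrite !exprS factM IH factN fact1 mulN1r scaleNr.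
Qed.

Lemma fact_fe i u : fact (fe k i) u = vE i u.
Proof. exact: fact_pi. Qed.
Lemma fact_fx l u : (0 < l <= n)%N -> fact (fx C k n l) u = uX l u.
Proof.
move=> h; rewrite /fx; case: insubP => [p _ <-|] /=; last by rewrite h.
exact: fact_pi.
Qed.
Lemma fact_ftau l u : (0 < l < n)%N -> fact (ftau C k n l) u = uT l u.
Proof.
move=> h; rewrite /ftau; case: insubP => [p _ <-|] /=; last by rewrite h.
exact: fact_pi.
Qed.
Lemma fact_fom l j a u : (l <= n)%N -> fact (fom k n l j a) u = uO l j a u.
Proof.
move=> h; rewrite /fom; case: insubP => [p _ <-|] /=; last by rewrite h.
exact: fact_pi.
Qed.
Lemma fx_out l : ~~ (0 < l <= n)%N -> fx C k n l = 0.
Proof. by move=> h; rewrite /fx insubN. Qed.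
Lemma ftau_out l : ~~ (0 < l < n)%N -> ftau C k n l = 0.
Proof. by move=> h; rewrite /ftau insubN. Qed.
Lemma fom_out l (j : C) a : ~~ (l <= n)%N -> fom k n l j a = 0.
Proof. by move=> h; rewrite /fom insubN. Qed.

Definition col (w : arr n) : n.-tuple C := [tuple c (nth 0%N (val w) p) | p < n].

Lemma colour_col w l j : colour (col w) l j = (0 < l <= n)%N && (c (st w l) == j).
Proof.
apply/existsP/andP => [[p /andP[/eqP <- /eqP <-]]|[/andP[l0 ln] /eqP <-]].
  by rewrite ltn_ord /st tnth_mktuple eqxx.
have ln' : (l.-1 < n)%N by lia.
by exists (Ordinal ln'); rewrite tnth_mktuple /st /= prednK // !eqxx.
Qed.

Lemma col_swp w l : (0 < l < n)%N -> col (arr_swp l w) = swap l (col w).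
Proof.
move=> h; apply: eq_from_tnth => p; rewrite !tnth_mktuple val_arr_swp //.
rewrite nth_swp ?size_arr //; congr (c (nth _ _ _)).
rewrite /insubd insubT //; rewrite /swap_pos; have := ltn_ord p.
by case: eqP => _; [lia|case: eqP => _; lia].
Qed.

Lemma swapK l (i : n.-tuple C) : (0 < l < n)%N -> swap l (swap l i) = i.
Proof.
move=> h; apply: eq_from_tnth => p; rewrite !tnth_mktuple; congr tnth.
have lt (p' : 'I_n) : (swap_pos l p' < n)%N.
  rewrite /swap_pos; have := ltn_ord p'.
  by case: eqP => _; [lia|case: eqP => _; lia].
apply: val_inj; rewrite val_insubd lt val_insubd lt /swap_pos /=.
case: (nat_of_ord p =P l.-1) => ?; case: (nat_of_ord p =P l) => ?; repeat case: eqP => ?; lia.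
Qed.

Lemma vsumE (J : Type) (r : seq J) (P : pred J) (E : J -> V) w :
  (\sum_(j <- r | P j) E j) w = \sum_(j <- r | P j) E j w.
Proof. by apply: (big_morph (fun u : V => u w)). Qed.

Lemma vEE i u w : vE i u w = if col w == i then u w else 0.
Proof. by []. Qed.

Lemma colour_range (i : n.-tuple C) l j : colour i l j -> (0 < l <= n)%N.
Proof. by case/existsP => p /andP[/eqP <- _]; rewrite ltn_ord. Qed.

Lemma fact_ssum i j f u : fact (ssum Q i j f) u =
  \sum_(t < (dnum i j).+1) \sum_(v < (dnum j i).+1) sc_s Q i j t v *: fact (f t v) u.
Proof.
rewrite fact_sum; apply: eq_bigr => t _; rewrite fact_sum; apply: eq_bigr => v _.
by rewrite factM fact_ascal.
Qed.

Lemma vX_vE l i u : uX l (vE i u) = vE i (uX l u).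
Proof. by apply/funext => w; rewrite /vX !vEE; case: ifP; rewrite ?linear0. Qed.
Lemma vO_vE l j a i u : uO l j a (vE i u) = vE i (uO l j a u).
Proof. by apply/funext => w; rewrite /vO !vEE; case: ifP; rewrite ?linear0. Qed.
Lemma vT_vE l i u : (0 < l < n)%N -> uT l (vE i u) = vE (swap l i) (uT l u).
Proof.
move=> h; apply/funext => w; rewrite [RHS]vEE /vT !vEE col_swp //.
have -> : (col w == swap l i) = (swap l (col w) == i).
  by apply/eqP/eqP => [->|<-]; rewrite swapK.
have [same|diff] := eqVneq (c (st w l)) (c (st w l.+1)).
  have -> : swap l (col w) = col w.
    apply: eq_from_tnth => p; rewrite -col_swp // !tnth_mktuple val_arr_swp //.
    rewrite nth_swp ?size_arr // /swap_pos.
    case: eqP => [->|_]; first by rewrite -[l in nth _ _ l]/(l.+1.-1) -/(st w l.+1) -same.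
    by case: eqP => // ->; rewrite -/(st w l) same.
  by case: ifP; rewrite ?linear0 ?addr0.
rewrite /ta (negbTE diff) !bact0 !add0r.
by case: ifP; rewrite ?linear0.
Qed.

Lemma fact_rel x y : rb_rel Q x y -> forall u, fact x u = fact y u.
Proof.
have wle l : (0 < l < n)%N -> (0 < l <= n)%N by lia.
have wle1 l : (0 < l < n)%N -> (0 < l.+1 <= n)%N by lia.
case=> {x y}.
- move=> i i' u; rewrite factM !fact_fe; apply/funext => w.
  case: eqP => [<-|ne]; first by rewrite fact_fe !vEE; case: ifP => // ->.
  by rewrite fact0 !vEE; case: eqP => // ->; case: eqP.
- move=> u; rewrite fact1 fact_sum; apply/funext => w; rewrite vsumE.
  rewrite (bigD1 (col w)) //= fact_fe vEE eqxx big1 ?addr0 // => i ne.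
  by rewrite fact_fe vEE eq_sym (negbTE ne).
- move=> l i u; have [h|h] := boolP (0 < l <= n)%N; last by rewrite fx_out // mul0r mulr0.
  by rewrite !factM !fact_fe !fact_fx // vX_vE.
- move=> l j a i u; have [h|h] := boolP (l <= n)%N; last by rewrite fom_out // mul0r mulr0.
  by rewrite !factM !fact_fe !fact_fom // vO_vE.
- by move=> l i h u; rewrite !factM !fact_fe !fact_ftau // vT_vE.
- move=> l l' u; have [h|h] := boolP (0 < l <= n)%N; last by rewrite fx_out // mul0r mulr0.
  have [h'|h'] := boolP (0 < l' <= n)%N; last by rewrite (fx_out h') mul0r mulr0.
  by rewrite !factM !fact_fx // vX_comm.
- move=> l l' hl u; have [h|h] := boolP (0 < l < n)%N; last by rewrite ftau_out // mul0r mulr0.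
  have [h'|h'] := boolP (0 < l' < n)%N; last by rewrite (ftau_out h') mul0r mulr0.
  by rewrite !factM !fact_ftau // vT_vT_comm.
- move=> l l' n1 n2 u; have [h|h] := boolP (0 < l < n)%N; last by rewrite ftau_out // mul0r mulr0.
  have [h'|h'] := boolP (0 < l' <= n)%N; last by rewrite (fx_out h') mul0r mulr0.
  by rewrite !factM !fact_ftau // !fact_fx // ?fact_ftau // vT_vX_comm.
- move=> l j a l' u; have [h|h] := boolP (l <= n)%N; last by rewrite fom_out // mul0r mulr0.
  have [h'|h'] := boolP (0 < l' <= n)%N; last by rewrite (fx_out h') mul0r mulr0.
  by rewrite !factM !fact_fom // !fact_fx // ?fact_fom // vO_vX.
- move=> l j a l' ne u; have [h|h] := boolP (l <= n)%N; last by rewrite fom_out // mul0r mulr0.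
  have [h'|h'] := boolP (0 < l' < n)%N; last by rewrite (ftau_out h') mul0r mulr0.
  by rewrite !factM !fact_fom // !fact_ftau // ?fact_fom // vO_vT.
- move=> i l j h1 h2 u; have := colour_range h1; have := colour_range h2 => r2 r1.
  have h : (0 < l < n)%N by lia.
  rewrite factM factX fact0 /= fact_fe !fact_ftau //; apply/funext => w.
  rewrite vT_sq // vEE; case: eqP => [e|_]; last by rewrite linear0.
  move: h1 h2; rewrite -e !colour_col => /andP[_ /eqP e1] /andP[_ /eqP e2].
  by rewrite /tq e1 e2 eqxx bact0.
- move=> i l j j' h1 h2 ne u; have := colour_range h1; have := colour_range h2 => r2 r1.
  have h : (0 < l < n)%N by lia.
  rewrite factM factX fact_ssum /= fact_fe !fact_ftau //; apply/funext => w.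
  rewrite vT_sq // vsumE; under [RHS]eq_bigr do rewrite vsumE.
  under [RHS]eq_bigr => t _.
    under eq_bigr => v _.
      rewrite !factM !factX fact_fe (eq_iter (fun x => fact_fx x r1)) (eq_iter (fun x => fact_fx x r2)) vZE !iter_vX.
      over.
    over.
  rewrite vEE; case: eqP => [e|_]; last first.
    rewrite linear0; symmetry; rewrite big1 // => t _; rewrite big1 // => v _.
    by rewrite !linear0.
  move: h1 h2; rewrite -e !colour_col => /andP[_ /eqP e1] /andP[_ /eqP e2].
  rewrite /tq e1 e2 (negbTE ne) /kQ bact_sum; apply: eq_bigr => t _.
  by rewrite bact_sum; apply: eq_bigr => v _.
- move=> i l j j' h1 h2 u; have := colour_range h1; have := colour_range h2 => r2 r1.
  have h : (0 < l < n)%N by lia.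
  rewrite factD !factM fact_fe !fact_ftau // !fact_fx //; apply/funext => w.
  rewrite vDE vX_vT //; congr (_ + _); rewrite vEE; case: (col w =P i) => [e|ne].
    move: h1 h2; rewrite -e !colour_col => /andP[_ /eqP e1] /andP[_ /eqP e2].
    rewrite e1 e2; case: ifP => _; last by rewrite fact0.
    by rewrite factM fact_ascal fact_fe vZE vEE e eqxx.
  rewrite scaler0 if_same; case: ifP => _; last by rewrite fact0.
  by rewrite factM fact_ascal fact_fe vZE vEE; case: eqP => // _; rewrite scaler0.
- move=> i l j j' h1 h2 u; have := colour_range h1; have := colour_range h2 => r2 r1.
  have h : (0 < l < n)%N by lia.
  rewrite factD !factM fact_fe !fact_ftau // !fact_fx // ?fact_ftau //; apply/funext => w.
  rewrite vDE vT_vX //; congr (_ + _); rewrite vEE; case: (col w =P i) => [e|ne].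
    move: h1 h2; rewrite -e !colour_col => /andP[_ /eqP e1] /andP[_ /eqP e2].
    rewrite e1 e2; case: ifP => _; last by rewrite fact0.
    by rewrite factM fact_ascal fact_fe vZE vEE e eqxx.
  rewrite scaler0 if_same; case: ifP => _; last by rewrite fact0.
  by rewrite factM fact_ascal fact_fe vZE vEE; case: eqP => // _; rewrite scaler0.
- move=> i l j j' j'' h1 h2 h3 u.
  have := colour_range h1; have := colour_range h2; have := colour_range h3 => r3 r2 r1.
  have [h h'] : (0 < l < n)%N /\ (0 < l.+1 < n)%N by lia.
  rewrite factM factD factN !factM fact_fe !(fun x => fact_ftau x h) !(fun x => fact_ftau x h').
  apply/funext => w; rewrite -[LHS]/(_ w - _ w) vT_braid //; try lia.
  have E (b : bool) (f : F) : fact (if b then f else 0) u w = if b then fact f u w else 0.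
    by case: b => //; rewrite fact0.
  rewrite {}E factM fact_ascal vZE fact_ssum vsumE.
  under [X in _ *: X]eq_bigr => t _.
    rewrite vsumE; under eq_bigr => v _.
      rewrite vZE fact_sum vsumE; under eq_bigr => o _.
        rewrite !factM !factX fact_fe (eq_iter (fun x => fact_fx x r1)) (eq_iter (fun x => fact_fx x r2)).
        rewrite (eq_iter (fun x => fact_fx x r3)) !iter_vX !bactK.
        over.
      rewrite -bact_sum -[_ *: _](bact_kS (m := n)) bactK.
      over.
    rewrite -bact_sum.
    over.
  rewrite -bact_sum -[_ *: _](bact_kS (m := n)) bactK vEE.
  case: eqP => [e|_]; last by rewrite !linear0 if_same.
  move: h1 h2 h3; rewrite -e !colour_col.
  move=> /andP[_ /eqP e1] /andP[_ /eqP e2] /andP[_ /eqP e3].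
  set p := st w l in e1 *; set q := st w l.+1 in e2 *; set r := st w l.+2 in e3 *.
  have lp : (p < n)%N by apply: st_lt; lia.
  have lr : (r < n)%N by apply: st_lt; lia.
  have pr : p != r by apply: st_neq; lia.
  case: ifP => [/andP[/eqP jj'' jj']|/negP jn]; last first.
    rewrite -[RHS](@bact0 k n (u w)); apply: bact_eq; rewrite /ta /tq e1 e2 e3.
    case: eqP jn => [<-|_] jn; last by rewrite mul0r.
    by case: eqP jn => [->|_ []] //; rewrite eqxx subrr mulr0.
  apply: bact_eq; rewrite /ta /tq e1 e2 e3 -jj'' eqxx (negbTE jj') (eq_sym j') (negbTE jj').
  rewrite (kQ_sym Q _ _ (_ : j' != j)); last by rewrite eq_sym.
  rewrite -mulrA; congr (_ * _); rewrite /kQ -sumrB mulr_sumr; apply: eq_bigr => t _.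
  rewrite -sumrB mulr_sumr; apply: eq_bigr => v _.
  transitivity (kS n (sc_s Q j j' t v) * kX k n q ^+ v
    * (kD k n p r * (kX k n p ^+ t - kX k n r ^+ t))); first by ring.
  rewrite subrXX; set Sg := \sum_(i0 < t) _.
  rewrite (mulrA (kD k n p r)) (kDK lp lr pr) mul1r -mulrA mulr_sumr; congr (_ * _).
  (* [subrXX] lists the monomials of the divided difference in the order opposite to the braid
     relation. *)
  rewrite [LHS](reindex_inj rev_ord_inj); apply: eq_bigr => o _ /=.
  have lo := ltn_ord o; have -> : (t - o.+1 = t.-1 - o)%N by lia.
  have -> : (t.-1 - (t.-1 - o) = o)%N by lia.
  by ring.
- move=> l j a l' j' a' u; have [h|h] := boolP (l <= n)%N; last by rewrite fom_out // mul0r mulr0 oppr0.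
  have [h'|h'] := boolP (l' <= n)%N; last by rewrite (fom_out _ _ h') mul0r mulr0 oppr0.
  by rewrite factN !factM !fact_fom // ?fact_fom // vO_anti.
- move=> l j a u; have [h|h] := boolP (l <= n)%N; last by rewrite fom_out // expr0n.
  by rewrite expr2 factM !fact_fom // vO_sq fact0.
- by move=> j a u; rewrite fact0 fact_fom // vO_0.
- move=> i l j a h u; have r := colour_range h.
  have [r1 r2] : (l <= n)%N /\ (l.-1 <= n)%N by lia.
  rewrite factD factN !factM !fact_fe !fact_fom // fact_fx //; apply/funext => w.
  rewrite -[RHS]/(_ w - _ w) /vO /vX.
  rewrite vEE; case: eqP => [e|_]; last by rewrite !linear0 ?oppr0 addr0.
  move: h; rewrite -e colour_col => /andP[_ /eqP e1].
  rewrite take_arr // om_same //; first exact: notin_arr.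
    exact: st_lt.
  by move=> q; apply: arr_sub.
- move=> i l i' j a h ne u; have r := colour_range h.
  have [r1 r2] : (l <= n)%N /\ (l.-1 <= n)%N by lia.
  rewrite factM fact_fom // fact_fe fact_ssum; apply/funext => w; rewrite vsumE.
  under [RHS]eq_bigr => t _.
    rewrite vsumE; under eq_bigr => v _.
      rewrite !factM fact_sign !factX fact_fe (eq_iter (fun x => fact_fx x r)) fact_fom // !vZE iter_vX.
      over.
    over.
  rewrite /vO vEE; case: eqP => [e|_]; last first.
    rewrite linear0; symmetry; rewrite big1 // => t _; rewrite big1 // => v _.
    by rewrite !linear0.
  move: h; rewrite -e colour_col => /andP[_ /eqP e1].
  rewrite take_arr // om_other ?e1 //; exact: notin_arr.
- move=> i l i' j a h1 h2 ne u; have := colour_range h1; have := colour_range h2 => r2 r1.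
  have h : (0 < l < n)%N by lia.
  have [q0 [q1 q2]] : (l <= n)%N /\ (l.-1 <= n)%N /\ (l.+1 <= n)%N by lia.
  rewrite factD !factM fact_fe !fact_ftau // !fact_fom // fact_ssum; apply/funext => w.
  rewrite vDE vsumE.
  under [X in _ = _ + X]eq_bigr => t _.
    rewrite vsumE; under eq_bigr => v _.
      rewrite vZE fact_sum vsumE; under eq_bigr => o _.
        rewrite !factM fact_sign !factX fact_fe (eq_iter (fun x => fact_fx x r1)).
        rewrite (eq_iter (fun x => fact_fx x r2)) fact_fom // vZE.
        over.
      over.
    over.
  have [e|ne'] := eqVneq (col w) i.
    move: h1 h2; rewrite -e !colour_col => /andP[_ /eqP e1] /andP[_ /eqP e2].
    by rewrite vO_bubble ?e1 ?e2.
  rewrite [X in _ + X]big1 ?addr0; last first.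
    move=> t _; rewrite big1 // => v _; rewrite big1 ?scaler0 // => o _.
    by rewrite /vO !iter_vX vEE (negbTE ne') !linear0.
  rewrite vT_vE // vO_vE vT_vE // swapK // vEE (negbTE ne').
  by rewrite /vO vEE (negbTE ne') linear0.
Qed.

Lemma fact_ideal z : Rb_ideal Q n z -> forall u, fact z u = 0.
Proof.
elim=> {z} [z [x [y [xy ->]]] u||x y _ IHx _ IHy u|a x _ IH u|a x _ IH u].
- by rewrite factD factN (fact_rel xy) subrr.
- exact: fact0.
- by rewrite factD IHx IHy addr0.
- by rewrite factM IH linear0.
- by rewrite factM IH.
Qed.

Definition rho (z : Rb Q n) : V -> V := fact (repr z).

Lemma rho_pi z u : rho (qpi (Rb_ideal Q n) z) u = fact z u.
Proof.
apply/eqP; rewrite -subr_eq0 -factN -factD; apply/eqP.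
exact/fact_ideal/quot_repr.
Qed.
Lemma rhoD (y z : Rb Q n) u : rho (y + z) u = rho y u + rho z u.
Proof. by elim/quot_ind: y => y; elim/quot_ind: z => z; rewrite -qpiD !rho_pi factD. Qed.
Lemma rhoM (y z : Rb Q n) u : rho (y * z) u = rho y (rho z u).
Proof. by elim/quot_ind: y => y; elim/quot_ind: z => z; rewrite -qpiM !rho_pi factM. Qed.
Lemma rho_ascal a u : rho (ascal a) u = a *: u.
Proof. by rewrite -qpi_ascal rho_pi fact_ascal. Qed.
Fact rho_linear z : linear (rho z).
Proof. exact: fact_linear. Qed.
HB.instance Definition _ z := GRing.isLinear.Build k V V _ (rho z) (rho_linear z).
Lemma rho0 u : rho 0 u = 0.
Proof. by rewrite -qpi0 rho_pi fact0. Qed.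
Lemma rhoN z u : rho (- z) u = - rho z u.
Proof. by elim/quot_ind: z => z; rewrite -qpiN !rho_pi factN. Qed.
Lemma rho_sum (J : Type) (r : seq J) (P : pred J) (E : J -> Rb Q n) u :
  rho (\sum_(j <- r | P j) E j) u = \sum_(j <- r | P j) rho (E j) u.
Proof. by apply: (big_morph (fun z => rho z u)) => [y z|]; rewrite ?rhoD ?rho0. Qed.
Lemma rho_e i u : rho (rb_e Q i) u = vE i u.
Proof. by rewrite rho_pi fact_fe. Qed.
Lemma rho_x l u : (0 < l <= n)%N -> rho (rb_x Q n l) u = uX l u.
Proof. by move=> h; rewrite rho_pi fact_fx. Qed.
Lemma rho_tau l u : (0 < l < n)%N -> rho (rb_tau Q n l) u = uT l u.
Proof. by move=> h; rewrite rho_pi fact_ftau. Qed.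
Lemma rho_om l j a u : (l <= n)%N -> rho (rb_om Q n l j a) u = uO l j a u.
Proof. by move=> h; rewrite rho_pi fact_fom. Qed.

End Representation.

(** * Relations in the algebra *)

Section Relations.
Variables (C : cartanDatum) (k : comPzRingType) (Q : klrScalars C k) (n : nat).

Local Notation A := (Rb Q n).
Local Notation pi := (qpi (Rb_ideal Q n)).
Local Notation e i := (rb_e Q (m:=n) i).
Local Notation x := (rb_x Q n).
Local Notation tau := (rb_tau Q n).
Local Notation om := (rb_om Q n).

Lemma rel_pi y z : rb_rel Q y z -> pi y = pi z.
Proof. by move=> h; apply/qpiP/ideal_gen_in; exists y, z. Qed.

Lemma piX (z : rb_free C k n) d : pi (z ^+ d) = pi z ^+ d.
Proof. by elim: d => // d IH; rewrite !exprS qpiM IH. Qed.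

Lemma e_idem i i' : e i * e i' = if i == i' then e i else 0.
Proof. by rewrite -qpiM (rel_pi (rel_idem Q i i')); case: ifP. Qed.
Lemma e_one : \sum_i e i = 1.
Proof. by rewrite -qpi_sum (rel_pi (rel_one Q n)). Qed.
Lemma x_e l i : x l * e i = e i * x l.
Proof. by rewrite -!qpiM (rel_pi (rel_dot_idem Q l i)). Qed.
Lemma om_e l j a i : om l j a * e i = e i * om l j a.
Proof. by rewrite -!qpiM (rel_pi (rel_float_idem Q l j a i)). Qed.
Lemma tau_e l i : (0 < l < n)%N -> tau l * e i = e (swap l i) * tau l.
Proof. by move=> h; rewrite -!qpiM (rel_pi (rel_cross_idem Q i h)). Qed.
Lemma x_x l l' : x l * x l' = x l' * x l.
Proof. by rewrite -!qpiM (rel_pi (rel_dot_dot Q n l l')). Qed.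
Lemma tau_tau l l' : (l.+1 < l')%N || (l'.+1 < l)%N -> tau l * tau l' = tau l' * tau l.
Proof. by move=> h; rewrite -!qpiM (rel_pi (rel_cross_cross Q n h)). Qed.
Lemma tau_x l l' : l' != l -> l' != l.+1 -> tau l * x l' = x l' * tau l.
Proof. by move=> h h'; rewrite -!qpiM (rel_pi (rel_cross_dot Q n h h')). Qed.
Lemma om_x l j a l' : om l j a * x l' = x l' * om l j a.
Proof. by rewrite -!qpiM (rel_pi (rel_float_dot Q n l j a l')). Qed.
Lemma om_tau l j a l' : l' != l -> om l j a * tau l' = tau l' * om l j a.
Proof. by move=> h; rewrite -!qpiM (rel_pi (rel_float_cross Q n j a h)). Qed.
Lemma tau_sq_eq i l j : colour i l j -> colour i l.+1 j -> tau l * tau l * e i = 0.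
Proof. by move=> h h'; rewrite -expr2 -piX -qpiM (rel_pi (rel_quad_eq Q h h')). Qed.
Lemma x_tau i l j j' : colour i l j -> colour i l.+1 j' ->
  x l * tau l * e i = tau l * x l.+1 * e i
    + if j == j' then ascal (sc_r Q j) * e i else 0.
Proof.
move=> h h'; have := rel_pi (rel_dot_cross_colour Q h h').
by rewrite qpiD !qpiM => ->; case: ifP; rewrite ?qpiM.
Qed.
Lemma tau_xl i l j j' : colour i l j -> colour i l.+1 j' ->
  tau l * x l * e i = x l.+1 * tau l * e i
    + if j == j' then ascal (sc_r Q j) * e i else 0.
Proof.
move=> h h'; have := rel_pi (rel_cross_dot_colour Q h h').
by rewrite qpiD !qpiM => ->; case: ifP; rewrite ?qpiM.
Qed.
Lemma om_om l j a l' j' a' : om l j a * om l' j' a' = - (om l' j' a' * om l j a).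
Proof. by rewrite -!qpiM (rel_pi (rel_float_float Q n l j a l' j' a')) qpiN. Qed.
Lemma om_sq l j a : om l j a * om l j a = 0.
Proof. by rewrite -expr2 -piX (rel_pi (rel_float_sq Q n l j a)). Qed.
Lemma om_left j a : om 0 j a = 0.
Proof. by rewrite /rb_om (rel_pi (rel_float_left Q n j a)). Qed.
Lemma om_same_colour i l j a : colour i l j ->
  om l j a.+1 * e i = om l.-1 j a * e i - om l j a * x l * e i.
Proof. by move=> h; have := rel_pi (rel_float_same Q a h); rewrite qpiD qpiN !qpiM. Qed.

Lemma colour_uniq (i : n.-tuple C) l j j' : colour i l j -> colour i l j' -> j = j'.
Proof.
move=> /existsP[p /andP[/eqP <- /eqP <-]] /existsP[q /andP[/eqP [h] /eqP <-]].
by congr tnth; apply: val_inj.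
Qed.
Lemma colour_ex (i : n.-tuple C) l : (0 < l <= n)%N -> exists j, colour i l j.
Proof.
move=> h; have lt : (l.-1 < n)%N by lia.
by exists (tnth i (Ordinal lt)); apply/existsP; exists (Ordinal lt); rewrite /= prednK ?eqxx //; lia.
Qed.

Definition theta : A := \sum_i \sum_(j | colour i 1 j) om 1 j 0 * e i.

Lemma theta_e i j : colour i 1 j -> theta * e i = om 1 j 0 * e i.
Proof.
move=> h; rewrite /theta mulr_suml (bigD1 i) //= [X in _ + X]big1 ?addr0; last first.
  move=> i' ne; rewrite mulr_suml big1 // => j' _.
  by rewrite -mulrA e_idem (negbTE ne) mulr0.
rewrite mulr_suml (bigD1 j) //= [X in _ + X]big1 ?addr0.
  by rewrite -mulrA e_idem eqxx.
by move=> j' /andP[h' ne]; rewrite (colour_uniq h' h) eqxx in ne.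
Qed.

Lemma by_idem (y z : A) : (forall i, y * e i = z * e i) -> y = z.
Proof. by move=> h; rewrite -[y]mulr1 -[z]mulr1 -e_one !mulr_sumr; apply: eq_bigr. Qed.

Lemma theta_x l : theta * x l = x l * theta.
Proof.
rewrite /theta mulr_suml mulr_sumr; apply: eq_bigr => i _.
rewrite mulr_suml mulr_sumr; apply: eq_bigr => j _.
by rewrite -mulrA -x_e !mulrA om_x.
Qed.
Lemma theta_comm_e i : theta * e i = e i * theta.
Proof.
rewrite /theta mulr_suml mulr_sumr; apply: eq_bigr => i' _.
rewrite mulr_suml mulr_sumr; apply: eq_bigr => j _.
rewrite -mulrA e_idem mulrA -om_e -mulrA e_idem eq_sym.
by case: eqP => [->|_].
Qed.

Lemma theta_tau l : (1 < l)%N -> theta * tau l = tau l * theta.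
Proof.
move=> l1; have [h|h] := boolP (0 < l < n)%N; last first.
  have -> : tau l = 0 by rewrite /rb_tau ftau_out.
  by rewrite mulr0 mul0r.
apply: by_idem => i; have [j hj] : exists j, colour i 1 j by apply: colour_ex; lia.
have hj' : colour (swap l i) 1 j.
  case/existsP: hj => p /andP[/eqP [p0] /eqP <-]; apply/existsP; exists p.
  rewrite p0 eqxx /= tnth_mktuple; apply/eqP; congr tnth.
  have sp : swap_pos l p = p by rewrite /swap_pos !ifF //; apply/eqP; lia.
  by apply: val_inj; rewrite val_insubd sp ltn_ord.
rewrite -mulrA tau_e // mulrA (theta_e hj') -mulrA -tau_e // mulrA om_tau; last lia.
by rewrite -!mulrA (theta_e hj).
Qed.

Lemma theta_sq : theta * theta = 0.
Proof.
apply: by_idem => i; rewrite mul0r.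
case: (posnP n) => [n0|n0].
  rewrite /theta mulr_suml big1 ?mul0r // => i' _; rewrite big1 ?mul0r // => j /colour_range; lia.
have [j hj] : exists j, colour i 1 j by apply: colour_ex; lia.
rewrite -mulrA (theta_e hj) om_e mulrA (theta_e hj) -mulrA -om_e mulrA.
by rewrite om_sq mul0r.
Qed.

Lemma swap_colours (i : n.-tuple C) l j j' : (0 < l < n)%N ->
  colour i l j -> colour i l.+1 j' -> colour (swap l i) l j' /\ colour (swap l i) l.+1 j.
Proof.
move=> h; have sw (p q : 'I_n) : val q = swap_pos l p -> tnth (swap l i) p = tnth i q.
  move=> e; rewrite tnth_mktuple; congr tnth; apply: val_inj.
  by rewrite val_insubd -e ltn_ord.
move=> /existsP[p /andP[/eqP ep /eqP ej]] /existsP[q /andP[/eqP [eq] /eqP ej']].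
split; apply/existsP; [exists p|exists q].
  by rewrite ep eqxx (sw p q) ?ej' ?eqxx // /swap_pos -ep /= eqxx eq -ep.
by rewrite eq eqxx (sw q p) ?ej ?eqxx // /swap_pos eq -ep /= eqn_leq ltnn eqxx.
Qed.

Lemma swap_same (i : n.-tuple C) l j : (0 < l < n)%N ->
  colour i l j -> colour i l.+1 j -> swap l i = i.
Proof.
move=> h /existsP[p /andP[/eqP ep /eqP ej]] /existsP[q /andP[/eqP [eq] /eqP ej']].
apply: eq_from_tnth => r; rewrite tnth_mktuple.
have sw (a b : 'I_n) : val b = swap_pos l a -> insubd a (swap_pos l a) = b.
  by move=> ab; apply: val_inj; rewrite val_insubd -ab ltn_ord.
have [-> | rp] := eqVneq r p.
  by rewrite (sw p q) ?ej //= /swap_pos -ep eqxx eq -ep.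
have [-> | rq] := eqVneq r q.
  by rewrite (sw q p) ?ej' //= /swap_pos eq -ep /= eqn_leq ltnn eqxx.
congr tnth; apply: val_inj; rewrite val_insubd /swap_pos.
have ne1 : (r == l.-1 :> nat) = false by rewrite -ep /=; apply/negbTE.
have ne2 : (r == l :> nat) = false by rewrite -eq; apply/negbTE.
by rewrite ne1 ne2 ltn_ord.
Qed.

Lemma om_bubble i l i' j a : colour i l i' -> colour i l.+1 j -> i' != j ->
  tau l * om l j a * tau l * e i = om l.+1 j a * e i
    + \sum_(t < (dnum i' j).+1) \sum_(v < (dnum j i').+1) ascal (sc_s Q i' j t v) *
        \sum_(u < v) (-1) ^+ u * om l.-1 j (a + u) * x l ^+ t * x l.+1 ^+ (v.-1 - u) * e i.
Proof.
move=> h1 h2 ne; have := rel_pi (rel_float_bubble Q a h1 h2 ne).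
rewrite qpiD !qpiM => ->; congr (_ + _).
rewrite /ssum qpi_sum; apply: eq_bigr => t _; rewrite qpi_sum; apply: eq_bigr => v _.
rewrite qpiM qpi_sum; congr (_ * _); apply: eq_bigr => o _.
by rewrite !qpiM !piX qpiN qpi1.
Qed.

Lemma om_other_colour i l i' j a : colour i l i' -> i' != j ->
  om l j a * e i =
    \sum_(t < (dnum i' j).+1) \sum_(v < (dnum j i').+1) ascal (sc_s Q i' j t v) *
      ((-1) ^+ v * x l ^+ t * om l.-1 j (a + v) * e i).
Proof.
move=> h1 ne; have := rel_pi (rel_float_other Q a h1 ne).
rewrite !qpiM => ->.
rewrite /ssum qpi_sum; apply: eq_bigr => t _; rewrite qpi_sum; apply: eq_bigr => v _.
by rewrite !qpiM !piX qpiN qpi1.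
Qed.

Lemma colour_pair (i : n.-tuple C) l : (0 < l < n)%N ->
  exists j j', colour i l j /\ colour i l.+1 j'.
Proof.
move=> h; have [j hj] : exists j, colour i l j by apply: colour_ex; lia.
have [j' hj'] : exists j', colour i l.+1 j' by apply: colour_ex; lia.
by exists j, j'.
Qed.

(* On two strands of the same colour, Omega_l = Omega_(l+1)^1 + Omega_(l+1)^0 x_(l+1)
   with both summands' floating dots commuting with tau_l. *)
Section SameColour.
Variables (i : n.-tuple C) (l : nat) (j : C).
Hypotheses (h : (0 < l < n)%N) (h1 : colour i l j) (h2 : colour i l.+1 j).
Let a := om l.+1 j 1.
Let b := om l.+1 j 0.
Let r : A := ascal (sc_r Q j).

Lemma same_om : om l j 0 * e i = (a + b * x l.+1) * e i.
Proof. by rewrite mulrDl /a (om_same_colour 0 h2) subrK. Qed.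
Lemma same_tau_e : tau l * e i = e i * tau l.
Proof. by rewrite tau_e // (swap_same h h1 h2). Qed.
Lemma same_a_tau : a * tau l = tau l * a. Proof. by apply: om_tau; rewrite neq_ltn ltnSn. Qed.
Lemma same_b_tau : b * tau l = tau l * b. Proof. by apply: om_tau; rewrite neq_ltn ltnSn. Qed.
(** Substitute a + b x_(l+1) for the floating dot: the term with a dies by tau^2 = 0, and in the
    other one tau x_(l+1) tau = - r tau. *)
Lemma same_tau_om_tau : tau l * om l j 0 * tau l * e i = - (r * (b * tau l * e i)).
Proof.
have te := same_tau_e; have at_ := same_a_tau; have bt := same_b_tau.
have xt := x_tau h1 h2; rewrite eqxx -/r in xt.
have tt : tau l * tau l * e i = 0 by apply: tau_sq_eq h1 h2.
have txt : tau l * x l.+1 * tau l * e i = - (r * (tau l * e i)).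
  rewrite -(mulrA _ (tau l)) te mulrA.
  have -> : tau l * x l.+1 * e i = x l * tau l * e i - r * e i by rewrite xt addrK.
  by rewrite mulrBl -!mulrA -te !mulrA -(mulrA (x l)) -(mulrA (x l)) tt mulr0 sub0r.
rewrite -(mulrA _ (tau l)) te mulrA -(mulrA (tau l)) same_om !mulrA mulrDr mulrDl mulrDl.
have -> : tau l * a * e i * tau l = a * (tau l * tau l * e i) by rewrite -at_ -!mulrA te.
have -> : tau l * (b * x l.+1) * e i * tau l = b * (tau l * x l.+1 * tau l * e i).
  by rewrite mulrA -bt -!mulrA te.
by rewrite tt mulr0 add0r txt mulrN !mulrA ascalC.
Qed.
End SameColour.

(** A signed braid relation of type B. For distinct colours tau_1 Omega_1 tau_1 is a floating dot in
    region 2, because the leftmost region carries no dots, and floating dots anticommute. For equal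
    colours both sides reduce by [same_tau_om_tau] to the same multiple of Omega_2^1 Omega_2^0
    tau_1. *)
Lemma theta_tau1_braid :
  theta * tau 1 * theta * tau 1 = - (tau 1 * theta * tau 1 * theta).
Proof.
apply: by_idem => i; rewrite mulNr; have [h|h] := boolP (0 < 1 < n)%N; last first.
  have -> : tau 1 = 0 by rewrite /rb_tau ftau_out.
  by rewrite !(mulr0, mul0r) oppr0.
have [j [j' [h1 h2]]] := colour_pair i h; have [s1 s2] := swap_colours h h1 h2.
have te : tau 1 * e i = e (swap 1 i) * tau 1 by apply: tau_e.
have te' : tau 1 * e (swap 1 i) = e i * tau 1 by rewrite tau_e // swapK.
pose X j0 := tau 1 * om 1 j0 0 * tau 1.
have cX j0 : X j0 * e i = e i * X j0.
  by rewrite /X -(mulrA _ (tau 1) (e i)) te mulrA -(mulrA (tau 1)) om_e (mulrA (tau 1)) te' !mulrA.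
have tX : tau 1 * theta * tau 1 * e i = X j' * e i.
  transitivity (tau 1 * (theta * e (swap 1 i)) * tau 1); first by rewrite -!mulrA te.
  by rewrite (theta_e s1) /X -!mulrA te.
have L : theta * tau 1 * theta * tau 1 * e i = om 1 j 0 * X j' * e i.
  transitivity (theta * (tau 1 * theta * tau 1 * e i)); first by rewrite !mulrA.
  by rewrite tX cX mulrA (theta_e h1) -mulrA -cX mulrA.
have R : tau 1 * theta * tau 1 * theta * e i = X j' * om 1 j 0 * e i.
  transitivity (tau 1 * theta * tau 1 * e i * om 1 j 0).
    by rewrite -mulrA (theta_e h1) om_e mulrA.
  by rewrite tX -mulrA -om_e mulrA.
rewrite L R; case: (eqVneq j j') => [ej|ne]; last first.
  have Xe : X j' * e i = om 2 j' 0 * e i.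
    rewrite /X (om_bubble 0 h1 h2 ne) big1 ?addr0 // => t _; rewrite big1 // => v _.
    by rewrite big1 ?mulr0 // => o _; rewrite om_left mulr0 !mul0r.
  have r : X j' * om 1 j 0 * e i = om 2 j' 0 * om 1 j 0 * e i.
    by rewrite -mulrA om_e mulrA Xe -mulrA -om_e mulrA.
  by rewrite r -mulrA Xe mulrA om_om mulNr.
rewrite -{j'}ej in h2 s1 s2 tX L R *.
have si : swap 1 i = i by apply: swap_same h1 h2.
rewrite si in te.
pose a := om 2 j 1; pose b := om 2 j 0.
have oE := same_om h2; rewrite -/a -/b in oE.
have bb : b * b = 0 by apply: om_sq.
have ba : b * a = - (a * b) by apply: om_om.
have at_ : a * tau 1 = tau 1 * a by apply: om_tau.
have bt : b * tau 1 = tau 1 * b by apply: om_tau.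
have bx : b * x 2 = x 2 * b by apply: om_x.
have Xe := same_tau_om_tau h h1 h2; rewrite -/(X j) -/b in Xe.
have ae : a * e i = e i * a by apply: om_e.
have be : b * e i = e i * b by apply: om_e.
have xe : x 2 * e i = e i * x 2 by apply: x_e.
set r := ascal _ in Xe.
have rC y : r * y = y * r by apply: ascalC.
transitivity (- (r * (a * b * tau 1 * e i))).
  rewrite -mulrA cX mulrA oE -mulrA -cX Xe mulrN; congr (- _).
  rewrite [LHS]mulrA -rC -[LHS]mulrA; congr (_ * _).
  by rewrite mulrDl !mulrA -(mulrA b (x 2)) -bx !mulrA bb !mul0r addr0.
congr (- _).
have -> : X j * om 1 j 0 * e i = X j * e i * (a + b * x 2).
  rewrite -mulrA oE -mulrA; congr (_ * _).
  by rewrite mulrDl mulrDr ae -mulrA xe mulrA be mulrA.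
suff H : b * tau 1 * e i * (a + b * x 2) = - (a * b * tau 1 * e i).
  by rewrite Xe mulNr -(mulrA r) H mulrN opprK.
have -> : b * tau 1 * e i * (a + b * x 2) = b * tau 1 * ((a + b * x 2) * e i).
  rewrite -mulrA; congr (_ * _).
  by rewrite mulrDl mulrDr ae; congr (_ + _); rewrite -(mulrA b) xe !mulrA be.
rewrite mulrDl mulrDr !mulrA -(mulrA b (tau 1) b) -bt !mulrA bb !mul0r addr0.
by rewrite -(mulrA b (tau 1)) -at_ mulrA ba !mulNr.
Qed.

Inductive generated : A -> Prop :=
| gen_ascal a : generated (ascal a)
| gen_e i : generated (e i)
| gen_x l : generated (x l)
| gen_tau l : generated (tau l)
| gen_theta : generated theta
| gen_D y z : generated y -> generated z -> generated (y + z)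
| gen_M y z : generated y -> generated z -> generated (y * z).

Lemma gen_0 : generated 0.
Proof. by rewrite -(ascal0 A); apply: gen_ascal. Qed.
Lemma gen_N y : generated y -> generated (- y).
Proof.
by move=> h; rewrite -mulN1r -(ascal1 (s := A)) -ascalN; apply: gen_M => //; apply: gen_ascal.
Qed.
Lemma gen_sum (J : Type) (r : seq J) (P : pred J) (E : J -> A) :
  (forall j, P j -> generated (E j)) -> generated (\sum_(j <- r | P j) E j).
Proof. by move=> h; apply: big_ind => //; [exact: gen_0|exact: gen_D]. Qed.
Lemma gen_X y d : generated y -> generated (y ^+ d).
Proof.
move=> h; elim: d => [|d IH]; last by rewrite exprS; apply: gen_M.
by rewrite expr0 -(ascal1 (s := A)); apply: gen_ascal.
Qed.
Lemma gen_sign d : generated ((-1) ^+ d).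
Proof. by apply/gen_X/gen_N; rewrite -(ascal1 (s := A)); apply: gen_ascal. Qed.

Lemma gen_idem y : (forall i, generated (y * e i)) -> generated y.
Proof. by move=> h; rewrite -[y]mulr1 -e_one mulr_sumr; apply: gen_sum. Qed.

(** The relations across strand l lower the region or the exponent until strand l has colour j and
    the exponent is 0; for l = 1 this is theta. If strand l-1 has another colour, the bubble
    relation can be solved for the dot. If it has colour j as well, writing Omega_(l-1) = a + b x_l
    yields b tau, then a tau, and finally b itself, after division by the unit r_j. *)
Lemma gen_om l j a : (l <= n)%N -> generated (om l j a).
Proof.
elim: l {-2}l (leqnn l) j a => [|L IHL] l lL j a ln.
  move: lL; rewrite leqn0 => /eqP ->; rewrite om_left; exact: gen_0.
move: lL; rewrite leq_eqVlt => /orP[/eqP el|lL]; last exact: IHL.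
subst l; apply: gen_idem => i.
have [i' hi'] : exists i', colour i L.+1 i' by apply: colour_ex; lia.
have [ei|ne] := eqVneq i' j; last first.
  rewrite (om_other_colour a hi' ne); apply: gen_sum => t _; apply: gen_sum => v _.
  apply: gen_M; first exact: gen_ascal.
  apply: gen_M; last exact: gen_e.
  apply: gen_M; last by apply: IHL => //=; lia.
  by apply: gen_M; [exact: gen_sign|apply/gen_X/gen_x].
subst i'; elim: a => [|a IHa]; last first.
  rewrite (om_same_colour a hi') /=; apply: gen_D.
    by apply: gen_M; [apply: IHL => //; lia|exact: gen_e].
  apply: gen_N; rewrite -mulrA x_e mulrA; apply: gen_M; [exact: IHa|exact: gen_x].
have [L0|L0] := posnP L.
  by subst L; rewrite -(theta_e hi'); apply: gen_M; [exact: gen_theta|exact: gen_e].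
have hL : (0 < L < n)%N by lia.
have [i' hi] : exists i', colour i L i' by apply: colour_ex; lia.
have gL a : generated (om L j a) by apply: IHL => //; lia.
have gt : generated (tau L) by apply: gen_tau.
have ge := gen_e i.
have [ei|ne] := eqVneq i' j; last first.
  rewrite -[X in generated X](addrK (\sum_(t < (dnum i' j).+1) \sum_(v < (dnum j i').+1)
    ascal (sc_s Q i' j t v) * \sum_(u < v) (-1) ^+ u * om L.-1 j (0 + u) * x L ^+ t
      * x L.+1 ^+ (v.-1 - u) * e i)).
  rewrite -(om_bubble 0 hi hi' ne); apply: gen_D.
    by repeat apply: gen_M.
  apply/gen_N/gen_sum => t _; apply: gen_sum => v _; apply: gen_M; first exact: gen_ascal.
  apply: gen_sum => u _; apply: gen_M => //.
  apply: gen_M; last exact/gen_X/gen_x.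
  apply: gen_M; last exact/gen_X/gen_x.
  apply: gen_M; first exact: gen_sign.
  by apply: IHL => //; lia.
subst i'.
have si : swap L i = i by apply: swap_same hi hi'.
have te := same_tau_e hL hi hi'; have oE := same_om hi'.
have at_ := same_a_tau L j; have bt := same_b_tau L j.
have Xe := same_tau_om_tau hL hi hi'.
set a := om L.+1 j 1 in oE at_; set b := om L.+1 j 0 in oE bt Xe *.
have be : b * e i = e i * b by apply: om_e.
have bx : b * x L.+1 = x L.+1 * b by apply: om_x.
have [r' rr'] := sc_r_inv Q j; set r := sc_r Q j in rr' Xe.
have gs y : generated (ascal r * y) -> generated y.
  move=> h; rewrite -[y]mul1r -(ascal1 (s := A)) -rr' mulrC ascalM -mulrA.
  by apply: gen_M => //; apply: gen_ascal.
have gbt : generated (b * tau L * e i).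
  by apply: gs; rewrite -[X in generated X]opprK -Xe; apply: gen_N; repeat apply: gen_M.
have gat : generated (a * tau L * e i).
  have -> : a * tau L * e i = om L j 0 * e i * tau L - x L.+1 * (b * tau L * e i).
    by rewrite oE -(mulrA _ (e i)) -te mulrDl !mulrA -bx addrK.
  apply: gen_D; first by repeat apply: gen_M.
  by apply/gen_N/gen_M; [exact: gen_x|].
apply: gs.
have -> : ascal r * (b * e i) = x L * (b * tau L * e i) + a * tau L * e i - tau L * om L j 0 * e i.
  have xt := x_tau hi hi'; rewrite eqxx -/r in xt.
  have bxL : b * x L = x L * b by apply: om_x.
  have -> : tau L * om L j 0 * e i = a * tau L * e i + b * (tau L * x L.+1 * e i).
    by rewrite -(mulrA (tau L)) oE mulrA mulrDr mulrDl !mulrA -at_ -bt.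
  have -> : x L * (b * tau L * e i) = b * (x L * tau L * e i) by rewrite !mulrA bxL.
  by rewrite opprD addrA addrK xt mulrDr addrC addKr !mulrA ascalC.
apply: gen_D; last by apply: gen_N; repeat apply: gen_M.
by apply: gen_D => //; apply: gen_M => //; apply: gen_x.
Qed.
End Relations.

(** * Normal forms *)

Section Spanning.
Variables (C : cartanDatum) (k : comPzRingType) (Q : klrScalars C k) (n : nat).

Local Notation A := (Rb Q n).
Local Notation pi := (qpi (Rb_ideal Q n)).
Local Notation e i := (rb_e Q (m:=n) i).
Local Notation x := (rb_x Q n).
Local Notation tau := (rb_tau Q n).
Local Notation om := (rb_om Q n).
Local Notation th := (theta Q n).

Lemma x_out l : ~~ (0 < l <= n)%N -> x l = 0.
Proof. by move=> h; rewrite /rb_x fx_out. Qed.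
Lemma tau_out l : ~~ (0 < l < n)%N -> tau l = 0.
Proof. by move=> h; rewrite /rb_tau ftau_out. Qed.

Lemma Rb_generated (z : A) : generated z.
Proof.
elim/quot_ind: z => z; elim/free_ind: z => t.
elim: t => [g|a|s IHs t IHt|s IHs t IHt].
- have -> : pi (fpi (rb_deg (m:=n)) (FGen g)) = match g with
    | GIdem i => e i
    | GDot p => x (val p)
    | GCross p => tau (val p)
    | GFloat p j a => om (val p) j a end.
    case: g => [i|p|p|p j a]; rewrite ?/rb_e ?/rb_x ?/rb_tau ?/rb_om //.
    + by rewrite /fx valK.
    + by rewrite /ftau valK.
    + by rewrite /fom valK.
  case: g => [i|p|p|p j a].
  + exact: gen_e.
  + exact: gen_x.
  + exact: gen_tau.
  + by apply: gen_om; apply: (valP p).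
- exact: (gen_ascal Q n a).
- by rewrite fpiD qpiD; apply: gen_D.
- by rewrite fpiM qpiM; apply: gen_M.
Qed.

Lemma Rb_left_ind (P : A -> Prop) :
    (forall y z, P y -> P z -> P (y + z)) -> (forall a y, P y -> P (ascal a * y)) ->
    (forall i y, P y -> P (e i * y)) -> (forall l y, P y -> P (x l * y)) ->
    (forall l y, P y -> P (tau l * y)) -> (forall y, P y -> P (th * y)) ->
  forall z y, P y -> P (z * y).
Proof.
move=> PD Pa Pe Px Pt Pth z; elim: (Rb_generated z) => {z} //.
- by move=> z z' _ IH _ IH' y Py; rewrite mulrDl; apply: PD; [apply: IH|apply: IH'].
- by move=> z z' _ IH _ IH' y Py; rewrite -mulrA; apply/IH/IH'.
Qed.

Inductive pol (L : nat) : A -> Prop :=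
| pol_ascal a : pol L (ascal a)
| pol_e i : pol L (e i)
| pol_x l : (l <= L)%N -> pol L (x l)
| pol_D y z : pol L y -> pol L z -> pol L (y + z)
| pol_M y z : pol L y -> pol L z -> pol L (y * z).

Lemma pol_0 L : pol L 0. Proof. by rewrite -(ascal0 A); apply: pol_ascal. Qed.
Lemma pol_1 L : pol L 1. Proof. by rewrite -(ascal1 (s := A)); apply: pol_ascal. Qed.
Lemma pol_N L y : pol L y -> pol L (- y).
Proof.
by move=> h; rewrite -mulN1r -(ascal1 (s := A)) -ascalN; apply: pol_M => //; apply: pol_ascal.
Qed.
Lemma pol_sum L (J : Type) (r : seq J) (P : pred J) (E : J -> A) :
  (forall j, P j -> pol L (E j)) -> pol L (\sum_(j <- r | P j) E j).
Proof. by move=> h; apply: big_ind => //; [exact: pol_0|exact: pol_D]. Qed.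
Lemma pol_X L y d : pol L y -> pol L (y ^+ d).
Proof.
by move=> h; elim: d => [|d IH]; [exact: pol_1|rewrite exprS; apply: pol_M].
Qed.
Lemma pol_idem L y : (forall i, pol L (y * e i)) -> pol L y.
Proof. by move=> h; rewrite -[y]mulr1 -e_one mulr_sumr; apply: pol_sum. Qed.
Lemma pol_leq L L' y : (L <= L')%N -> pol L y -> pol L' y.
Proof.
move=> h; elim=> {y} [a|i|l hl|y z _ IH _ IH'|y z _ IH _ IH'].
- exact: pol_ascal.
- exact: pol_e.
- by apply: pol_x; apply: leq_trans h.
- exact: pol_D.
- exact: pol_M.
Qed.

Definition s (l : nat) : A := if l is 0 then th else tau l.

Lemma pol_x_tau l L : pol L (x l * tau l - tau l * x l.+1).
Proof.
have [h|h] := boolP (0 < l < n)%N; last first.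
  by rewrite tau_out // mulr0 mul0r subr0; apply: pol_0.
apply: pol_idem => i; have [j [j' [h1 h2]]] := colour_pair i h.
rewrite mulrBl (x_tau Q h1 h2) addrC addKr.
by case: ifP => _; [apply: pol_M; [apply: pol_ascal|apply: pol_e]|apply: pol_0].
Qed.
Lemma pol_tau_x l L : pol L (tau l * x l - x l.+1 * tau l).
Proof.
have [h|h] := boolP (0 < l < n)%N; last first.
  by rewrite tau_out // mulr0 mul0r subr0; apply: pol_0.
apply: pol_idem => i; have [j [j' [h1 h2]]] := colour_pair i h.
rewrite mulrBl (tau_xl Q h1 h2) addrC addKr.
by case: ifP => _; [apply: pol_M; [apply: pol_ascal|apply: pol_e]|apply: pol_0].
Qed.

(** A twisted Leibniz rule: on the generators of [pol L] the error is a scalar multiple of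
    idempotents or 0, and the form of the equation is inherited by sums and products. *)
Lemma pol_s l L y : (l < L)%N -> pol L y ->
  exists y' y'', [/\ pol L y', pol L y'' & y * s l = s l * y' + y''].
Proof.
move=> lL; elim=> {y} [a|i|l' hl|y z _ [y1 [y2 [h1 h2 ey]]] _ [z1 [z2 [h3 h4 ez]]]
  |y z hy [y1 [y2 [h1 h2 ey]]] _ [z1 [z2 [h3 h4 ez]]]].
- exists (ascal a), 0; rewrite addr0 ascalC.
  by split=> //; [apply: pol_ascal|apply: pol_0].
- case: l lL => [|l] lL /=.
    by exists (e i), 0; rewrite addr0 theta_comm_e; split; [exact: pol_e|exact: pol_0|].
  exists (e (swap l.+1 i)), 0; rewrite addr0; split; [exact: pol_e|exact: pol_0|].
  have [h|h] := boolP (0 < l.+1 < n)%N; last by rewrite tau_out // mulr0 mul0r.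
  by rewrite tau_e // swapK.
- case: l lL => [|l] lL /=.
    by exists (x l'), 0; rewrite addr0 theta_x; split; [exact: pol_x|exact: pol_0|].
  have [->|ne] := eqVneq l' l.+1.
    exists (x l.+2), (x l.+1 * tau l.+1 - tau l.+1 * x l.+2).
    by split; [apply: pol_x|apply: pol_x_tau|rewrite addrC subrK].
  have [->|ne'] := eqVneq l' l.+2.
    exists (x l.+1), (- (tau l.+1 * x l.+1 - x l.+2 * tau l.+1)).
    split; [by apply: pol_x; lia|apply: pol_N; apply: pol_tau_x|].
    by rewrite opprB addrC subrK.
  by exists (x l'), 0; rewrite addr0 tau_x //; split; [exact: pol_x|exact: pol_0|].
- exists (y1 + z1), (y2 + z2); split; [exact: pol_D|exact: pol_D|].
  by rewrite mulrDl ey ez mulrDr addrACA.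
- exists (y1 * z1), (y2 * z1 + y * z2); split.
  + exact: pol_M.
  + by apply: pol_D; apply: pol_M.
  + by rewrite -mulrA ez mulrDr (mulrA y) ey mulrDl -addrA -(mulrA (s l)).
Qed.

Lemma pol_s_sq l : pol l.+1 (s l * s l).
Proof.
case: l => [|l] /=; first by rewrite theta_sq; apply: pol_0.
have [h|h] := boolP (0 < l.+1 < n)%N; last by rewrite tau_out // mulr0; apply: pol_0.
apply: pol_idem => i; have [j [j' [h1 h2]]] := colour_pair i h.
have [ej|ne] := eqVneq j j'.
  by rewrite -ej in h2; rewrite (tau_sq_eq Q h1 h2); apply: pol_0.
rewrite -expr2 -piX -qpiM (rel_pi (rel_quad_neq Q h1 h2 ne)) /ssum qpi_sum.
apply: pol_sum => t _; rewrite qpi_sum; apply: pol_sum => v _; rewrite !qpiM !piX.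
apply: pol_M; first exact: pol_ascal.
by repeat apply: pol_M; try exact: pol_e; apply/pol_X/pol_x.
Qed.

Lemma pol_braid l : (0 < l)%N ->
  pol l.+2 (s l * s l.+1 * s l - s l.+1 * s l * s l.+1).
Proof.
case: l => // l _ /=.
have [h|h] := boolP (l.+2 < n)%N; last first.
  by rewrite (@tau_out l.+2) ?mulr0 ?mul0r ?subr0 //; apply: pol_0.
apply: pol_idem => i; have [|j [j' [h1 h2]]] := @colour_pair C n i l.+1; first by lia.
have [j'' h3] : exists j'', colour i l.+3 j'' by apply: colour_ex; lia.
have := rel_pi (rel_braid Q h1 h2 h3); rewrite !(qpiM, qpiD, qpiN) => ->.
case: ifP => _; last by apply: pol_0.
rewrite qpiM; apply: pol_M; first exact: pol_ascal.
rewrite /ssum qpi_sum; apply: pol_sum => t _; rewrite qpi_sum; apply: pol_sum => v _.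
rewrite qpiM qpi_sum; apply: pol_M; first exact: pol_ascal.
apply: pol_sum => u _; rewrite !qpiM !piX.
by repeat apply: pol_M; try exact: pol_e; apply/pol_X/pol_x => //; lia.
Qed.

Lemma s_comm l l' : (l.+1 < l')%N || (l'.+1 < l)%N -> s l * s l' = s l' * s l.
Proof.
case: l => [|l]; case: l' => [|l'] //= h; last exact: tau_tau.
  by rewrite theta_tau //; lia.
by rewrite theta_tau //; lia.
Qed.

Lemma s_braid0 : s 0 * s 1 * s 0 * s 1 = - (s 1 * s 0 * s 1 * s 0).
Proof. exact: theta_tau1_braid. Qed.

Inductive span (G : A -> Prop) : A -> Prop :=
| span_in y : G y -> span G y
| span_0 : span G 0
| span_D y z : span G y -> span G z -> span G (y + z).

Lemma span_map (G H : A -> Prop) f : {morph f : y z / y + z} -> f 0 = 0 ->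
  (forall y, G y -> span H (f y)) -> forall y, span G y -> span H (f y).
Proof.
move=> fD f0 h y; elim=> {y} [y Gy||y z _ IH _ IH']; first exact: h.
  by rewrite f0; apply: span_0.
by rewrite fD; apply: span_D.
Qed.
Lemma span_mul (G H : A -> Prop) a :
  (forall y, G y -> span H (a * y)) -> forall y, span G y -> span H (a * y).
Proof. by apply: span_map; [exact: mulrDr|exact: mulr0]. Qed.
Lemma span_sub (G H : A -> Prop) : (forall y, G y -> span H y) ->
  forall y, span G y -> span H y.
Proof. exact: (@span_map G H id). Qed.

(* The chain s_m, s_(m-1) s_m, ..., s_0 s_1 ... s_m, s_1 s_0 ... s_m, ..., s_m ... s_0 ... s_m
   of minimal coset representatives of W(B_m) in W(B_(m+1)). *)
Definition kap (m b : nat) : nat := if (b <= m)%N then (m - b)%N else (b - m)%N.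

Fixpoint chain (m b : nat) : A :=
  if b is b'.+1 then s (kap m b') * chain m b' else 1.

(** * Adding one strand to a spanning set *)

Section Step.
Variables (m : nat) (S : A -> Prop).
Hypothesis SP : forall y z, pol m y -> S z -> span S (y * z).
Hypothesis Ss : forall l z, (l < m)%N -> S z -> span S (s l * z).

Definition shifted (y : A) := exists p z, S z /\ y = x m.+1 ^+ p * z.
Definition step_upto (B : nat) (y : A) :=
  exists b z, [/\ (b < B)%N, shifted z & y = chain m b * z].
Local Notation U B := (span (step_upto B)).

Lemma U_leq B B' y : (B <= B')%N -> U B y -> U B' y.
Proof.
move=> h; apply: span_sub => {}y [b [z [lt hz ->]]].
by apply: span_in; exists b, z; split=> //; apply: leq_trans h.
Qed.

Lemma shifted_span p z : span S z -> span shifted (x m.+1 ^+ p * z).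
Proof. by apply: span_mul => {}z hz; apply: span_in; exists p, z. Qed.

Lemma shifted_pol y z : pol m.+1 y -> shifted z -> span shifted (y * z).
Proof.
move=> hy; elim: hy z => {y} [a|i|l hl|y y' _ IH _ IH'|y y' _ IH _ IH'] z hz.
- case: hz => p [z' [hz ->]]; rewrite mulrA ascalC -mulrA.
  by apply: shifted_span; apply: SP => //; apply: pol_ascal.
- case: hz => p [z' [hz ->]].
  have -> : e i * (x m.+1 ^+ p * z') = x m.+1 ^+ p * (e i * z').
    rewrite !mulrA; congr (_ * _); elim: p => [|p IH]; first by rewrite expr0 mulr1 mul1r.
    by rewrite exprS mulrA -x_e -!mulrA IH.
  by apply: shifted_span; apply: SP => //; apply: pol_e.
- case: hz => p [z' [hz ->]]; move: hl; rewrite leq_eqVlt => /orP[/eqP ->|hl].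
    by apply: span_in; exists p.+1, z'; rewrite exprS mulrA.
  have -> : x l * (x m.+1 ^+ p * z') = x m.+1 ^+ p * (x l * z').
    rewrite !mulrA; congr (_ * _); elim: p => [|p IH]; first by rewrite expr0 mulr1 mul1r.
    by rewrite exprS mulrA x_x -!mulrA IH.
  by apply: shifted_span; apply: SP => //; apply: pol_x.
- by rewrite mulrDl; apply: span_D; [apply: IH|apply: IH'].
- by rewrite -mulrA; apply: (span_mul IH); apply: IH'.
Qed.

Lemma shifted_s l z : (l < m)%N -> shifted z -> span shifted (s l * z).
Proof.
move=> hl [p [z' [hz ->]]].
have -> : s l * (x m.+1 ^+ p * z') = x m.+1 ^+ p * (s l * z').
  have c : s l * x m.+1 = x m.+1 * s l.
    case: l hl => [|l] hl /=; first exact: theta_x.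
    by rewrite tau_x //; lia.
  rewrite !mulrA; congr (_ * _); elim: p => [|p IH]; first by rewrite expr0 mulr1 mul1r.
  by rewrite exprS mulrA c -!mulrA IH.
by apply: shifted_span; apply: Ss.
Qed.

Definition chain_good b := 
  (forall y z, pol m.+1 y -> shifted z -> U b.+1 (y * (chain m b * z))) /\
  (forall l z, (l <= m)%N -> l != kap m b -> shifted z -> U b.+1 (s l * (chain m b * z))).

Lemma s_U B l y : (l <= m)%N -> (forall b, (b < B)%N -> chain_good b) -> U B y -> U B.+1 (s l * y).
Proof.
move=> hl hg; apply: span_mul => {}y [b [z [lt hz ->]]].
have [el|ne] := eqVneq l (kap m b).
  by apply: span_in; exists b.+1, z; split; rewrite ?el //= mulrA.
by apply: (@U_leq b.+1); [lia|apply: (hg b lt).2].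
Qed.
Lemma pol_U B y z : pol m.+1 y -> (forall b, (b < B)%N -> chain_good b) -> U B z -> U B (y * z).
Proof.
move=> hy hg; apply: span_mul => {}z [b [z' [lt hz ->]]].
by apply: (@U_leq b.+1); [lia|apply: (hg b lt).1].
Qed.

Lemma in_U b z : shifted z -> U b.+1 (chain m b * z).
Proof. by move=> hz; apply: span_in; exists b, z. Qed.

(** Only the next letter may lengthen a chain. Let K be the letter added last. If l = K, the square
    s_K^2 is a polynomial; if l is far from K, it commutes past s_K. Otherwise l is a neighbour of K
    that is not the next letter, hence the letter before K, and a braid relation moves the product
    to shorter chains up to a polynomial error. *)
Lemma good_all b : (b <= (m.*2).+1)%N -> chain_good b.
Proof.
elim/ltn_ind: b => -[|b] IH hb.
  split=> [y z hy hz|l z hl ne hz]; rewrite mul1r.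
    apply: span_sub (shifted_pol hy hz) => w hw.
    by rewrite -[w]mul1r; apply: (@in_U 0).
  apply: span_sub (shifted_s _ hz) => [w hw|]; first by rewrite -[w]mul1r; apply: (@in_U 0).
  by move: ne; rewrite /kap /= subn0; lia.
have hg b' : (b' <= b)%N -> chain_good b' by move=> h; apply: IH; lia.
have kb : (kap m b <= m)%N by rewrite /kap; case: ifP; lia.
have sU l y B : (l <= m)%N -> (B <= b.+1)%N -> U B y -> U B.+1 (s l * y).
  by move=> hl hB; apply: s_U => // b' h; apply: hg; lia.
have pU l y B : pol m.+1 l -> (B <= b.+1)%N -> U B y -> U B (l * y).
  by move=> hl hB; apply: pol_U => // b' h; apply: hg; lia.
split=> [y z hy hz|l z hl ne hz] /=.
  have [|y' [y'' [h' h'' ey]]] := @pol_s (kap m b) m.+1 y _ hy; first by rewrite ltnS.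
  rewrite -mulrA mulrA ey mulrDl -mulrA; apply: span_D.
    by apply: (sU) => //; apply: (pU) => //; apply: in_U.
  by apply: (@U_leq b.+1) => //; apply: (pU) => //; apply: in_U.
have [el|ne'] := eqVneq l (kap m b).
  rewrite el mulrA mulrA -mulrA; apply: (@U_leq b.+1) => //; apply: (pU) => //; last exact: in_U.
  by apply: pol_leq (pol_s_sq _); rewrite ltnS.
have [far|near] := boolP ((l.+1 < kap m b)%N || ((kap m b).+1 < l)%N).
  rewrite -mulrA mulrA s_comm // -mulrA; apply: (sU) => //.
  by apply: (hg b (leqnn b)).2.
(* K > 0 because the neighbour 1 of the letter 0 is always the next letter; l = 0 occurs only when
   the chain begins with s_1 s_0 s_1, where the relation of length four applies. *)
have [b0 [eb el Kl K0]] : exists b0, [/\ b = b0.+1, l = kap m b0, (0 < kap m b)%N &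
    l = 0%N -> exists b1, [/\ b0 = b1.+1, kap m b = 1%N & kap m b1 = 1%N]].
  move: ne ne' near; rewrite /kap; case: b {IH hg sU pU} hb kb => [|b0] hb kb.
    by rewrite /= !subn0; case: ifP; lia.
  move=> ne ne' near; exists b0; split=> //.
  - by move: ne ne' near; repeat case: ifP; lia.
  - by move: ne ne' near; repeat case: ifP; lia.
  move=> l0; case: b0 hb kb ne ne' near => [|b1] hb kb ne ne' near.
    by move: ne ne' near; repeat case: ifP; lia.
  by exists b1; split=> //; move: ne ne' near; repeat case: ifP; lia.
subst b; rewrite /= -el; set K := kap m b0.+1 in kb ne' near Kl K0 *.
have base i : (i <= m)%N -> i != l -> U b0.+1 (s i * (chain m b0 * z)).
  by move=> hi ni; apply: (hg b0 (leqnSn b0)).2 => //; rewrite -el.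
have [l0|l0] := posnP l.
  have [b1 [eb1 K1 kb1]] := K0 l0.
  have -> : s l * (s K * (s l * chain m b0) * z)
      = s 1 * (s 0 * (s 1 * (- 1 * (s 0 * (chain m b1 * z))))).
    by rewrite l0 K1 eb1 /= kb1 mulN1r !mulrN !mulrA s_braid0 !mulNr.
  have m1 : (1 <= m)%N by rewrite -K1.
  apply: (sU) => //; apply: (sU) => //.
  rewrite eb1; apply: (sU) => //; first by rewrite eb1; lia.
  apply: (pU); [by apply: pol_N; apply: pol_1|by rewrite eb1; lia|].
  by apply: (hg b1 _).2 => //; rewrite ?eb1 ?kb1 //; lia.
have lK : l = K.+1 \/ K = l.+1 by move: near ne'; lia.
have [p hp ep] : exists2 p, pol m.+1 p & s l * s K * s l = s K * s l * s K + p.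
  case: lK => [eK|eK].
    exists (- (s K * s l * s K - s l * s K * s l)); last by rewrite opprB addrC subrK.
    by apply: pol_N; apply: pol_leq (_ : pol K.+2 _); [lia|rewrite eK; apply: pol_braid].
  exists (s l * s K * s l - s K * s l * s K); last by rewrite addrC subrK.
  by apply: pol_leq (_ : pol l.+2 _); [lia|rewrite eK; apply: pol_braid].
have -> : s l * (s K * (s l * chain m b0) * z) = s l * s K * s l * (chain m b0 * z).
  by rewrite !mulrA.
rewrite ep mulrDl -!mulrA; apply: span_D.
  by apply: (sU) => //; apply: (sU) => //; apply: base => //; rewrite eq_sym.
by apply: (@U_leq b0.+1); [lia|apply: (pU) => //; apply: in_U].
Qed.

Definition step := span (step_upto (m.*2).+2).

Lemma step_pol y z : pol m.+1 y -> step z -> step (y * z).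
Proof. by move=> hy; apply: pol_U => // b hb; apply: good_all; lia. Qed.

Lemma step_s l z : (l <= m)%N -> step z -> step (s l * z).
Proof.
move=> hl; apply: span_mul => {}z [b [z' [lt hz ->]]].
have [el|ne] := eqVneq l (kap m b).
  have hb : (b < (m.*2).+1)%N by move: hl; rewrite el /kap; case: ifP; lia.
  by apply: span_in; exists b.+1, z'; split; rewrite ?el ?mulrA //=.
by apply: (@U_leq b.+1); [lia|apply: (good_all _).2 => //; lia].
Qed.
End Step.

(* The first m strands span R(m) e(i) with normal form C_(m-1) x_m^(p_(m-1)) ... C_0 x_1^(p_0) e(i). *)
Fixpoint normal (i : n.-tuple C) (m : nat) : A -> Prop :=
  if m is m'.+1 then step m' (normal i m') else fun z => exists a, z = ascal a * e i.

Lemma normal_D i m y z : normal i m y -> normal i m z -> normal i m (y + z).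
Proof.
case: m => [|m]; last exact: span_D.
by move=> [a ->] [b ->]; exists (a + b); rewrite ascalD mulrDl.
Qed.
Lemma normal_0 i m : normal i m 0.
Proof. by case: m => [|m]; [exists 0; rewrite ascal0 mul0r|apply: span_0]. Qed.

Lemma normal_closed i m :
  (forall y z, pol m y -> normal i m z -> normal i m (y * z)) /\
  (forall l z, (l < m)%N -> normal i m z -> normal i m (s l * z)).
Proof.
elim: m => [|m [IHp IHs]].
  split=> // y z hy; elim: hy z => {y} [a|i'|l hl|y y' _ IH _ IH'|y y' _ IH _ IH'] z hz.
  - by case: hz => b ->; exists (a * b); rewrite ascalM mulrA.
  - case: hz => b ->; rewrite mulrA -ascalC -mulrA e_idem.
    by case: eqP => [->|_]; [exists b|rewrite mulr0; apply: normal_0].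
  - by rewrite x_out ?mul0r //; [exact: (normal_0 i 0)|lia].
  - by rewrite mulrDl; apply: (@normal_D i 0); [apply: IH|apply: IH'].
  - by rewrite -mulrA; apply/IH/IH'.
have SP y z : pol m y -> normal i m z -> span (normal i m) (y * z).
  by move=> hy hz; apply/span_in/IHp.
have Ss l z : (l < m)%N -> normal i m z -> span (normal i m) (s l * z).
  by move=> hl hz; apply/span_in/IHs.
split=> [y z hy hz|l z hl hz]; first exact: step_pol hz.
exact: step_s hz.
Qed.

Lemma normal_e i m : normal i m (e i).
Proof.
elim: m => [|m IH]; first by exists 1; rewrite ascal1 mul1r.
apply: span_in; exists 0%N, (e i); split=> //; last by rewrite mul1r.
by exists 0%N, (e i); rewrite mul1r.
Qed.

Lemma normal_all i z : normal i n (z * e i).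
Proof.
have [hp hs] := normal_closed i n.
apply: (Rb_left_ind (P := normal i n)); last exact: normal_e.
- exact: normal_D.
- by move=> a y h; apply: hp => //; apply: pol_ascal.
- by move=> i' y h; apply: hp => //; apply: pol_e.
- move=> l y h; have [hl|hl] := boolP (0 < l <= n)%N; last by rewrite x_out // mul0r; apply: normal_0.
  by apply: hp => //; apply: pol_x; lia.
- move=> l y h; have [hl|hl] := boolP (0 < l < n)%N; last by rewrite tau_out // mul0r; apply: normal_0.
  by case: l hl => // l hl; apply: (hs l.+1) => //; lia.
- move=> y h; have [n0|n0] := posnP n; last exact: (hs 0%N).
  have -> : th = 0.
    by rewrite /theta big1 // => i' _; rewrite big1 // => j /colour_range; lia.
  by rewrite mul0r; apply: normal_0.
Qed.
End Spanning.

(** * Triangular decomposition *)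

Lemma seq_max_bound (T : eqType) (r : seq T) (f : T -> int) :
  exists M, forall y, y \in r -> f y <= M.
Proof.
elim: r => [|y r [M hM]]; first by exists 0.
exists (Num.max (f y) M) => z; rewrite inE le_max => /orP[/eqP->|/hM ->].
  by rewrite lexx.
by rewrite orbT.
Qed.

Section Family.
Variables (k : comPzRingType) (m : nat) (W : lmodType k).

Lemma arr_bound (f : arr m -> int) : exists M, forall w, f w <= M.
Proof.
pose g (s : seq nat) := if insub s is Some w then f w else 0.
have [M hM] := seq_max_bound (permutations (iota 0 m)) g.
exists M => w; have := hM (val w); rewrite mem_permutations (valP w) => /(_ isT).
by rewrite /g valK.
Qed.

Lemma family_bound (F : arr m -> laurent W) :
  exists M : int, forall n, M < n -> (fun w => lcoef n (F w)) = 0.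
Proof.
have [B hB] := choice (fun w => lcoef_bound (F w)).
have [M hM] := arr_bound B; exists M => n hn; apply/funext => w.
by apply: hB; apply: le_lt_trans (hM w) hn.
Qed.

(** As there are finitely many arrangements, degrees are bounded uniformly and a family of series is
    the same as a series of families. This brings x_m outside the module for m strands. *)
Definition fam (F : arr m -> laurent W) : laurent (arr m -> W) :=
  of_fun (fun n w => lcoef n (F w)).
Lemma lcoef_fam F n w : lcoef n (fam F) w = lcoef n (F w).
Proof.
have [M hM] := family_bound F.
by rewrite (@lcoef_of_fun _ (arr m -> W) _ M).
Qed.
Definition unfam (g : laurent (arr m -> W)) (w : arr m) : laurent W :=
  lmap (fun f : arr m -> W => f w) g.
Lemma lcoef_unfam g n w : lcoef n (unfam g w) = lcoef n g w.
Proof. by rewrite lcoef_map. Qed.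
Lemma unfamK g : fam (unfam g) = g.
Proof. by apply: lcoefP => n; apply/funext => w; rewrite lcoef_fam lcoef_unfam. Qed.
Lemma famK F w : unfam (fam F) w = F w.
Proof. by apply: lcoefP => n; rewrite lcoef_unfam lcoef_fam. Qed.
Lemma famP (g h : laurent (arr m -> W)) : (forall w, unfam g w = unfam h w) -> g = h.
Proof. by move=> e; rewrite -[g]unfamK -[h]unfamK; congr fam; apply/funext. Qed.
Lemma unfamD g h w : unfam (g + h) w = unfam g w + unfam h w.
Proof. by apply: lcoefP => n; rewrite lcoef_unfam !linearD /= !lcoef_unfam. Qed.
Lemma unfamN g w : unfam (- g) w = - unfam g w.
Proof. by apply: lcoefP => n; rewrite lcoef_unfam !linearN /= !lcoef_unfam. Qed.
Lemma unfamZ a g w : unfam (a *: g) w = a *: unfam g w.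
Proof. by apply: lcoefP => n; rewrite lcoef_unfam !linearZ /= !lcoef_unfam. Qed.
Lemma unfam0 w : unfam 0 w = 0.
Proof. by apply: lcoefP => n; rewrite lcoef_unfam !linear0. Qed.
Lemma unfam_shift e g w : unfam (lshift e g) w = lshift e (unfam g w).
Proof. by apply: lcoefP => n; rewrite lcoef_unfam !lcoef_shift lcoef_unfam. Qed.
End Family.

(** * Inserting the strand with the largest label *)

Section Insertion.
Variable m : nat.

Lemma iotaS_rcons : iota 0 m.+1 = rcons (iota 0 m) m.
Proof. by rewrite -addn1 iotaD cats1. Qed.

Definition ins_seq (c : nat) (s : seq nat) := take c s ++ m :: drop c s.
Fact ins_perm c (w : arr m) : perm_eq (ins_seq c (val w)) (iota 0 m.+1).
Proof.
rewrite iotaS_rcons -cats1 /ins_seq -cat1s perm_catCA cat_take_drop.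
by rewrite perm_sym perm_catC perm_cat2l perm_sym (valP w).
Qed.
Definition ins c (w : arr m) : arr m.+1 := exist _ (ins_seq c (val w)) (ins_perm c w).

Fact rest_perm (w : arr m.+1) : perm_eq (rem m (val w)) (iota 0 m).
Proof.
have h : m \in val w by rewrite mem_arr ltnSn.
rewrite -(perm_cons m); apply: (@perm_trans _ (val w)).
  by rewrite perm_sym perm_to_rem.
by rewrite (permPl (valP w)) iotaS_rcons perm_rcons.
Qed.
Definition rest (w : arr m.+1) : arr m := exist _ (rem m (val w)) (rest_perm w).
Definition pos (w : arr m.+1) : nat := index m (val w).

Lemma m_notin (w : arr m) : m \notin val w.
Proof. by rewrite mem_arr ltnn. Qed.

Lemma pos_ins c w : (c <= m)%N -> pos (ins c w) = c.
Proof.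
move=> h; rewrite /pos /= index_cat.
rewrite ifN; last by apply: contra (m_notin w); apply: mem_take.
by rewrite /= eqxx addn0 size_takel ?size_arr.
Qed.
Lemma rest_ins c w : rest (ins c w) = w.
Proof.
apply: val_inj; rewrite /= /ins_seq -[RHS](cat_take_drop c).
have : m \notin take c (val w) by apply: contra (m_notin w); apply: mem_take.
elim: (take c _) => [|y r IH] /=; first by rewrite eqxx.
rewrite inE negb_or eq_sym => /andP[/negbTE -> h]; congr cons; exact: IH.
Qed.
Lemma ins_rest w : ins (pos w) (rest w) = w.
Proof.
have h : m \in val w by rewrite mem_arr ltnSn.
have [a [b ew]] : exists a b, val w = a ++ m :: b by case/splitPr: h => a b; exists a, b.
have ha : m \notin a.
  by have := uniq_arr w; rewrite ew cat_uniq /= => /and3P[_ /norP[]].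
apply: val_inj; rewrite -[LHS]/(ins_seq (pos w) (rem m (val w))) /ins_seq /pos ew.
rewrite index_cat (negbTE ha) /= eqxx addn0.
have -> : rem m (a ++ m :: b) = a ++ b.
  elim: a ha {ew} => [|y a IH] /=; first by rewrite eqxx.
  by rewrite inE negb_or eq_sym => /andP[/negbTE -> /IH ->].
by rewrite take_size_cat // drop_size_cat.
Qed.
Lemma pos_le w : (pos w <= m)%N.
Proof.
by rewrite -ltnS -[X in (_ < X)%N](size_arr w) index_mem mem_arr ltnSn.
Qed.

Lemma nth_ins c w i : (c <= m)%N -> nth 0%N (val (ins c w)) i =
  if (i < c)%N then nth 0%N (val w) i else if i == c then m else nth 0%N (val w) i.-1.
Proof.
move=> h; rewrite /= nth_cat size_takel ?size_arr //.
case: ltnP => lt; first by rewrite nth_take.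
case: eqP => [->|ne]; first by rewrite subnn.
have -> : (i - c = (i.-1 - c).+1)%N by lia.
by rewrite /= nth_drop; congr nth; lia.
Qed.

Lemma st_ins c w l : (c <= m)%N -> (0 < l)%N -> st (ins c w) l =
  if (l <= c)%N then st w l else if l == c.+1 then m else st w l.-1.
Proof.
move=> h l0; rewrite /st nth_ins //; by case: l l0.
Qed.

Lemma arr_eqP n (w w' : arr n) :
  (forall i, (i < n)%N -> nth 0%N (val w) i = nth 0%N (val w') i) -> w = w'.
Proof.
by move=> h; apply/val_inj/(@eq_from_nth _ 0%N); rewrite !size_arr.
Qed.

Lemma nth_arr_swp n (w : arr n) l i : (0 < l < n)%N ->
  nth 0%N (val (arr_swp l w)) i = nth 0%N (val w) (swap_pos l i).
Proof. by move=> h; rewrite val_arr_swp // nth_swp ?size_arr. Qed.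

Local Ltac swap_cases i l :=
  let E := fresh in let E' := fresh in
  rewrite /swap_pos; case: (i =P l.-1) => E; [rewrite E|case: (i =P l) => E'; [rewrite E'|]];
  repeat case: ifP => ?; try congr nth; lia.

Lemma swp_ins_lt c w l : (0 < l)%N -> (l < c)%N -> (c <= m)%N ->
  arr_swp l (ins c w) = ins c (arr_swp l w).
Proof.
move=> l0 lc cm; have h : (0 < l < m)%N by lia.
apply: arr_eqP => i _; rewrite nth_arr_swp ?nth_ins ?nth_arr_swp //; last lia.
rewrite /swap_pos; case: (i.-1 =P l.-1) => [?|?]; case: (i.-1 =P l) => [?|?];
  swap_cases i l.
Qed.
Lemma swp_ins_gt c w l : (c.+1 < l)%N -> (l < m.+1)%N ->
  arr_swp l (ins c w) = ins c (arr_swp l.-1 w).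
Proof.
move=> cl lm; have h : (0 < l.-1 < m)%N by lia.
apply: arr_eqP => i _; rewrite nth_arr_swp ?nth_ins ?nth_arr_swp //; try lia.
rewrite /swap_pos; case: (i.-1 =P l.-1.-1) => [?|?]; case: (i.-1 =P l.-1) => [?|?];
  swap_cases i l.
Qed.
Lemma swp_ins_l c w : (0 < c <= m)%N -> arr_swp c (ins c w) = ins c.-1 w.
Proof.
move=> h; apply: arr_eqP => i _; rewrite nth_arr_swp ?nth_ins; try lia.
swap_cases i c.
Qed.
Lemma swp_ins_r c w : (c < m)%N -> arr_swp c.+1 (ins c w) = ins c.+1 w.
Proof.
move=> h; rewrite -[c in ins c w]/(c.+1.-1) -swp_ins_l; last lia.
by rewrite arr_swpK //; lia.
Qed.
End Insertion.

(** * Components by position and parity of the last strand *)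

Section Components.
Variables (k : comPzRingType) (m : nat).
Local Notation V p := (arr p -> Wt k p).
Local Notation LW := (laurent (Wt k m)).

Definition part (b : bool) (u : LW * LW) : LW := if b then u.2 else u.1.
(** Here c counts the strands to the left of strand m, and b tells whether zeta_m occurs; what
    remains is a series in x_m over the module of the other m strands. *)
Definition comp (c : nat) (b : bool) (u : V m.+1) : laurent (V m) :=
  fam (fun w => part b (u (ins c w))).
Definition glue (G : nat -> bool -> laurent (V m)) : V m.+1 := fun w =>
  (unfam (G (pos w) false) (rest w), unfam (G (pos w) true) (rest w)).

Lemma unfam_comp c b u w : unfam (comp c b u) w = part b (u (ins c w)).
Proof. by rewrite famK. Qed.

Lemma comp_glue G c b : (c <= m)%N -> comp c b (glue G) = G c b.
Proof.
move=> h; apply: famP => w; rewrite unfam_comp /glue pos_ins // rest_ins.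
by case: b.
Qed.

Lemma compP u v :
  (forall c b, (c <= m)%N -> comp c b u = comp c b v) -> u = v.
Proof.
move=> h; apply/funext => w; rewrite -(ins_rest w).
have e b : part b (u (ins (pos w) (rest w))) = part b (v (ins (pos w) (rest w))).
  by rewrite -!unfam_comp h // pos_le.
have := e false; have := e true; rewrite /part.
by case: (u _) => ? ?; case: (v _) => ? ? /= -> ->.
Qed.

Fact comp_linear c b : linear (comp c b).
Proof.
move=> a u v; apply: famP => w; rewrite unfamD unfamZ !unfam_comp.
by case: b.
Qed.
HB.instance Definition _ c b := GRing.isLinear.Build k (V m.+1) (laurent (V m)) _
  (comp c b) (comp_linear c b).

(** Strand m is placed at the right end, without zeta_m: the starting point of every chain. *)
Definition sig (g : laurent (V m)) : V m.+1 :=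
  glue (fun c b => if (c == m) && ~~ b then g else 0).

Lemma comp_sig g c b : (c <= m)%N -> comp c b (sig g) = if (c == m) && ~~ b then g else 0.
Proof. exact: comp_glue. Qed.
Fact sig_linear : linear sig.
Proof.
move=> a g h; apply: compP => c b hc; rewrite [RHS]linearP /= !comp_sig //.
by case: ifP; rewrite ?scaler0 ?addr0.
Qed.
HB.instance Definition _ := GRing.isLinear.Build k (laurent (V m)) (V m.+1) _ sig sig_linear.

(* [bicommutant] elements commute with (f, g) |-> (g, 0) and (f, g) |-> (0, f). *)
Lemma bact_both (a : wK k m.+1) :
  exists2 f : LW -> LW, linear f & forall u, bact a u = both f u.
Proof.
pose N (u : Wt k m.+1) : Wt k m.+1 := (u.2, 0).
have cN : in_commutant (@wX k m.+1) N.
  split=> [b [u1 u2] [v1 v2]|p x].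
    by rewrite /N; congr pair => /=; rewrite scaler0 addr0.
  rewrite /N /= /both /=; congr pair; case: eqP => _; rewrite ?linear0 //.
have cZ := commutant_wZ k m.+1 m.
exists (fun f => (bact a (f, 0)).1).
  move=> b f g; have := bact_linear a b (f, 0) (g, 0).
  rewrite [X in bact a X](_ : _ = (b *: f + g, 0)); last by congr pair => /=; rewrite scaler0 addr0.
  by move->.
move=> [f g]; have efg : (f, g) = (f, 0) + (0, g) :> Wt k m.+1.
  by congr pair; rewrite ?addr0 ?add0r.
rewrite [in LHS]efg linearD /=.
have e2 x : bact a (0, x) = (0, (bact a (x, 0)).1).
  by have := @bact_wZ k m.+1 m a (x, 0); rewrite /= eqxx => <-.
have e1 x : bact a (x, 0) = ((bact a (x, 0)).1, 0).
  have := bact_comm a cN (0, x); rewrite /N /= => <-.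
  by rewrite e2.
by rewrite e2 (e1 f) /both; congr pair; [exact: addr0|exact: add0r].
Qed.

(* The action on coefficients of an operator not involving the variable x_m. *)
Definition lowers (a : wK k m.+1) (a' : wK k m) :=
  forall u, bact a u = both (lmap (bact a')) u.

Lemma lowersD a a' b b' : lowers a a' -> lowers b b' -> lowers (a + b) (a' + b').
Proof.
move=> h h' u; rewrite bactD h h' /both; congr pair;
  by apply: lcoefP => n; rewrite linearD /= !lcoef_map ?linear0.
Qed.
Lemma lowersM a a' b b' : lowers a a' -> lowers b b' -> lowers (a * b) (a' * b').
Proof.
move=> h h' u; rewrite bactM h h' /both; congr pair;
  by apply: lcoefP => n; rewrite !lcoef_map ?linear0.
Qed.
Lemma lowers0 : lowers 0 0.
Proof.
move=> u; rewrite bact0 /both; congr pair;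
  by apply: lcoefP => n; rewrite lcoef_map ?linear0.
Qed.
Lemma lowers1 : lowers 1 1.
Proof.
move=> u; rewrite bact1 /both; case: u => u v; congr pair;
  by apply: lcoefP => n; rewrite lcoef_map.
Qed.
Lemma lowersS b : lowers (kS m.+1 b) (kS m b).
Proof.
move=> u; rewrite bact_kS /both; case: u => u v; congr pair;
  by apply: lcoefP => n; rewrite linearZ /= lcoef_map ?linear0.
Qed.
Lemma lowersN a a' : lowers a a' -> lowers (- a) (- a').
Proof.
move=> h u; rewrite bactN h /both; congr pair;
  by apply: lcoefP => n; rewrite linearN /= !lcoef_map ?linear0 // oppr0.
Qed.
Lemma lowersX a a' e : lowers a a' -> lowers (a ^+ e) (a' ^+ e).
Proof.
by move=> h; elim: e => [|e IH]; [exact: lowers1|rewrite !exprS; apply: lowersM].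
Qed.
Lemma lowers_sum (J : Type) (r : seq J) (P : pred J) (E : J -> wK k m.+1) E' :
  (forall j, lowers (E j) (E' j)) ->
  lowers (\sum_(j <- r | P j) E j) (\sum_(j <- r | P j) E' j).
Proof.
by move=> h; elim/big_rec2: _ => [|j a b _ hab]; [exact: lowers0|apply: lowersD].
Qed.
Lemma lowers_kX p : p != m -> lowers (kX k m.+1 p) (kX k m p).
Proof. by move=> /negbTE ne u; rewrite bact_kX /= ne. Qed.
Lemma lowers_kD p q : (p < m)%N -> (q < m)%N -> p != q ->
  lowers (kD k m.+1 p q) (kD k m p q).
Proof.
move=> lp lq ne u; rewrite bact_kD //; try lia.
rewrite wD_lower // /both; congr pair;
  by apply: lcoefP => n; rewrite !lcoef_map ?linear0 ?bact_kD // -bact_kD // linear0.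
Qed.
End Components.

(** * Invertibility of the leading coefficients *)

Section Ladder.
Variables (C : cartanDatum) (k : comPzRingType) (Q : klrScalars C k) (c : nat -> C).
Local Notation V p := (arr p -> Wt k p).

Definition vTh m (u : V m) : V m := fun w => wZ (st w 1) (u w).
Definition vM m (l : nat) (j : C) (u : V m) : V m :=
  fun w => if c (st w l) == j then u w else 0.

Fact vTh_linear m : linear (@vTh m).
Proof. by move=> a u v; apply/funext => w; rewrite /vTh linearP. Qed.
HB.instance Definition _ m := GRing.isLinear.Build k (V m) (V m) _ (@vTh m) (@vTh_linear m).
Fact vM_linear m l j : linear (@vM m l j).
Proof.
move=> a u v; apply/funext => w; rewrite vDE vZE /vM vDE vZE.
by case: ifP; rewrite ?scaler0 ?addr0.
Qed.
HB.instance Definition _ m l j := GRing.isLinear.Build k (V m) (V m) _ (@vM m l j)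
  (@vM_linear m l j).

(** Used for the vectors coming from the algebra ([image]), for those satisfying [vwF], and for the
    whole module, where it yields uniqueness. *)
Record stable m (X : V m -> Prop) : Prop := Stable {
  stable0 : X 0;
  stableD : forall f g, X f -> X g -> X (f + g);
  stableZ : forall a f, X f -> X (a *: f);
  stable_x : forall l f, (0 < l <= m)%N -> X f -> X (vX l f);
  stable_M : forall l j f, (0 < l <= m)%N -> X f -> X (vM l j f);
  stable_T : forall l f, (0 < l < m)%N -> X f -> X (vT Q c l f);
  stable_Th : forall f, X f -> X (vTh f)
}.

Section Act.
Variable m : nat.
Local Notation L := (laurent (V m)).
Local Notation K := (wK k m.+1).

(** The operator may depend on the label of the strand at position l. Reading off the even part
    loses nothing, as elements of [wK] act alike on both parts by [bact_both]. *)
Definition act (l : nat) (A : nat -> K) (g : L) : L :=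
  fam (fun w => (bact (A (st w l)) (unfam g w, 0)).1).

Lemma part_bact (a : K) b u : part b (bact a u) = (bact a (part b u, 0)).1.
Proof. by have [f lf e] := bact_both a; rewrite !e; case: b. Qed.

Lemma unfam_act l A g w : unfam (act l A g) w = (bact (A (st w l)) (unfam g w, 0)).1.
Proof. by rewrite famK. Qed.

Fact act_linear l A : linear (act l A).
Proof.
move=> a g h; apply: famP => w; rewrite unfamD unfamZ !unfam_act unfamD unfamZ.
by have [f lf e] := bact_both (A (st w l)); rewrite !e /= lf.
Qed.
HB.instance Definition _ l A := GRing.isLinear.Build k L L _ (act l A) (act_linear l A).

Lemma actD l A B g : act l (fun p => A p + B p) g = act l A g + act l B g.
Proof. by apply: famP => w; rewrite unfamD !unfam_act bactD. Qed.
Lemma actM l A B g : act l (fun p => A p * B p) g = act l A (act l B g).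
Proof.
apply: famP => w; rewrite !unfam_act bactM.
by have [f lf e] := bact_both (B (st w l)); have [f' lf' e'] := bact_both (A (st w l));
  rewrite !(e, e').
Qed.
Lemma act_sum l (J : Type) (r : seq J) (P : pred J) (E : J -> nat -> K) g :
  act l (fun p => \sum_(j <- r | P j) E j p) g = \sum_(j <- r | P j) act l (E j) g.
Proof.
elim: r => [|j r IH].
  by rewrite big_nil; apply: famP => w; rewrite unfam_act unfam0 big_nil.
rewrite big_cons -IH; case: ifP => Pj.
  by rewrite -actD; apply: famP => w; rewrite !unfam_act big_cons Pj.
by apply: famP => w; rewrite !unfam_act big_cons Pj.
Qed.
Lemma actS l b g : act l (fun=> kS m.+1 b) g = b *: g.
Proof. by apply: famP => w; rewrite unfam_act unfamZ. Qed.
Lemma act1 l g : act l (fun=> 1) g = g.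
Proof. by apply: famP => w; rewrite unfam_act. Qed.
Lemma act0 l g : act l (fun=> 0) g = 0.
Proof. by apply: famP => w; rewrite unfam_act unfam0. Qed.
Lemma act_top l e g : act l (fun=> kX k m.+1 m ^+ e) g = lshift e%:Z g.
Proof.
elim: e => [|e IH]; first by rewrite lshift0 -[RHS](act1 l); congr act.
transitivity (act l (fun=> kX k m.+1 m * kX k m.+1 m ^+ e) g).
  by congr act; apply/funext => p; rewrite exprS.
rewrite actM IH; apply: famP => w; rewrite unfam_act bact_kX /= eqxx /both /=.
by rewrite -unfam_shift lshiftD intS.
Qed.
Lemma act_x l e g : (0 < l <= m)%N ->
  act l (fun p => kX k m.+1 p ^+ e) g = iter e (lmap (vX l)) g.
Proof.
move=> hl; elim: e => [|e IH]; first by rewrite -[RHS](act1 l); congr act.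
transitivity (act l (fun p => kX k m.+1 p * kX k m.+1 p ^+ e) g).
  by congr act; apply/funext => p; rewrite exprS.
rewrite actM IH /=; apply: famP => w; rewrite unfam_act bact_kX /=.
rewrite (ltn_eqF (st_lt w hl)) /both /=; apply: lcoefP => n.
by rewrite lcoef_map ?linear0 // !lcoef_unfam lcoef_map // linear0.
Qed.

Definition mask (l : nat) (j : C) (g : L) : L := lmap (vM l j) g.
Lemma unfam_mask l j g w : unfam (mask l j g) w = if c (st w l) == j then unfam g w else 0.
Proof.
apply: lcoefP => n; rewrite lcoef_unfam lcoef_map ?linear0 // /vM.
by case: ifP => _; rewrite ?lcoef_unfam ?linear0.
Qed.
Lemma mask_sum l g : \sum_j mask l j g = g.
Proof.
apply: lcoefP => n; rewrite linear_sum; apply/funext => w /=.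
rewrite (big_morph (fun u : V m => u w) (id1 := 0) (op1 := +%R)) //.
rewrite (bigD1 (c (st w l))) //= -lcoef_unfam unfam_mask eqxx lcoef_unfam big1 ?addr0 //.
by move=> j ne; rewrite -lcoef_unfam unfam_mask eq_sym (negbTE ne) linear0.
Qed.
Lemma act_mask l A j g : act l A (mask l j g) = mask l j (act l A g).
Proof.
apply: famP => w; rewrite unfam_mask !unfam_act unfam_mask; case: ifP => // _.
by have [f lf e] := bact_both (A (st w l)); rewrite e /= linear_at0.
Qed.
Lemma act_ext l A B j g : (0 < l <= m)%N ->
    (forall p, (p < m)%N -> c p = j -> A p = B p) ->
  act l A (mask l j g) = act l B (mask l j g).
Proof.
move=> hl h; apply: famP => w; rewrite !unfam_act unfam_mask.
case: eqP => [e|_]; first by rewrite h // st_lt.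
have [f lf e] := bact_both (A (st w l)); have [f' lf' e'] := bact_both (B (st w l)).
by rewrite e e' /= !linear_at0.
Qed.
Lemma mask_idem l j g : mask l j (mask l j g) = mask l j g.
Proof. by apply: famP => w; rewrite !unfam_mask; case: ifP => // ->. Qed.

Lemma maskZ l j a g : mask l j (a *: g) = a *: mask l j g.
Proof. by apply: lcoefP => n; rewrite linearZ /= !lcoef_map ?linear0 // !linearZ. Qed.

Section Solve.
Variables (X : V m -> Prop) (sX : stable X) (l : nat) (hl : (0 < l <= m)%N).

Lemma allcD g h : allc X g -> allc X h -> allc X (g + h).
Proof. by move=> hg hh n; rewrite linearD; apply: (stableD sX); [exact: hg|exact: hh]. Qed.
Lemma allcZ a g : allc X g -> allc X (a *: g).
Proof. by move=> hg n; rewrite linearZ; apply: (stableZ sX); exact: hg. Qed.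
Lemma allc0 : allc X 0.
Proof. by move=> n; rewrite linear0; apply: (stable0 sX). Qed.
Lemma allc_sum (J : Type) (r : seq J) (P : pred J) (E : J -> L) :
  (forall j, P j -> allc X (E j)) -> allc X (\sum_(j <- r | P j) E j).
Proof. by move=> h; apply: (big_ind (allc X)) => //; [exact: allc0|exact: allcD]. Qed.
Lemma allc_shift e g : allc X g -> allc X (lshift e g).
Proof. by move=> h n; rewrite lcoef_shift; exact: h. Qed.
Lemma allc_map f g : f 0 = 0 -> (forall u, X u -> X (f u)) -> allc X g -> allc X (lmap f g).
Proof. by move=> f0 h hg n; rewrite lcoef_map //; apply: h; exact: hg. Qed.
Lemma allc_mask j g : allc X g -> allc X (mask l j g).
Proof. by apply: allc_map; [rewrite linear0|move=> u; apply: stable_M]. Qed.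

(** The arrangements are sorted by the colour j of the strand at position l, since the coefficients
    of a crossing are given by one formula for each colour. *)
Record good_at (A : nat -> K) (j : C) : Prop := GoodAt {
  at_pres : forall g, allc X g -> allc X (act l A (mask l j g));
  at_inj : forall g, act l A (mask l j g) = 0 -> mask l j g = 0;
  at_surj : forall f, allc X f ->
    exists2 g, allc X g & act l A (mask l j g) = mask l j f
}.
Record good (G : L -> L) : Prop := Good {
  good_pres : forall g, allc X g -> allc X (G g);
  good_inj : forall g, G g = 0 -> g = 0;
  good_surj : forall f, allc X f -> exists2 g, allc X g & G g = f
}.
Lemma good_id : good id.
Proof. by split=> // f hf; exists f. Qed.
Lemma good_comp G H : good G -> good H -> good (G \o H).
Proof.
move=> hG hH; split=> /=.
- by move=> g hg; apply: (good_pres hG); apply: (good_pres hH).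
- by move=> g /(good_inj hG) /(good_inj hH).
- by move=> f /(good_surj hG)[g /(good_surj hH)[h hh <-] <-]; exists h.
Qed.

Lemma act_masks A g : act l A g = \sum_j act l A (mask l j g).
Proof. by rewrite -linear_sum /= mask_sum. Qed.

Lemma pres_masks A : (forall j g, allc X g -> allc X (act l A (mask l j g))) ->
  forall g, allc X g -> allc X (act l A g).
Proof. by move=> h g hg; rewrite act_masks; apply: allc_sum => j _; apply: h. Qed.

Lemma good_masks A : (forall j, good_at A j) -> good (act l A).
Proof.
move=> h; split.
- by apply: pres_masks => j; exact: (at_pres (h j)).
- move=> g e; rewrite -(mask_sum l g) big1 // => j _; apply: (at_inj (h j)).
  by rewrite act_mask e /mask; apply: lcoefP => n; rewrite lcoef_map ?linear0.
- move=> f hf; have ex j : exists g, allc X g /\ act l A (mask l j g) = mask l j f.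
    by have [g hg eg] := at_surj (h j) hf; exists g.
  have [G hG] := choice ex.
  exists (\sum_j mask l j (G j)).
    by apply: allc_sum => j _; apply: allc_mask; have [] := hG j.
  rewrite linear_sum -[RHS](mask_sum l); apply: eq_bigr => j _.
  by have [] := hG j.
Qed.

Lemma good_at_ext A B j : (forall p, (p < m)%N -> c p = j -> A p = B p) ->
  good_at B j -> good_at A j.
Proof.
move=> e [h1 h2 h3]; split.
- by move=> g hg; rewrite (act_ext _ hl e); apply: h1.
- by move=> g; rewrite (act_ext _ hl e); apply: h2.
- by move=> f /h3[g hg eg]; exists g; rewrite ?(act_ext _ hl e).
Qed.

Lemma good_at1 j : good_at (fun=> 1) j.
Proof.
split.
- by move=> g hg; rewrite act1; apply: allc_mask.
- by move=> g; rewrite act1.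
- by move=> f hf; exists f; rewrite ?act1.
Qed.

Lemma good_at_inv A B j a : good_at B j -> invertible a ->
  (forall p, (p < m)%N -> c p = j -> A p * B p = kS m.+1 a) -> good_at A j.
Proof.
move=> [h1 h2 h3] [a' aa'] e.
have AB g : act l A (act l B (mask l j g)) = a *: mask l j g.
  rewrite -actM (act_ext (B := fun=> kS m.+1 a) _ hl) ?actS //.
have BA g : act l B (act l A (mask l j g)) = a *: mask l j g.
  rewrite -actM (act_ext (B := fun=> kS m.+1 a) _ hl) ?actS // => p lp cp.
  by rewrite mulrC e.
split.
- move=> g /h3[f hf ef]; rewrite -ef AB; apply: allcZ; exact: allc_mask.
- move=> g e0; have := BA g; rewrite e0 linear0 => /(congr1 (fun x => a' *: x)).
  by rewrite scaler0 scalerA mulrC aa' scale1r.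
- move=> f hf; exists (a' *: act l B (mask l j f)); first exact: allcZ (h1 _ hf).
  by rewrite maskZ -act_mask mask_idem linearZ /= AB scalerA mulrC aa' scale1r.
Qed.

Lemma vM_vX j (u : V m) : vM l j (vX l u) = vX l (vM l j u).
Proof. by apply/funext => w; rewrite /vM /vX; case: ifP; rewrite ?linear0. Qed.

Lemma good_at_monic A j d (e : nat -> {linear V m -> V m}) a : invertible a ->
    (forall v u, X u -> X (e v u)) ->
    (forall v u, vM l j (e v u) = e v (vM l j u)) ->
    (forall g, act l A (mask l j g) = a *: monic_op d e (mask l j g)) ->
  good_at A j.
Proof.
move=> [a' aa'] Xe eM E; split.
- move=> g hg; rewrite E; apply: allcZ; have hm := allc_mask j hg.
  apply: allcD; first exact: allc_shift.
  apply: allc_sum => v _; apply: allc_map.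
  - by rewrite linear0.
  - exact: Xe.
  - exact: allc_shift.
- move=> g; rewrite E => /(congr1 (fun x => a' *: x)).
  by rewrite scaler0 scalerA mulrC aa' scale1r => /monic_op_inj.
- move=> f hf; have [|g hg eg] := @monic_op_solve k (V m) d e X f (stable0 sX) _ Xe hf.
    move=> x y hx hy; rewrite -scaleN1r; apply: (stableD sX) => //; exact: (stableZ sX).
  have ms : mask l j (monic_op d e g) = monic_op d e (mask l j g).
    apply: lcoefP => n; rewrite /monic_op lcoef_map ?linear0 // !(linearD (lcoef n)).
    rewrite (linearD (vM l j)) !(linear_sum (lcoef n)) (linear_sum (vM l j)) /=.
    rewrite !lcoef_shift lcoef_map ?linear0 //; congr (_ + _).
    by apply: eq_bigr => v _; rewrite !lcoef_map ?linear0 // !lcoef_shift lcoef_map ?linear0.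
  exists (a' *: g); first exact: allcZ.
  by rewrite maskZ linearZ /= E -ms eg scalerA mulrC aa' scale1r.
Qed.

Lemma invertible_opp (a : k) : invertible a -> invertible (- a).
Proof. by move=> [a' e]; exists (- a'); rewrite mulrNN. Qed.

Lemma kSN (a : k) : kS m.+1 (- a) = - kS m.+1 a.
Proof. by apply/eqP; rewrite -addr_eq0 -kSD addNr kS0. Qed.

Lemma strand_good_at j : good_at (fun p => kX k m.+1 p - kX k m.+1 m) j.
Proof.
apply: (@good_at_monic _ _ 1 (fun=> \- vX (k := k) (n := m) l) (-1)).
- by exists (-1); rewrite mulrNN mulr1.
- move=> v u hu /=; rewrite -scaleN1r; apply: (stableZ sX); exact: (stable_x sX).
- by move=> v u /=; rewrite linearN /= vM_vX.
- move=> g; rewrite /monic_op big_ord1 lshift0 actD.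
  rewrite (_ : act l (fun p => kX k m.+1 p) _ = lmap (vX l) (mask l j g)); last first.
    exact: (@act_x l 1 _ hl).
  rewrite (_ : act l _ (mask l j g) = - lshift 1 (mask l j g)); last first.
    rewrite -(@act_top l 1) -[RHS]scaleN1r -[RHS](actS l (-1)) -actM; congr act.
    by apply/funext => p; rewrite kSN kS1 mulN1r.
  rewrite scaleN1r opprD addrC; congr (_ + _); apply: lcoefP => n.
  by rewrite linearN /= !lcoef_map ?linear0 //= ?oppr0 ?opprK.
Qed.

Lemma ta_diff_top p : (p < m)%N -> c p = c m ->
  ta Q c m.+1 p m * (kX k m.+1 p - kX k m.+1 m) = kS m.+1 (sc_r Q (c m)).
Proof. by move=> lp e; rewrite ta_diff ?e ?eqxx //; lia. Qed.

Lemma ta_top_sym p : (p < m)%N -> ta Q c m.+1 m p = - ta Q c m.+1 p m.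
Proof. by move=> lp; apply: taN; lia. Qed.

Lemma pres_ta : forall g, allc X g -> allc X (act l (fun p => ta Q c m.+1 p m) g).
Proof.
apply: pres_masks => j g hg; case: (j =P c m) => [e|ne].
  apply: (at_pres (j := j) _ hg); apply: good_at_inv (strand_good_at j) (sc_r_inv Q (c m)) _.
  by move=> p lp cp; apply: ta_diff_top => //; rewrite cp.
rewrite (act_ext (B := fun=> 0) _ hl) ?act0; first exact: allc0.
by move=> p lp cp; rewrite /ta ifF //; apply/eqP; rewrite cp.
Qed.

Lemma pres_ta' : forall g, allc X g -> allc X (act l (ta Q c m.+1 m) g).
Proof.
move=> g hg; suff -> : act l (ta Q c m.+1 m) g = - act l (fun p => ta Q c m.+1 p m) g.
  by rewrite -scaleN1r; apply: allcZ; apply: pres_ta.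
rewrite !act_masks -sumrN; apply: eq_bigr => j _.
rewrite (act_ext (B := fun p => kS m.+1 (-1) * ta Q c m.+1 p m) _ hl).
  by rewrite actM actS scaleN1r.
by move=> p lp _; rewrite ta_top_sym // kSN kS1 mulN1r.
Qed.

(** The coefficient of x_m^v in the polynomial Q between colour j and the colour of strand m, acting
    through the dot on strand l. *)
Definition kq_coef j v (u : V m) : V m :=
  \sum_(t < (dnum j (c m)).+1) sc_s Q j (c m) t v *: iter t (vX l) u.
Fact kq_coef_linear j v : linear (kq_coef j v).
Proof.
move=> a u w; rewrite /kq_coef scaler_sumr -big_split /=; apply: eq_bigr => t _.
have -> b : iter t (vX l) (b + w) = iter t (vX l) b + iter t (vX l) w.
  by elim: (val t) => //= n ->; rewrite linearD.
have -> : iter t (vX l) (a *: u) = a *: iter t (vX l) u.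
  by elim: (val t) => //= n ->; rewrite linearZ.
by rewrite scalerDr !scalerA mulrC.
Qed.
HB.instance Definition _ j v := GRing.isLinear.Build k (V m) (V m) _
  (kq_coef j v) (kq_coef_linear j v).

(** As a polynomial in x_m, Q has degree d with leading coefficient the unit t: for v = d the degree
    condition on s_ij^tv leaves only t = 0. Dividing by this unit gives a monic operator. *)
Lemma kq_good_at j : j != c m ->
  good_at (fun p => kQ Q j (c m) (kX k m.+1 p) (kX k m.+1 m)) j.
Proof.
move=> ne; have [b' bb'] := sc_t_inv Q (c m) j.
pose d := dnum (c m) j.
apply: (@good_at_monic _ _ d (fun v => b' \*: kq_coef j v) (sc_t Q (c m) j)).
- by exists b'.
- move=> v u hu /=; apply: (stableZ sX); apply: (big_ind X) => [|x y|t _].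
  + exact: (stable0 sX).
  + exact: (stableD sX).
  + apply: (stableZ sX); elim: (val t) => //= n; exact: (stable_x sX).
- move=> v u /=; rewrite linearZ linear_sum /=; congr (_ *: _); apply: eq_bigr => t _.
  rewrite linearZ /=; congr (_ *: _); elim: (val t) => //= n IH.
  by rewrite vM_vX IH.
- move=> g; rewrite /kQ act_sum.
  have E v : act l (fun p => \sum_(t < (dnum j (c m)).+1) kS m.+1 (sc_s Q j (c m) t v) *
      kX k m.+1 p ^+ t * kX k m.+1 m ^+ v) (mask l j g) =
      lmap (kq_coef j v) (lshift v%:Z (mask l j g)).
    rewrite act_sum; apply: lcoefP => n; rewrite linear_sum lcoef_map ?linear0 //.
    apply: eq_bigr => t _; rewrite !actM actS act_top act_x // linearZ /=.
    congr (_ *: _); rewrite iter_lmap.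
    by rewrite lcoef_map ?iter_linear0.
  transitivity (\sum_(v < d.+1) lmap (kq_coef j v) (lshift v%:Z (mask l j g))).
    rewrite -act_sum; under [RHS]eq_bigr => v _ do rewrite -E.
    rewrite -act_sum; congr act; apply/funext => p; exact: exchange_big.
  rewrite big_ord_recr /= scalerDr scaler_sumr addrC; congr (_ + _).
    apply: lcoefP => n; rewrite lcoef_map ?linear0 // linearZ /= lcoef_shift.
    rewrite /kq_coef big_ord_recl /= sc_s_right // big1 ?addr0 // => t _.
    rewrite (sc_s_zero Q) ?scale0r // !cd_formE !cd_a_diag /bump /= {}/d /dnum.
    move: (nat_of_ord t) => t'; rewrite abszN -(cd_symm (c m) j).
    have dj := cd_d_gt0 j; have sg : cd_a (c m) j <= 0 by apply: cd_a_off; rewrite eq_sym.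
    by move: (cd_a _ _) sg (cd_d j) dj (cd_d (c m)) => a sg x hx y; nia.
  apply: eq_bigr => v _; apply: lcoefP => n; rewrite linearZ /= !lcoef_map ?linear0 //.
  by rewrite /= scalerA bb' scale1r.
Qed.

(** For equal colours the inverse is x_p - x_m up to a unit, which is monic in x_m up to sign; for
    distinct colours p < m selects the polynomial Q. With the labels exchanged, as in [good_tb'],
    the latter becomes 1. *)
Lemma good_tb : good (act l (fun p => tb Q c m.+1 p m)).
Proof.
apply: good_masks => j; case: (j =P c m) => [e|/eqP ne].
  apply: good_at_inv (strand_good_at j) (invertible_opp (sc_r_inv Q (c m))) _.
  move=> p lp cp; rewrite /tb ifT; last by rewrite cp e.
  by rewrite mulNr ta_diff_top ?cp // kSN.
apply: good_at_ext (kq_good_at ne) => p lp cp.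
by rewrite /tb cp (negbTE ne) lp.
Qed.

Lemma good_tb' : good (act l (tb Q c m.+1 m)).
Proof.
apply: good_masks => j; case: (j =P c m) => [e|/eqP ne].
  apply: good_at_inv (strand_good_at j) (sc_r_inv Q (c m)) _.
  move=> p lp cp; rewrite /tb ifT; last by rewrite cp e.
  by rewrite ta_top_sym // opprK ta_diff_top ?cp.
apply: good_at_ext (good_at1 j) => p lp cp.
by rewrite /tb cp eq_sym (negbTE ne) ltnNge ltnW.
Qed.

End Solve.
End Act.
End Ladder.

(** * Triangularity of the chain *)

Section Triangular.
Variables (C : cartanDatum) (k : comPzRingType) (Q : klrScalars C k) (c : nat -> C).
Variable m : nat.
Local Notation V p := (arr p -> Wt k p).
Local Notation L := (laurent (V m)).

Lemma part_both (f : laurent (Wt k m) -> laurent (Wt k m)) b u :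
  part b (both f u) = f (part b u).
Proof. by case: b. Qed.
Lemma partD b (u v : Wt k m.+1) : part b (u + v) = part b u + part b v.
Proof. by case: b. Qed.

Lemma unfam_lmap (f : V m -> V m) (F : Wt k m -> Wt k m) g w :
  f 0 = 0 -> F 0 = 0 -> (forall u, f u w = F (u w)) -> unfam (lmap f g) w = lmap F (unfam g w).
Proof.
move=> f0 F0 h; apply: lcoefP => n.
by rewrite lcoef_unfam !lcoef_map // h lcoef_unfam.
Qed.

Lemma comp_vX cc b l (u : V m.+1) : (cc <= m)%N -> (0 < l <= m.+1)%N ->
  comp cc b (vX l u) =
    if (l <= cc)%N then lmap (vX l) (comp cc b u)
    else if l == cc.+1 then lshift 1 (comp cc b u) else lmap (vX l.-1) (comp cc b u).
Proof.
move=> hc hl; apply: famP => w; rewrite unfam_comp [in LHS]/vX st_ins //; last lia.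
have low p : (p < m)%N -> part b (wX p (u (ins cc w))) = lmap (wX p) (unfam (comp cc b u) w).
  by move=> lt; rewrite /= (ltn_eqF lt) part_both unfam_comp.
case: leqP => h1.
  rewrite low; last by apply: st_lt; lia.
  by rewrite (@unfam_lmap _ (wX (st w l))) //; exact: linear0.
case: eqP => [_|h2]; first by rewrite /= eqxx part_both unfam_shift unfam_comp.
rewrite low; last by apply: st_lt; lia.
by rewrite (@unfam_lmap _ (wX (st w l.-1))) //; exact: linear0.
Qed.

Lemma comp_vTh cc b (u : V m.+1) : (cc <= m)%N ->
  comp cc b (vTh u) =
    if cc == 0%N then if b then comp 0 false u else 0
    else (-1) ^+ b *: lmap (@vTh k m) (comp cc b u).
Proof.
move=> hc; apply: famP => w; rewrite unfam_comp [in LHS]/vTh st_ins //.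
case: cc hc => [|cc] hc.
  by rewrite /= eqxx; case: b; rewrite ?unfam_comp ?unfam0.
rewrite unfamZ (@unfam_lmap _ (wZ (st w 1))) //; try exact: linear0.
rewrite /= ltn_eqF; last by apply: st_lt; lia.
by case: b; rewrite unfam_comp ?scale1r ?scaleN1r.
Qed.

Lemma lowers_ta p q : (p < m)%N -> (q < m)%N -> p != q ->
  lowers (ta Q c m.+1 p q) (ta Q c m p q).
Proof.
move=> lp lq ne; rewrite /ta; case: ifP => _; last exact: lowers0.
by apply: lowersM; [exact: lowersS|exact: lowers_kD].
Qed.
Lemma lowers_tb p q : (p < m)%N -> (q < m)%N -> p != q ->
  lowers (tb Q c m.+1 p q) (tb Q c m p q).
Proof.
move=> lp lq ne; rewrite /tb; case: ifP => _; first exact/lowersN/lowers_ta.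
case: ifP => _; last exact: lowers1.
apply: lowers_sum => t; apply: lowers_sum => v.
apply: lowersM; first apply: lowersM; first exact: lowersS.
  by apply/lowersX/lowers_kX; lia.
by apply/lowersX/lowers_kX; lia.
Qed.

Lemma comp_vT_low cc b l l' (u : V m.+1) : (cc <= m)%N -> (0 < l' < m)%N ->
    (forall w : arr m, st (ins cc w) l = st w l') ->
    (forall w : arr m, st (ins cc w) l.+1 = st w l'.+1) ->
    (forall w : arr m, arr_swp l (ins cc w) = ins cc (arr_swp l' w)) ->
  comp cc b (vT Q c l u) = lmap (vT Q c l') (comp cc b u).
Proof.
move=> hc hl e1 e2 e3; apply: famP => w; rewrite unfam_comp [in LHS]/vT e1 e2 e3.
have lp : (st w l' < m)%N by apply: st_lt; lia.
have lq : (st w l'.+1 < m)%N by apply: st_lt; lia.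
have ne : st w l' != st w l'.+1 by apply: st_neq; lia.
rewrite (lowers_ta lp lq ne) (lowers_tb lp lq ne) partD !part_both -!unfam_comp.
by apply: lcoefP => n; rewrite lcoef_unfam linearD /= !lcoef_map ?linear0.
Qed.

Lemma comp_vT_lt cc b l (u : V m.+1) : (cc <= m)%N -> (0 < l < cc)%N ->
  comp cc b (vT Q c l u) = lmap (vT Q c l) (comp cc b u).
Proof.
move=> hc hl; apply: comp_vT_low => [||w|w|w]; try lia.
- by rewrite st_ins ?ifT //; lia.
- by rewrite st_ins ?ifT //; lia.
- by rewrite swp_ins_lt //; lia.
Qed.
Lemma comp_vT_gt cc b l (u : V m.+1) : (cc.+1 < l <= m)%N ->
  comp cc b (vT Q c l u) = lmap (vT Q c l.-1) (comp cc b u).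
Proof.
move=> hl; apply: comp_vT_low => [||w|w|w]; try lia.
- by rewrite st_ins ?ifF //; lia.
- rewrite st_ins ?ifF //; try lia.
- by rewrite swp_ins_gt //; lia.
Qed.
Lemma comp_vT_l cc b (u : V m.+1) : (0 < cc <= m)%N ->
  comp cc b (vT Q c cc u) = act cc (fun p => ta Q c m.+1 p m) (comp cc b u)
    + act cc (fun p => tb Q c m.+1 p m) (comp cc.-1 b u).
Proof.
move=> hc; apply: famP => w; rewrite unfamD !unfam_act !unfam_comp /vT.
rewrite swp_ins_l // !st_ins; try lia.
by rewrite leqnn ltnn eqxx partD !part_bact.
Qed.
Lemma comp_vT_r cc b (u : V m.+1) : (cc < m)%N ->
  comp cc b (vT Q c cc.+1 u) = act cc.+1 (ta Q c m.+1 m) (comp cc b u)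
    + act cc.+1 (tb Q c m.+1 m) (comp cc.+1 b u).
Proof.
move=> hc; apply: famP => w; rewrite unfamD !unfam_act !unfam_comp /vT.
rewrite swp_ins_r // !st_ins; try lia.
rewrite ltnn eqxx (_ : (cc.+2 <= cc)%N = false); last lia.
rewrite (_ : (cc.+2 == cc.+1) = false); last lia.
by rewrite partD !part_bact.
Qed.

Definition allM (X : V m -> Prop) (u : V m.+1) :=
  forall cc b, (cc <= m)%N -> allc X (comp cc b u).

Section Stable.
Variables (X : V m -> Prop) (sX : stable Q c X).

Lemma allM_D u v : allM X u -> allM X v -> allM X (u + v).
Proof. by move=> hu hv cc b hc; rewrite linearD; apply: (allcD sX); [exact: hu|exact: hv]. Qed.
Lemma allM_Z a u : allM X u -> allM X (a *: u).
Proof. by move=> hu cc b hc; rewrite linearZ; apply: (allcZ sX); exact: hu. Qed.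
Lemma allM_N u : allM X u -> allM X (- u).
Proof. by rewrite -scaleN1r; exact: allM_Z. Qed.
Lemma allM_sig g : allc X g -> allM X (sig g).
Proof. by move=> hg cc b hc; rewrite comp_sig //; case: ifP => // _; exact: (allc0 sX). Qed.
Lemma allM_Th u : allM X u -> allM X (vTh u).
Proof.
move=> hu cc b hc; rewrite comp_vTh //; case: cc hc => [|cc] hc.
  by case: b; [exact: hu|exact: (allc0 sX)].
apply: (allcZ sX); apply: allc_map; [exact: linear0|exact: (stable_Th sX)|exact: hu].
Qed.
Lemma allM_T l u : (0 < l <= m)%N -> allM X u -> allM X (vT Q c l u).
Proof.
move=> hl hu cc b hc; case: (ltngtP l cc) => h.
- rewrite comp_vT_lt //; last lia.
  apply: allc_map; [exact: linear0|move=> v; apply: (stable_T sX); lia|exact: hu].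
- have [e|ne] := eqVneq l cc.+1.
    rewrite e comp_vT_r; last lia.
    apply: (allcD sX).
      by apply: (pres_ta' sX); [lia|exact: hu].
    by apply: (good_pres (good_tb' sX _)); [lia|apply: hu; lia].
  rewrite comp_vT_gt; last lia.
  apply: allc_map; [exact: linear0|move=> v; apply: (stable_T sX); lia|exact: hu].
- rewrite -h comp_vT_l; last lia.
  apply: (allcD sX).
    by apply: (pres_ta sX); [lia|apply: hu; lia].
  by apply: (good_pres (good_tb sX _)); [lia|apply: hu; lia].
Qed.
Lemma allM_X l u : (0 < l <= m.+1)%N -> allM X u -> allM X (vX l u).
Proof.
move=> hl hu cc b hc; rewrite comp_vX //; case: ifP => h; last case: eqP => h'.
- apply: allc_map; [exact: linear0|move=> v; apply: (stable_x sX); lia|exact: hu].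
- by apply: allc_shift; apply: hu.
- apply: allc_map; [exact: linear0|move=> v; apply: (stable_x sX); lia|exact: hu].
Qed.
End Stable.
Definition vs n (l : nat) (u : V n) : V n := if l is 0 then vTh u else vT Q c l u.
Fixpoint vchain (b : nat) (u : V m.+1) : V m.+1 :=
  if b is b'.+1 then vs (kap m b') (vchain b' u) else u.
Fact vs_linear n l : linear (@vs n l).
Proof. by move=> a u v; case: l => [|l] /=; rewrite linearP. Qed.
HB.instance Definition _ n l := GRing.isLinear.Build k (V n) (V n) _ (@vs n l) (@vs_linear n l).
Fact vchain_linear b : linear (vchain b).
Proof. by elim: b => [|b IH] a u v //=; rewrite IH linearP. Qed.
HB.instance Definition _ b := GRing.isLinear.Build k (V m.+1) (V m.+1) _
  (vchain b) (vchain_linear b).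

Lemma allM_chain X b u : stable Q c X -> (b <= (m.*2).+1)%N -> allM X u -> allM X (vchain b u).
Proof.
move=> sX; elim: b => [|b IH] // hb hu; rewrite /= /vs.
have hk : (kap m b <= m)%N by rewrite /kap; case: ifP; lia.
have := IH (ltnW hb) hu; case: (kap m b) hk => [|l] hl; first exact: allM_Th.
by apply: allM_T => //; lia.
Qed.

(* Each step of the chain moves strand m by one position, first to the left end,
   where theta turns the even part into the odd part, and then back to the right;
   [lead_pos], [lead_part] record where [vchain b] puts the component of [sig g]. *)
Definition lead_pos b : nat := if (b <= m)%N then (m - b)%N else (b - m.+1)%N.
Definition lead_part b : bool := (m < b)%N.
Definition rank (cc : nat) (p : bool) : nat := if p then (m.+1 + cc)%N else (m - cc)%N.
Definition lead_step b (g : L) : L :=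
  if (b < m)%N then act (m - b) (tb Q c m.+1 m) g
  else if b == m then g else act (b - m) (fun p => tb Q c m.+1 p m) g.
Fixpoint lead_map b (g : L) : L := if b is b'.+1 then lead_step b' (lead_map b' g) else g.

Lemma lead_map_good X b : stable Q c X -> (b <= (m.*2).+1)%N -> good X (lead_map b).
Proof.
move=> sX; elim: b => [|b IH] hb; first exact: good_id.
have hG : good X (lead_step b).
  rewrite /lead_step; case: ltngtP => h /=.
  - by apply: good_tb' => //; lia.
  - by apply: good_tb => //; lia.
  - exact: good_id.
exact: good_comp hG (IH (ltnW hb)).
Qed.

Lemma chain_lead b g : (b <= (m.*2).+1)%N ->
  (forall cc p, (cc <= m)%N -> (b < rank cc p)%N -> comp cc p (vchain b (sig g)) = 0) /\
  comp (lead_pos b) (lead_part b) (vchain b (sig g)) = lead_map b g.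
Proof.
elim: b => [|b IH] hb.
  split=> [cc p hc|] /=; last by rewrite /lead_pos subn0 comp_sig ?eqxx.
  by rewrite comp_sig // /rank; case: p => //=; case: eqP => // ->; rewrite subnn.
have [z e] := IH (ltnW hb); rewrite /= /vs.
set u := vchain b (sig g) in z e *.
rewrite /lead_step /kap; case: (ltngtP b m) => h.
- have [l el] : exists l, (m - b)%N = l.+1 by exists (m - b).-1; lia.
  have e' : lead_map b g = comp l.+1 false u.
    by rewrite -e /lead_pos /lead_part (ltnW h) el ltnNge (ltnW h).
  rewrite el; split.
    move=> cc p hc hr.
    have zc : comp cc p u = 0 by apply: z => //; lia.
    case: (ltngtP l.+1 cc) => h'.
    + rewrite comp_vT_lt ?zc ?lmap0 ?linear0 //; lia.
    + have [e1|ne] := eqVneq l cc.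
        rewrite e1 comp_vT_r; last lia.
        rewrite zc linear0 add0r z ?linear0 //; first lia.
        by move: hr; rewrite /rank; case: p {zc} => //; lia.
      by rewrite comp_vT_gt ?zc ?lmap0 ?linear0 //; lia.
    + rewrite h' comp_vT_l; last lia.
      rewrite zc linear0 add0r z ?linear0 //; first lia.
      by move: hr; rewrite /rank; case: p {zc} => //; lia.
  rewrite e' -el.
  have -> : lead_pos b.+1 = l by rewrite /lead_pos h; lia.
  have -> : lead_part b.+1 = false by rewrite /lead_part; lia.
  rewrite el comp_vT_r; last lia.
  by rewrite z ?linear0 ?add0r //; [lia|rewrite /rank; lia].
- have [l el] : exists l, (b - m)%N = l.+1 by exists (b - m).-1; lia.
  have e' : lead_map b g = comp l true u.
    rewrite -e; have -> : lead_pos b = l by rewrite /lead_pos; case: ifP; lia.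
    by have -> : lead_part b = true by rewrite /lead_part; lia.
  rewrite el; split.
    move=> cc p hc; rewrite /rank; case: p => hr; last lia.
    have zc : comp cc true u = 0 by apply: z => //; rewrite /rank; lia.
    by rewrite comp_vT_lt ?zc ?lmap0 ?linear0 //; lia.
  rewrite e'.
  have -> : lead_pos b.+1 = l.+1 by rewrite /lead_pos; case: ifP; lia.
  have -> : lead_part b.+1 = true by rewrite /lead_part; lia.
  rewrite comp_vT_l; last lia.
  by rewrite z ?linear0 ?add0r //; [lia|rewrite /rank; lia].
- rewrite h subnn; split.
    move=> cc p hc; rewrite /rank; case: p => hr; last lia.
    have zc : comp cc true u = 0 by apply: z => //; rewrite /rank; lia.
    rewrite comp_vTh //; case: cc hc hr zc => [|cc] hc hr zc; first lia.
    by rewrite zc lmap0 ?linear0 ?scaler0.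
  have -> : lead_pos m.+1 = 0%N by rewrite /lead_pos ltnn subnn.
  have -> : lead_part m.+1 = true by rewrite /lead_part ltnSn.
  rewrite comp_vTh //; move: e; rewrite /lead_pos /lead_part.
  rewrite (_ : (b <= m)%N); last lia.
  rewrite (_ : (m - b)%N = 0%N); last lia.
  rewrite (_ : (m < b)%N = false); last lia.
  by move=> ->; rewrite h.
Qed.

Lemma rank_lead cc p : (cc <= m)%N -> lead_pos (rank cc p) = cc /\ lead_part (rank cc p) = p.
Proof.
by move=> h; rewrite /lead_pos /lead_part /rank; case: p; case: ifP => ?; split; lia.
Qed.
Lemma lead_rank b : rank (lead_pos b) (lead_part b) = b.
Proof. by rewrite /lead_pos /lead_part /rank; case: (leqP b m) => ?; lia. Qed.
Lemma lead_pos_le b : (b <= (m.*2).+1)%N -> (lead_pos b <= m)%N.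
Proof. by rewrite /lead_pos; case: ifP => ? ?; lia. Qed.
Lemma rank_lt cc p : (cc <= m)%N -> (rank cc p < (m.*2).+2)%N.
Proof. by rewrite /rank; case: p; lia. Qed.

(** The component of highest rank is matched exactly by the bijective [lead_map]; subtracting that
    chain lowers the rank. *)
Lemma chain_decomposition_upto X B u : stable Q c X -> (B <= (m.*2).+2)%N -> allM X u ->
    (forall cc p, (cc <= m)%N -> (B <= rank cc p)%N -> comp cc p u = 0) ->
  exists2 g : nat -> L, (forall b, allc X (g b)) &
    u = \sum_(b < B) vchain b (sig (g b)).
Proof.
move=> sX; elim: B u => [|B IH] u hB hu z.
  exists (fun=> 0); first by move=> b; exact: (allc0 sX).
  by rewrite big_ord0; apply: compP => cc p hc; rewrite z ?linear0.
have [f hf ef] := good_surj (lead_map_good sX hB) (hu _ (lead_part B) (lead_pos_le hB)).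
have [z' e'] := chain_lead f hB.
have [|cc p hc hr|g hg eg] := IH (u - vchain B (sig f)) (ltnW hB).
- apply: (allM_D sX) => //; apply: (allM_N sX); apply: (allM_chain sX hB).
  exact: (allM_sig sX).
- rewrite linearB /=; move: hr; rewrite leq_eqVlt => /orP[/eqP er|hr].
    by have [] := rank_lead p hc; rewrite -er => <- <-; rewrite e' ef subrr.
  by rewrite z // z' // subrr.
exists (fun b => if b == B then f else g b); first by move=> b; case: eqP.
rewrite big_ord_recr /= eqxx -[LHS](subrK (vchain B (sig f))) eg; congr (_ + _).
by apply: eq_bigr => b _; rewrite ltn_eqF.
Qed.

Lemma chain_decomposition X u : stable Q c X -> allM X u ->
  exists2 g : nat -> L, (forall b, allc X (g b)) &
    u = \sum_(b < (m.*2).+2) vchain b (sig (g b)).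
Proof.
move=> sX hu; apply: (chain_decomposition_upto sX) => // cc p hc.
by have := rank_lt p hc; lia.
Qed.

Lemma stable_all n : stable Q c (fun _ : V n => True).
Proof. by split. Qed.

Lemma chain_sig0 b : vchain b (sig (0 : L)) = 0.
Proof.
have e : sig (0 : L) = 0 := linear0 (@sig k m).
by rewrite e; exact: linear0.
Qed.

(** Only the last summand reaches the highest rank, where injectivity of [lead_map] kills its
    coefficient. *)
Lemma chain_unique B0 B (g : nat -> L) : (B <= (m.*2).+2)%N ->
    (forall cc p, (cc <= m)%N -> (B0 <= rank cc p)%N ->
       comp cc p (\sum_(b < B) vchain b (sig (g b))) = 0) ->
  forall b, (B0 <= b < B)%N -> g b = 0.
Proof.
elim: B => [|B IH] hB z b hb; first lia.
have hle := lead_pos_le hB.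
have [le|lt] := leqP B0 B; last lia.
have [z1 e1] := chain_lead (g B) hB.
have gB : g B = 0.
  have := z _ (lead_part B) hle; rewrite lead_rank => /(_ le).
  rewrite big_ord_recr /= linearD linear_sum /= e1 big1 ?add0r.
    by move/(good_inj (lead_map_good (stable_all m) hB)).
  move=> i _; have [z2 _] := chain_lead (g i) (leq_trans (ltnW (ltn_ord i)) hB).
  by apply: z2 => //; rewrite lead_rank.
have [->|ne] := eqVneq b B; first exact: gB.
apply: (IH (ltnW hB)); last lia.
move=> cc p hc hr; have := z cc p hc hr.
by rewrite big_ord_recr /= gB chain_sig0 addr0.
Qed.
End Triangular.

(** * The action on normal forms *)

Section SigOps.
Variables (C : cartanDatum) (k : comPzRingType) (Q : klrScalars C k) (c : nat -> C).
Variable m : nat.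
Local Notation V p := (arr p -> Wt k p).
Local Notation L := (laurent (V m)).

Lemma sig_inj : injective (sig (k := k) (m := m)).
Proof.
move=> g h e; have := congr1 (comp m false) e.
by rewrite !comp_sig // eqxx.
Qed.

Lemma sigP (g : L) u : comp m false u = g ->
  (forall cc b, (cc <= m)%N -> (cc, b) != (m, false) -> comp cc b u = 0) -> u = sig g.
Proof.
move=> e z; apply: compP => cc b hc; rewrite comp_sig //.
case: ifP => [/andP[/eqP -> /negbTE ->] //|h]; apply: z => //.
by apply: contraFneq h => -[-> ->]; rewrite eqxx.
Qed.
Lemma comp_sig0 (g : L) cc b : (cc <= m)%N -> (cc, b) != (m, false) -> comp cc b (sig g) = 0.
Proof.
move=> hc ne; rewrite comp_sig //; case: ifP => // /andP[/eqP e1 /negbTE e2].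
by move: ne; rewrite e1 e2 eqxx.
Qed.

Lemma vX_sig l (g : L) : (0 < l <= m)%N -> vX l (sig g) = sig (lmap (vX l) g).
Proof.
move=> hl; apply: sigP => [|cc b hc ne]; rewrite comp_vX //; try lia.
  by rewrite ifT; [rewrite comp_sig ?eqxx|lia].
by rewrite comp_sig0 // !lmap0 ?linear0 // !if_same.
Qed.
Lemma vX_sig_top (g : L) : vX m.+1 (sig g) = sig (lshift 1 g).
Proof.
apply: sigP => [|cc b hc ne]; rewrite comp_vX //; try lia.
  by rewrite ltnn eqxx comp_sig ?eqxx.
by rewrite comp_sig0 // !lmap0 ?linear0 // !if_same.
Qed.
Lemma vTh_sig (g : L) : (0 < m)%N -> vTh (sig g) = sig (lmap (@vTh k m) g).
Proof.
move=> hm; apply: sigP => [|cc b hc ne]; rewrite comp_vTh //.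
  by rewrite gtn_eqF // scale1r comp_sig // eqxx.
case: eqP => [e|_]; last by rewrite comp_sig0 // lmap0 ?linear0 ?scaler0.
rewrite {}e in hc ne; case: b ne => // _; apply: comp_sig0 => //.
by apply/eqP => -[]; lia.
Qed.
Lemma vT_sig l (g : L) : (0 < l < m)%N -> vT Q c l (sig g) = sig (lmap (vT Q c l) g).
Proof.
move=> hl; apply: sigP => [|cc b hc ne].
  by rewrite comp_vT_lt ?comp_sig ?eqxx //; lia.
case: (ltngtP l cc) => h.
- by rewrite comp_vT_lt ?comp_sig0 ?lmap0 ?linear0 //; lia.
- have [e|ne'] := eqVneq l cc.+1.
    rewrite e comp_vT_r ?comp_sig0 ?linear0 ?addr0 //; try lia.
    by apply/eqP => -[]; lia.
  by rewrite comp_vT_gt ?comp_sig0 ?lmap0 ?linear0 //; lia.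
- rewrite h comp_vT_l ?comp_sig0 ?linear0 ?addr0 //; try lia.
  by apply/eqP => -[]; lia.
Qed.
Lemma vM_sig l j (g : L) : (0 < l <= m)%N -> vM c l j (sig g) = sig (lmap (vM c l j) g).
Proof.
have E cc b (u : V m.+1) : (cc <= m)%N -> (0 < l <= cc)%N ->
    comp cc b (vM c l j u) = lmap (vM c l j) (comp cc b u).
  move=> hc hl; apply: famP => w; rewrite unfam_comp /vM st_ins //; last lia.
  rewrite (_ : (l <= cc)%N); last lia.
  apply: lcoefP => n; rewrite lcoef_unfam lcoef_map; last by apply/funext => v; case: ifP.
  by case: ifP => _; rewrite ?linear0 -?unfam_comp ?lcoef_unfam //; case: b; rewrite linear0.
move=> hl; apply: sigP => [|cc b hc ne]; first by rewrite E ?comp_sig ?eqxx.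
apply: famP => w; rewrite unfam_comp /vM unfam0; case: ifP => _; last by case: b ne.
by rewrite -unfam_comp comp_sig0 // unfam0.
Qed.

(** A new strand is added at the right end with trivial coefficient x_m^0, which corresponds to the
    inclusion of the algebra on m strands. *)
Definition emb (u : V m) : V m.+1 := sig (lmon 0 u).
Fact emb_linear : linear emb.
Proof.
move=> a u v; rewrite /emb -linearP; congr sig; apply: lcoefP => n.
by rewrite lcoef_mon (linearP (lcoef n)) /= !lcoef_mon; case: ifP; rewrite ?scaler0 ?addr0.
Qed.
HB.instance Definition _ := GRing.isLinear.Build k (V m) (V m.+1) _ emb emb_linear.
Lemma emb_inj : injective emb.
Proof. by move=> u v /sig_inj/(congr1 (lcoef 0)); rewrite !lcoef_mon. Qed.
Lemma vX_emb l u : (0 < l <= m)%N -> vX l (emb u) = emb (vX l u).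
Proof. by move=> hl; rewrite vX_sig // lmap_mon ?linear0. Qed.
Lemma vT_emb l u : (0 < l < m)%N -> vT Q c l (emb u) = emb (vT Q c l u).
Proof. by move=> hl; rewrite vT_sig // lmap_mon ?linear0. Qed.
Lemma vM_emb l j u : (0 < l <= m)%N -> vM c l j (emb u) = emb (vM c l j u).
Proof. by move=> hl; rewrite vM_sig // lmap_mon ?linear0. Qed.
Lemma vTh_emb u : (0 < m)%N -> vTh (emb u) = emb (vTh u).
Proof. by move=> hl; rewrite vTh_sig // lmap_mon ?linear0. Qed.
Lemma vX_top_emb p u : iter p (vX m.+1) (emb u) = sig (lmon p%:Z u).
Proof.
elim: p => //= p ->; rewrite vX_sig_top lshift_mon; congr (sig (lmon _ _)); lia.
Qed.

End SigOps.

(** * Embedding m strands into n strands *)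

Section Lift.
Variables (C : cartanDatum) (k : comPzRingType) (Q : klrScalars C k) (c : nat -> C).
Variable n : nat.
Local Notation V p := (arr p -> Wt k p).

(** The level reached after n - m embeddings equals n only provably, so it is recorded in a
    dependent pair and transported by [at_n], which returns 0 if the levels differ. *)
Fixpoint up (d m : nat) (u : V m) : {p : nat & V p} :=
  if d is d'.+1 then up d' (emb u) else existT (fun p => V p) m u.
Definition at_n (t : {p : nat & V p}) : V n :=
  if tag t =P n is ReflectT e then eq_rect _ (fun p => V p) (tagged t) _ e else 0.
Definition lift_to m (u : V m) : V n := at_n (up (n - m) u).

Lemma lift_to_n (u : V n) : lift_to u = u.
Proof. by rewrite /lift_to subnn /at_n /=; case: eqP => // e; rewrite eq_axiomK. Qed.
Lemma lift_to_emb m (u : V m) : (m < n)%N -> lift_to u = lift_to (emb u).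
Proof. by move=> h; rewrite /lift_to -(subnSK h). Qed.

Lemma lift_rec (P : forall m, (V m -> V n) -> Prop) :
    (P n id) -> (forall m, (m < n)%N -> P m.+1 (@lift_to m.+1) -> P m (@lift_to m)) ->
  forall m, (m <= n)%N -> P m (@lift_to m).
Proof.
move=> P0 PS m; elim: {m}(n - m)%N {-2}m (erefl (n - m)%N) => [|d IH] m hd hm.
  have e : m = n by lia.
  rewrite e (_ : @lift_to n = id) //; apply/funext => u; exact: lift_to_n.
by apply: PS; [lia|apply: IH; lia].
Qed.

Fact lift_linear m : (m <= n)%N -> linear (@lift_to m).
Proof.
move: m; apply: (lift_rec (P := fun m f => linear f)) => [//|m h IH] a u v; by rewrite !(lift_to_emb _ h) linearP IH.
Qed.
Lemma lift_inj m : (m <= n)%N -> injective (@lift_to m).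
Proof.
move: m; apply: (lift_rec (P := fun m f => injective f)) => [//|m h IH] u v.
by rewrite !(lift_to_emb _ h) => /IH /emb_inj.
Qed.
Lemma lift_vX l m (u : V m) : (0 < l <= m)%N -> (m <= n)%N ->
  vX l (lift_to u) = lift_to (vX l u).
Proof.
move=> hl hm; move: m hm hl u.
apply: (lift_rec (P := fun m f => (0 < l <= m)%N -> forall u : V m, vX l (f u) = f (vX l u))).
  by [].
by move=> m h IH hl u; rewrite !(lift_to_emb _ h) IH ?vX_emb //; lia.
Qed.
Lemma lift_vT l m (u : V m) : (0 < l < m)%N -> (m <= n)%N ->
  vT Q c l (lift_to u) = lift_to (vT Q c l u).
Proof.
move=> hl hm; move: m hm hl u.
apply: (lift_rec (P := fun m f => (0 < l < m)%N -> forall u : V m,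
  vT Q c l (f u) = f (vT Q c l u))); first by [].
by move=> m h IH hl u; rewrite !(lift_to_emb _ h) IH ?vT_emb //; lia.
Qed.
Lemma lift_vM l j m (u : V m) : (0 < l <= m)%N -> (m <= n)%N ->
  vM c l j (lift_to u) = lift_to (vM c l j u).
Proof.
move=> hl hm; move: m hm hl u.
apply: (lift_rec (P := fun m f => (0 < l <= m)%N -> forall u : V m,
  vM c l j (f u) = f (vM c l j u))); first by [].
by move=> m h IH hl u; rewrite !(lift_to_emb _ h) IH ?vM_emb //; lia.
Qed.
Lemma lift_vTh m (u : V m) : (0 < m <= n)%N -> vTh (lift_to u) = lift_to (vTh u).
Proof.
move=> /andP[hl hm]; move: m hm hl u.
apply: (lift_rec (P := fun m f => (0 < m)%N -> forall u : V m, vTh (f u) = f (vTh u))).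
  by [].
by move=> m h IH hl u; rewrite !(lift_to_emb _ h) IH ?vTh_emb.
Qed.
Lemma lift_vs l m (u : V m) : (l < m <= n)%N ->
  vs Q c l (lift_to u) = lift_to (vs Q c l u).
Proof. by case: l => [|l] h /=; [apply: lift_vTh|apply: lift_vT]; lia. Qed.
End Lift.
Arguments lift_to [k] n [m] u _.

Section RhoOps.
Variables (C : cartanDatum) (k : comPzRingType) (Q : klrScalars C k).
Variables (n : nat) (c : nat -> C).
Local Notation V p := (arr p -> Wt k p).
Local Notation A := (Rb Q n).

Lemma rho_theta (u : V n) : (0 < n)%N -> rho c (theta Q n) u = vTh u.
Proof.
move=> n0; apply/funext => w; rewrite rho_sum vsumE (bigD1 (col c w)) //= [X in _ + X]big1 ?addr0.
  rewrite rho_sum vsumE (bigD1 (c (st w 1))) /=; last by rewrite colour_col n0 eqxx.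
  rewrite big1 ?addr0; last first.
    by move=> j; rewrite colour_col eq_sym => /andP[/andP[_ /eqP ->]]; rewrite eqxx.
  rewrite rhoM rho_om // rho_e /vO.
  have -> : take 1 (val w) = [:: st w 1].
    by rewrite /st; move: (size_arr w); case: (val w) => [|p r] /=; [lia|rewrite take0].
  rewrite /odd_sum big_seq1 /om_coef eqxx expr0 mul1r big_mkcond big_seq1 eqxx bact1.
  by rewrite vEE eqxx.
move=> i ne; rewrite rho_sum vsumE big1 // => j /colour_range hj.
by rewrite rhoM rho_om // rho_e /vO vEE eq_sym (negbTE ne) linear0.
Qed.

Lemma rho_s l (u : V n) : (l < n)%N -> rho c (s Q n l) u = vs Q c l u.
Proof. by case: l => [|l] h /=; [exact: rho_theta|exact: rho_tau]. Qed.

Lemma rho_colour l j (u : V n) : (0 < l <= n)%N ->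
  rho c (\sum_(i : n.-tuple C | colour i l j) rb_e Q i) u = vM c l j u.
Proof.
move=> hl; apply/funext => w; rewrite rho_sum vsumE /vM.
have [e|ne] := boolP (colour (col c w) l j).
  rewrite (bigD1 (col c w)) //= rho_e vEE eqxx big1 ?addr0.
    by move: e; rewrite colour_col hl /= => ->.
  by move=> i /andP[_ ne]; rewrite rho_e vEE eq_sym (negbTE ne).
rewrite big1 => [|i hi].
  by move: ne; rewrite colour_col hl /= => /negbTE ->.
by rewrite rho_e vEE; case: eqP => // e; rewrite e hi in ne.
Qed.
End RhoOps.

(** * Normal forms applied to the vacuum vector *)

Section Rep.
Variables (C : cartanDatum) (k : comPzRingType) (Q : klrScalars C k).
Variables (n : nat) (i : n.-tuple C) (c : nat -> C).
Hypothesis ci : forall p : 'I_n, c p = tnth i p.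
Local Notation V p := (arr p -> Wt k p).
Local Notation A := (Rb Q n).

(** The strands in increasing order with coefficient 1. The left ideal of e(i) acts faithfully on
    this one vector, by [normal_inj] and [normal_all]. *)
Definition vac : V n := lift_to n (fun _ : arr 0 => 1 : k^o).

Lemma vac_support (w : arr n) : val w <> iota 0 n -> vac w = 0.
Proof.
pose supp m (u : V m) := forall w : arr m, val w <> iota 0 m -> u w = 0.
have lift_supp : forall m, (m <= n)%N -> forall u : V m, supp m u -> supp n (lift_to n u).
  apply: (lift_rec (P := fun m f => forall u : V m, supp m u -> supp n (f u))) => //.
  move=> m h IH u hu; rewrite (lift_to_emb _ h); apply: IH => w' hw'.
  rewrite /emb /sig /glue /= andbF; case: eqP => [e|_]; last by rewrite !unfam0.
  congr pair; last by rewrite unfam0.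
  apply: lcoefP => d; rewrite lcoef_unfam lcoef_mon linear0; case: ifP => // _.
  rewrite hu // => er; case: hw'; rewrite -(ins_rest w') e.
  rewrite -[LHS]/(ins_seq m m (val (rest w'))) er /ins_seq.
  rewrite -[RHS]/(iota 0 m.+1) iotaS_rcons.
  by rewrite take_oversize ?drop_oversize ?size_iota // cats1.
apply: (lift_supp 0%N) => // w' hw'; case: hw'.
by have := size_arr w'; case: (val w').
Qed.

Lemma rho_e_vac : rho c (rb_e Q i) vac = vac.
Proof.
rewrite rho_e; apply/funext => w; rewrite vEE; case: eqP => // ne.
rewrite vac_support // => e; case: ne; apply: eq_from_tnth => p.
by rewrite tnth_mktuple e nth_iota // add0n ci.
Qed.

Definition rep m (z : A) (u : V m) := rho c z vac = lift_to n u.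
(** The vectors that come from the algebra, inside a module that also contains negative powers and
    infinite series. *)
Definition image m (u : V m) := exists2 z : A, normal i m z & rep z u.

Lemma step_expand (S : A -> Prop) m z :
    S 0 -> (forall y y', S y -> S y' -> S (y + y')) -> step m S z ->
  exists P (Z : nat -> nat -> A), (forall b p, S (Z b p)) /\
    z = \sum_(b < (m.*2).+2) \sum_(p < P) chain Q n m b * (rb_x Q n m.+1 ^+ p * Z b p).
Proof.
move=> S0 SD hz.
(* The expansion is claimed for all larger bounds, so that two expansions can be added. *)
suff [P [Z [h e]]] : exists P (Z : nat -> nat -> A), (forall b p, S (Z b p)) /\
    forall P', (P <= P')%N -> z = \sum_(b < (m.*2).+2) \sum_(p < P')
      chain Q n m b * (rb_x Q n m.+1 ^+ p * Z b p) by exists P, Z; split=> //; exact: e.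
elim: z / hz => [y [b [y' [hb [p [z [hz ->]]] ->]]]||y z _ [P [Z [h e]]] _ [P' [Z' [h' e']]]].
- exists p.+1, (fun b' p' => if (b' == b) && (p' == p) then z else 0).
  split=> [b' p'|P' hP']; first by case: ifP.
  rewrite (bigD1 (Ordinal hb)) //= (bigD1 (Ordinal hP')) //= !eqxx big1 ?addr0 => [|p' ne].
    rewrite big1 ?addr0 // => b' ne; rewrite big1 // => p' _.
    by rewrite -val_eqE in ne; rewrite (negbTE ne) !mulr0.
  by rewrite -val_eqE in ne; rewrite (negbTE ne) !mulr0.
- exists 0%N, (fun _ _ => 0); split=> // P' _.
  by rewrite big1 // => b _; rewrite big1 // => p _; rewrite !mulr0.
- exists (P + P')%N, (fun b p => Z b p + Z' b p); split=> [b p|P'' hP]; first exact: SD.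
  rewrite {1}(e P''); last lia.
  rewrite {1}(e' P''); last lia.
  rewrite -big_split; apply: eq_bigr => b _; rewrite -big_split; apply: eq_bigr => p _.
  by rewrite /= -mulrDr -mulrDr.
Qed.

Lemma normal_expand m z : normal i m.+1 z ->
  exists P (Z : nat -> nat -> A), (forall b p, normal i m (Z b p)) /\
    z = \sum_(b < (m.*2).+2) \sum_(p < P) chain Q n m b * (rb_x Q n m.+1 ^+ p * Z b p).
Proof.
apply: (@step_expand (normal i m)); first exact: normal_0.
by move=> y y'; exact: normal_D.
Qed.

Section Level.
Variable m : nat.
Hypothesis mn : (m <= n)%N.

Lemma rep_D z z' u u' : rep z u -> rep z' u' -> rep (m := m) (z + z') (u + u').
Proof.
rewrite /rep rhoD => -> ->; have := lift_linear mn 1 u u'.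
by rewrite !scale1r => ->.
Qed.
Lemma lift0 : lift_to n (0 : V m) = 0.
Proof. exact: linear_at0 (lift_linear mn). Qed.
Lemma rep_0 : rep 0 (0 : V m).
Proof. by rewrite /rep lift0 rho0. Qed.
Lemma rep_sum (J : Type) (r : seq J) (P : pred J) (Z : J -> A) (U : J -> V m) :
  (forall j, P j -> rep (Z j) (U j)) ->
  rep (\sum_(j <- r | P j) Z j) (\sum_(j <- r | P j) U j).
Proof.
by move=> h; apply: (big_ind2 (@rep m)) => //; [exact: rep_0|move=> *; exact: rep_D].
Qed.
Lemma rep_Z a z u : rep z u -> rep (m := m) (ascal a * z) (a *: u).
Proof.
rewrite /rep rhoM rho_ascal => ->; have := lift_linear mn a u 0.
by rewrite !addr0 lift0 addr0 => ->.
Qed.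
Lemma rep_inj z u u' : rep z u -> rep z u' -> u = u' :> V m.
Proof. by rewrite /rep => -> /(lift_inj mn). Qed.

Lemma image_stable : stable Q c (@image m).
Proof.
have [cp cs] := @normal_closed C k Q n i m; split.
- by exists 0; [exact: normal_0|exact: rep_0].
- move=> f g [y hy ry] [z hz rz]; exists (y + z); first exact: normal_D.
  exact: rep_D.
- move=> a f [y hy ry]; exists (ascal a * y); last exact: rep_Z.
  by apply: cp => //; exact: pol_ascal.
- move=> l f hl [y hy ry]; exists (rb_x Q n l * y).
    by apply: cp => //; apply: pol_x; lia.
  by rewrite /rep rhoM ry rho_x ?lift_vX //; lia.
- move=> l j f hl [y hy ry]; exists ((\sum_(i' : n.-tuple C | colour i' l j) rb_e Q i') * y).
    by apply: cp => //; apply: pol_sum => i' _; exact: pol_e.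
  by rewrite /rep rhoM ry rho_colour ?lift_vM //; lia.
- move=> l f hl [y hy ry]; exists (rb_tau Q n l * y).
    by case: l hl => // l hl; apply: (cs l.+1); lia || exact: hy.
  by rewrite /rep rhoM ry rho_tau ?lift_vT //; lia.
- move=> f [y hy ry]; have [m0|m0] := posnP m.
    exists 0; first exact: normal_0.
    rewrite (_ : vTh f = 0); first exact: rep_0.
    have z0 q p (x : Wt k q) : q = 0%N -> wZ p x = 0 by case: q x.
    by apply/funext => w; exact: z0.
  exists (s Q n 0 * y); first exact: cs.
  by rewrite /rep rhoM ry rho_s ?lift_vs //; lia.
Qed.
End Level.

(** Degrees are already bounded above, so excluding negative ones leaves polynomials in x_m. *)
Definition poly m (X : V m -> Prop) (g : laurent (V m)) :=
  allc X g /\ forall d : int, d < 0 -> lcoef d g = 0.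

Lemma rep_chain m b p z (u : V m) : (m < n)%N -> (b <= (m.*2).+1)%N -> rep z u ->
  rep (chain Q n m b * (rb_x Q n m.+1 ^+ p * z)) (vchain Q c b (sig (lmon p%:Z u))).
Proof.
move=> mn; elim: b => [|b IH] hb ru /=.
  rewrite mul1r /rep rhoM ru (lift_to_emb _ mn) -vX_top_emb.
  elim: p => [|p IH]; first by rewrite expr0 -(ascal1 (s := A)) rho_ascal scale1r.
  by rewrite exprS rhoM IH rho_x ?lift_vX //; lia.
have hk : (kap m b <= m)%N by rewrite /kap; case: ifP; lia.
rewrite /rep -mulrA rhoM (IH (ltnW hb) ru) rho_s ?lift_vs //; lia.
Qed.

Lemma lcoef_monomials m P (U : nat -> V m) d :
  lcoef d (\sum_(p < P) lmon p%:Z (U p)) = if (0 <= d) && (d < P%:Z) then U `|d|%N else 0.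
Proof.
rewrite linear_sum /=; case: ifP => h.
  have lt : (`|d| < P)%N by lia.
  rewrite (bigD1 (Ordinal lt)) //= lcoef_mon ifT; last by lia.
  rewrite big1 ?addr0 // => p; rewrite -val_eqE /= lcoef_mon => ne.
  by rewrite ifF //; lia.
rewrite big1 // => p _; rewrite lcoef_mon ifF //.
by have := ltn_ord p; lia.
Qed.

Section LevelStep.
Variables (m : nat) (mn : (m < n)%N).

Lemma rep_expansion P (Z : nat -> nat -> A) (U : nat -> nat -> V m) :
    (forall b p, rep (Z b p) (U b p)) ->
  rep (\sum_(b < (m.*2).+2) \sum_(p < P) chain Q n m b * (rb_x Q n m.+1 ^+ p * Z b p))
    (\sum_(b < (m.*2).+2) vchain Q c b (sig (\sum_(p < P) lmon p%:Z (U b p)))).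
Proof.
move=> h; apply: (rep_sum mn) => b _; rewrite !linear_sum; apply: (rep_sum mn) => p _.
by apply: rep_chain => //; have := ltn_ord b; lia.
Qed.

End LevelStep.

Lemma rep_choice m (Z : nat -> nat -> A) :
    (forall z, normal i m z -> exists u : V m, rep z u) -> (forall b p, normal i m (Z b p)) ->
  exists U : nat -> nat -> V m, forall b p, rep (Z b p) (U b p).
Proof.
move=> h hZ.
have ex (bp : nat * nat) : exists u : V m, rep (Z bp.1 bp.2) u by apply: h.
have [U hU] := choice ex; exists (fun b p => U (b, p)) => b p; exact: (hU (b, p)).
Qed.

Lemma rep_exists m z : (m <= n)%N -> normal i m z -> exists u : V m, rep z u.
Proof.
elim: m z => [|m IH] z hm.
  move=> [a ->]; exists (a *: ((fun=> 1 : k^o) : V 0)).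
  by apply: rep_Z => //; rewrite /rep rho_e_vac.
move=> /normal_expand[P [Z [hZ ->]]].
have [U hU] := rep_choice (fun z => IH z (ltnW hm)) hZ.
exists (\sum_(b < (m.*2).+2) vchain Q c b (sig (\sum_(p < P) lmon p%:Z (U b p)))).
exact: rep_expansion.
Qed.

Section ImageStep.
Variables (m : nat) (mn : (m < n)%N).

Lemma image_expand (u : V m.+1) : image u -> exists2 g : nat -> laurent (V m),
  (forall b, poly (@image m) (g b)) & u = \sum_(b < (m.*2).+2) vchain Q c b (sig (g b)).
Proof.
move=> [z hz ru].
have [P [Z [hZ ez]]] := normal_expand hz.
have [U hU] := rep_choice (fun z => @rep_exists m z (ltnW mn)) hZ.
exists (fun b => \sum_(p < P) lmon p%:Z (U b p)).
  move=> b; split=> [d|d hd]; rewrite lcoef_monomials; last by rewrite ifF //; lia.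
  case: ifP => _; last exact: (stable0 (image_stable (ltnW mn))).
  by exists (Z b `|d|%N).
by apply: (rep_inj mn ru); rewrite ez; apply: rep_expansion.
Qed.

Lemma image_chain (g : nat -> laurent (V m)) : (forall b, poly (@image m) (g b)) ->
  image (\sum_(b < (m.*2).+2) vchain Q c b (sig (g b))).
Proof.
move=> hg; have sI := image_stable mn.
apply: (big_ind (@image m.+1)); [exact: (stable0 sI)|exact: (stableD sI)|move=> b _].
have [hX hn] := hg b; have [M hM] := lcoef_bound (g b).
have eg : g b = \sum_(p < `|M|.+1) lmon p%:Z (lcoef p%:Z (g b)).
  by apply: laurent_poly => d [/hn|hd] //; apply: hM; lia.
rewrite eg !linear_sum.
apply: (big_ind (@image m.+1)); [exact: (stable0 sI)|exact: (stableD sI)|move=> p _].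
have [z hz rz] := hX p%:Z; exists (chain Q n m b * (rb_x Q n m.+1 ^+ p * z)).
  by apply: span_in; exists b, (rb_x Q n m.+1 ^+ p * z); split=> //; exists p, z.
by apply: rep_chain => //; have := ltn_ord b; lia.
Qed.
End ImageStep.

(** [chain_unique] separates the chains and comparison of degrees separates the powers of the dot,
    so every coefficient of the normal form kills [vac] and is 0 by induction. *)
Lemma normal_inj m (z : A) : (m <= n)%N -> normal i m z -> rho c z vac = 0 -> z = 0.
Proof.
elim: m z => [|m IH] z hm.
  move=> [a ->]; rewrite rhoM rho_ascal rho_e_vac.
  rewrite /vac; have := lift_linear hm a (fun=> 1 : k^o) 0; rewrite addr0 (lift0 hm) addr0.
  move=> <-; rewrite -(lift0 hm) => /(lift_inj hm) /(congr1 (fun u => u (exist _ [::] isT))).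
  by rewrite vZE => e; rewrite -[a]mulr1 [a * 1]e ascal0 mul0r.
move=> /normal_expand[P [Z [hZ ->]]].
have [U hU] := rep_choice (fun z => @rep_exists m z (ltnW hm)) hZ.
rewrite (rep_expansion hm P hU) -(lift0 hm) => /(lift_inj hm) e0.
rewrite big1 // => b _; rewrite big1 // => p _.
suff -> : Z b p = 0 by rewrite !mulr0.
apply: IH (ltnW hm) (hZ b p) _; rewrite hU.
suff -> : U b p = 0 by exact: (lift0 (ltnW hm)).
have g0 : \sum_(p < P) lmon p%:Z (U b p) = 0.
  apply: (@chain_unique C k Q c m 0 _ (fun b => \sum_(p < P) lmon p%:Z (U b p))
    (leqnn (m.*2).+2) _ b) => [cc q hc _|]; last by rewrite ltn_ord.
  by rewrite [X in comp _ _ X]e0 linear0.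
have := lcoef_monomials P (U b) p%:Z.
by rewrite g0 linear0 ifT //; have := ltn_ord p; lia.
Qed.
End Rep.

(** * Exactness *)

Section Differential.
Variables (C : cartanDatum) (k : comPzRingType) (Q : klrScalars C k) (c : nat -> C).
Variables (If : {set C}) (N : C -> nat).
Local Notation V p := (arr p -> Wt k p).

Definition vd n (u : V n) : V n := fun w => wd If N c (u w).
Fact vd_linear n : linear (@vd n).
Proof. by move=> a u v; apply/funext => w; rewrite /vd vDE vZE linearP. Qed.
HB.instance Definition _ n := GRing.isLinear.Build k (V n) (V n) _ (@vd n) (@vd_linear n).

Lemma vd_vX n l (u : V n) : vd (vX l u) = vX l (vd u).
Proof. by apply/funext => w; rewrite /vd /vX wdX. Qed.
Lemma vd_vT n l (u : V n) : vd (vT Q c l u) = vT Q c l (vd u).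
Proof. by apply/funext => w; rewrite /vd /vT linearD /= !bact_wd. Qed.

(** The operator of d_N(theta), as [rho_dN_theta] confirms. *)
Definition vdel n (u : V n) : V n := fun w => wtopX If N c (st w 1) (u w).
Lemma vd_vTh n (u : V n) : (0 < n)%N -> vd (vTh u) = vdel u - vTh (vd u).
Proof.
move=> n0; apply/funext => w; rewrite -[RHS]/(vdel u w - vTh (vd u) w) /vdel /vd /vTh.
by rewrite -wdZ ?addrK // st_lt.
Qed.

Definition vwF n (u : V n) := forall w, wF If c (u w).
Lemma vwF_stable n : stable Q c (@vwF n).
Proof.
have F0 p q x : (p < n)%N -> (q < n)%N -> p != q ->
    wF If c x -> wF If c (bact (ta Q c n p q) x).
  move=> lp lq ne hx; rewrite /ta; case: ifP => _; last by rewrite bact0; exact: wF0.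
  by rewrite bactM bact_kS; apply: wFZ; rewrite bact_kD //; apply: wFD_inv.
split.
- by move=> w; exact: wF0.
- by move=> f g hf hg w; apply: wFD; [exact: hf|exact: hg].
- by move=> a f hf w; apply: wFZ; exact: hf.
- by move=> l f hl hf w; apply: wFX; exact: hf.
- by move=> l j f hl hf w; rewrite /vM; case: ifP => _; [exact: hf|exact: wF0].
- move=> l f hl hf w; rewrite /vT.
  have lp : (st w l < n)%N by apply: st_lt; lia.
  have lq : (st w l.+1 < n)%N by apply: st_lt; lia.
  have ne : st w l != st w l.+1 by apply: st_neq; lia.
  apply: wFD; first by apply: F0 => //; exact: hf.
  rewrite /tb; case: ifP => _.
    by rewrite bactN; apply: wFN; apply: F0 => //; exact: hf.
  case: ifP => _; last by rewrite bact1; exact: hf.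
  have hX p e x : wF If c x -> wF If c (bact (kX k n p ^+ e) x).
    move=> hx; elim: e => [|e IH]; first by rewrite expr0 bact1.
    by rewrite exprS bactM bact_kX; apply: wFX.
  rewrite bact_sum; apply: wF_sum => t _; rewrite bact_sum; apply: wF_sum => v _.
  by rewrite !bactM bact_kS; apply: wFZ; apply: (hX); apply: hX; exact: hf.
- by move=> f hf w; apply: wFZp; exact: hf.
Qed.

Section Level.
Variable m : nat.
Local Notation L := (laurent (V m)).

Lemma unfam_wtop (g : L) w : unfam (wtop If N c m g) w = wtop If N c m (unfam g w).
Proof.
rewrite /wtop; case: ifP => _; last by rewrite unfam0.
by rewrite unfamZ unfam_shift.
Qed.
Lemma unfam_vd (g : L) w : unfam (lmap (@vd m) g) w = lmap (wd If N c (m := m)) (unfam g w).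
Proof. by rewrite (@unfam_lmap _ _ _ (wd If N c (m := m))) ?linear0. Qed.

Lemma comp_vd cc b (u : V m.+1) : comp cc b (vd u) =
  if b then - lmap (@vd m) (comp cc true u)
  else lmap (@vd m) (comp cc false u) + wtop If N c m (comp cc true u).
Proof.
apply: famP => w; rewrite unfam_comp; case: b.
  by rewrite unfamN unfam_vd unfam_comp.
by rewrite unfamD unfam_wtop unfam_vd !unfam_comp.
Qed.

Lemma vd_sig (g : L) : vd (sig g) = sig (lmap (@vd m) g).
Proof.
apply: sigP => [|cc b hc ne]; rewrite comp_vd.
  rewrite comp_sig // eqxx comp_sig0 ?linear0 ?addr0 //.
  by apply/eqP => -[].
case: b ne => ne; first by rewrite comp_sig0 // lmap0 ?linear0 ?oppr0.
by rewrite !comp_sig0 // ?lmap0 ?linear0 ?addr0 //; apply/eqP => -[].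
Qed.

(** A substitute for [vdel] when the leftmost strand has the colour of strand m. Being a fixed
    multiple of a power of the first dot for all arrangements, it visibly preserves subspaces stable
    under dots. *)
Definition vdelm (u : V m.+1) : V m.+1 :=
  if c m \in If then (-1) ^+ N (c m) *: iter (N (c m)) (vX 1) u else 0.
Fact vdelm_linear : linear vdelm.
Proof.
move=> a u v; rewrite /vdelm; case: ifP => _; last by rewrite scaler0 addr0.
have -> : iter (N (c m)) (vX 1) (a *: u + v) =
    a *: iter (N (c m)) (vX 1) u + iter (N (c m)) (vX 1) v.
  by elim: (N _) => //= e ->; rewrite linearP.
by rewrite scalerDr !scalerA mulrC.
Qed.
HB.instance Definition _ := GRing.isLinear.Build k (V m.+1) (V m.+1) _ vdelm vdelm_linear.

Definition coloured l (u : V m.+1) := forall w, c (st w l) != c m -> u w = 0.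
Lemma vdel_coloured u : coloured 1 u -> vdel u = vdelm u.
Proof.
move=> h; apply/funext => w; rewrite /vdel /wtopX /vdelm.
have iterE e : iter e (vX 1) u w = iter e (wX (st w 1)) (u w).
  by elim: e => //= e <-.
have [e|ne] := eqVneq (c (st w 1)) (c m).
  by rewrite e; case: ifP => _ //; rewrite vZE iterE.
rewrite h // iter_linear0 scaler0 if_same; case: ifP => _ //.
by rewrite vZE iterE h // iter_linear0 scaler0.
Qed.
Lemma coloured_T l u : (0 < l < m.+1)%N -> coloured l.+1 u -> coloured l (vT Q c l u).
Proof.
move=> hl h w ne; rewrite /vT (h (arr_swp l w)) ?st_swp_r // linear0 addr0.
rewrite /ta; case: eqP => [e|_]; last by rewrite bact0.
by rewrite h ?linear0 // -e.
Qed.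
Lemma coloured_sig g : coloured m.+1 (sig g).
Proof.
move=> w ne; rewrite /sig /glue andbF; case: eqP => [e|_].
  move: ne; rewrite -(ins_rest w) st_ins ?pos_le // e ltnn eqxx.
  by rewrite eqxx.
by rewrite !unfam0.
Qed.
(** Either strand m moves with the chain, or a divided difference leaves it behind, but that happens
    only when the two crossing strands have equal colours. *)
Lemma coloured_chain b g : (b <= m)%N -> coloured (m.+1 - b) (vchain Q c b (sig g)).
Proof.
elim: b => [|b IH] hb; first exact: coloured_sig.
have [l el] : exists l, (m - b)%N = l.+1 by exists (m - b).-1; lia.
rewrite /= /kap (ltnW hb) el /= (_ : (m.+1 - b.+1)%N = l.+1); last lia.
apply: coloured_T; first lia.
by rewrite (_ : l.+2 = (m.+1 - b)%N); [apply: IH; lia|lia].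
Qed.

(* [vchain] with the factor theta replaced by its differential. *)
Fixpoint echain b (u : V m.+1) : V m.+1 :=
  if b is b'.+1 then
    if b' == m then vdelm (vchain Q c b' u) else vs Q c (kap m b') (echain b' u)
  else 0.
Fact echain_linear b : linear (echain b).
Proof.
elim: b => [|b IH] a u v /=; first by rewrite scaler0 addr0.
by case: eqP => _; [rewrite !linearP|rewrite IH linearP].
Qed.
HB.instance Definition _ b := GRing.isLinear.Build k (V m.+1) (V m.+1) _
  (echain b) (echain_linear b).
Lemma echain_low b u : (b <= m)%N -> echain b u = 0.
Proof.
elim: b => [|b IH] //= hb; rewrite ltn_eqF // IH ?linear0 //; lia.
Qed.

Lemma kap_pos b : (b < (m.*2).+1)%N -> b != m -> exists2 l, kap m b = l.+1 & (l < m)%N.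
Proof.
move=> hb ne; exists (kap m b).-1; rewrite /kap; case: ifP; lia.
Qed.

Lemma vd_vdelm u : vd (vdelm u) = vdelm (vd u).
Proof.
rewrite /vdelm; case: ifP => _; last by rewrite linear0.
rewrite linearZ /=; congr (_ *: _); elim: (N _) => //= e <-; exact: vd_vX.
Qed.

(** The Leibniz rule: crossings are closed of degree 0, and theta occurs once, exactly when b > m,
    which explains the sign. *)
Lemma vd_chain b g : (b <= (m.*2).+1)%N -> vd (vchain Q c b (sig g)) =
  echain b (sig g) + (-1) ^+ (m < b)%N *: vchain Q c b (sig (lmap (@vd m) g)).
Proof.
elim: b => [|b IH] hb; first by rewrite /= add0r scale1r vd_sig.
have {}IH := IH (ltnW hb); rewrite [vchain _ _ _]/=; case: (eqVneq b m) => [e|ne].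
  have -> : kap m b = 0%N by rewrite e /kap leqnn subnn.
  rewrite [vs _ _ _ _]/= vd_vTh // IH vdel_coloured; last first.
    by have := coloured_chain g (eq_leq e); rewrite e subSnn.
  by rewrite /= e eqxx ltnn ltnSn echain_low // add0r scale1r scaleN1r.
have [l el hl] := kap_pos hb ne.
rewrite /= (negbTE ne) el /= vd_vT IH linearD linearZ /=; congr (_ + _ *: _).
by congr (_ ^+ _); lia.
Qed.

Lemma vd_echain b g : (b <= (m.*2).+1)%N ->
  vd (echain b (sig g)) = echain b (sig (lmap (@vd m) g)).
Proof.
elim: b => [|b IH] hb; first by rewrite /= linear0.
have {}IH := IH (ltnW hb); rewrite /=; case: eqP => [e|/eqP ne].
  rewrite vd_vdelm vd_chain; last lia.
  by rewrite e echain_low // add0r ltnn scale1r.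
have [l el hl] := kap_pos hb ne.
by rewrite el /= vd_vT IH.
Qed.

Definition even_part (u : V m.+1) := forall cc, (cc <= m)%N -> comp cc true u = 0.
Lemma even_T l u : (0 < l <= m)%N -> even_part u -> even_part (vT Q c l u).
Proof.
move=> hl hu cc hc; case: (ltngtP l cc) => h.
- by rewrite comp_vT_lt ?hu ?lmap0 ?linear0 //; lia.
- have [e|ne] := eqVneq l cc.+1.
    by rewrite e comp_vT_r ?hu ?linear0 ?addr0 //; lia.
  by rewrite comp_vT_gt ?hu ?lmap0 ?linear0 //; lia.
- by rewrite h comp_vT_l ?hu ?linear0 ?addr0 //; lia.
Qed.
Lemma even_X u : even_part u -> even_part (vX 1 u).
Proof. by move=> hu cc hc; rewrite comp_vX // hu // !lmap0 ?linear0 // !if_same. Qed.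
(** Theta is the only letter that produces zeta_m and it has been replaced by its differential;
    crossings and dots preserve parity in zeta_m. *)
Lemma even_echain b g : (b <= (m.*2).+1)%N -> even_part (echain b (sig g)).
Proof.
elim: b => [|b IH] hb; first by move=> cc hc /=; rewrite linear0.
have {}IH := IH (ltnW hb); rewrite /=; case: eqP => [e|/eqP ne].
  have h : even_part (vchain Q c b (sig g)).
    by move=> cc hc; apply: (chain_lead _ _ g _).1; rewrite /rank ?e //; lia.
  rewrite /vdelm; case: ifP => _; last by move=> cc hc; rewrite linear0.
  have hd d : even_part (iter d (vX 1) (vchain Q c b (sig g))).
    by elim: d => //= d; exact: even_X.
  by move=> cc hc; rewrite linearZ /= hd ?scaler0.
have [l el hl] := kap_pos hb ne.
by rewrite el /=; apply: even_T.
Qed.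
Lemma allM_echain X b g : stable Q c X -> (b <= (m.*2).+1)%N -> allc X g ->
  allM X (echain b (sig g)).
Proof.
move=> sX; elim: b => [|b IH] hb hg; first by move=> cc p hc; rewrite linear0; exact: (allc0 sX).
rewrite /=; case: eqP => [e|/eqP ne].
  rewrite /vdelm; case: ifP => _; last by move=> cc p hc; rewrite linear0; exact: (allc0 sX).
  apply: (allM_Z sX); elim: (N _) => [|d IHd] /=; last exact: (allM_X sX).
  by apply: (allM_chain sX (ltnW hb)); exact: (allM_sig sX).
have [l el hl] := kap_pos hb ne.
by rewrite el /=; apply: (allM_T sX) => //; exact: IH (ltnW hb) hg.
Qed.

End Level.
End Differential.

(** * Consequences of uniqueness *)

Section Decompositions.
Variables (C : cartanDatum) (k : comPzRingType) (Q : klrScalars C k) (c : nat -> C) (m : nat).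
Local Notation V p := (arr p -> Wt k p).
Local Notation chains g := (\sum_(b < (m.*2).+2) vchain Q c b (sig (g b))).

Lemma chain_sig_add b (g h : laurent (V m)) a :
  vchain Q c b (sig (g + a *: h)) = vchain Q c b (sig g) + a *: vchain Q c b (sig h).
Proof.
by rewrite addrC (linearP (@sig k m)) (linearP (vchain Q c b)) addrC.
Qed.

Lemma chain_sigZ b (g : laurent (V m)) a :
  a *: vchain Q c b (sig g) = vchain Q c b (sig (a *: g)).
Proof. by rewrite -[a *: g]add0r chain_sig_add chain_sig0 add0r. Qed.

Lemma chains_eq (g h : nat -> laurent (V m)) : chains g = chains h ->
  forall b, (b < (m.*2).+2)%N -> g b = h b.
Proof.
move=> e b hb; apply/eqP; rewrite -subr_eq0; apply/eqP.
apply: (@chain_unique C k Q c m 0 _ (fun b => g b - h b) (leqnn (m.*2).+2) _ b) => //.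
move=> cc q hc _; rewrite [X in comp _ _ X](_ : _ = 0) ?linear0 //.
transitivity (chains g - chains h); last by rewrite e subrr.
by rewrite -sumrB; apply: eq_bigr => b' _; rewrite -!linearB.
Qed.

(** Uniqueness forces the decompositions for X and for Y to coincide, so each coefficient satisfies
    both conditions. *)
Lemma chain_decomposition2 X Y (u : V m.+1) :
    stable Q c X -> stable Q c Y -> allM X u -> allM Y u ->
  exists g : nat -> laurent (V m), [/\ forall b, allc X (g b),
    forall b, (b < (m.*2).+2)%N -> allc Y (g b) & u = chains g].
Proof.
move=> sX sY /(chain_decomposition sX)[g hg eg] /(chain_decomposition sY)[h hh eh].
exists g; split=> // b hb.
by rewrite (@chains_eq g h) // -eg.
Qed.

(** The odd components are those of rank above m, so only chains without theta occur. *)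
Lemma even_decomposition X (u : V m.+1) : stable Q c X -> allM X u -> even_part u ->
  exists g : nat -> laurent (V m), [/\ forall b, allc X (g b),
    forall b, (m < b)%N -> g b = 0 & u = chains g].
Proof.
move=> sX hX hu.
have [||g hg eg] := @chain_decomposition_upto C k Q c m X m.+1 u sX _ hX; first lia.
  by move=> cc [] hc; [rewrite hu|rewrite /rank; lia].
exists (fun b => if (b <= m)%N then g b else 0); split.
- by move=> b; case: ifP => _ //; exact: (allc0 sX).
- by move=> b; case: leqP.
- rewrite eg (big_ord_widen (m.*2).+2 (fun b => vchain Q c b (sig (g b)))); last lia.
  rewrite big_mkcond; apply: eq_bigr => b _; rewrite ltnS.
  by case: ifP => // _; rewrite chain_sig0.
Qed.
End Decompositions.

(** * Cycles in the ideal are boundaries *)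

Section Exactness.
Variables (C : cartanDatum) (k : comPzRingType) (Q : klrScalars C k).
Variables (n : nat) (i : n.-tuple C) (c : nat -> C).
Hypothesis ci : forall p : 'I_n, c p = tnth i p.
Variables (If : {set C}) (N : C -> nat).
Local Notation V p := (arr p -> Wt k p).
Local Notation image m := (@image C k Q n i c m).
Local Notation vd m := (@vd C k c If N m).
Local Notation vwF m := (@vwF C k c If m).

(** Primitives are chosen degree by degree, and 0 is taken wherever g vanishes; this keeps degrees
    bounded above and creates no new negative powers. *)
Lemma exact_coefs m (g : laurent (V m)) :
    (forall u, image m u -> vwF m u -> vd m u = 0 -> exists2 u', image m u' & u = vd m u') ->
    (m <= n)%N -> allc (image m) g -> allc (vwF m) g -> lmap (vd m) g = 0 ->
  exists g' : laurent (V m), [/\ allc (image m) g', lmap (vd m) g' = g &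
    forall d, lcoef d g = 0 -> lcoef d g' = 0].
Proof.
move=> EX mn h1 h2 h3; have sI := @image_stable C k Q n i c m mn.
have ex d : exists u', [/\ image m u', lcoef d g = vd m u' & lcoef d g = 0 -> u' = 0].
  have [e|ne] := pselect (lcoef d g = 0).
    by exists 0; rewrite e linear0; split=> //; exact: (stable0 sI).
  have [||u' hu e] := EX (lcoef d g) (h1 d); [exact: h2| |by exists u'].
  by rewrite -(lcoef_map (phi := vd m)) ?h3 ?linear0.
have [U hU] := choice ex; have [M hM] := lcoef_bound g.
have [|g' hg'] := @laurent_build k (V m) U M.
  by move=> d hd; have [_ _ ->] := hU d; rewrite ?hM.
exists g'; split.
- by move=> d; rewrite hg'; have [] := hU d.
- by apply: lcoefP => d; rewrite lcoef_map ?linear0 // hg'; have [_ <-] := hU d.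
- by move=> d; rewrite hg'; have [_ _ ] := hU d.
Qed.

Lemma vd_chain_zero m b a : echain Q c If N b (sig (0 : laurent (V m))) +
  a *: vchain Q c b (sig (lmap (vd m) 0)) = vchain Q c b (sig (lmap (vd m) 0)).
Proof.
have e1 : lmap (vd m) 0 = 0 := lmap0 (linear0 (vd m)).
have e2 : sig (0 : laurent (V m)) = 0 := linear0 (@sig k m).
have e3 : echain Q c If N b (0 : V m.+1) = 0 := linear0 (echain Q c If N b).
by rewrite e1 chain_sig0 scaler0 addr0 e2 e3.
Qed.

Section ImageOps.
Variables (m : nat) (mn : (m < n)%N).
Let sI := @image_stable C k Q n i c m.+1 mn.

Lemma image_sig g : poly (image m) g -> image m.+1 (sig g).
Proof.
move=> hg; have z0 : poly (image m) 0.
  split=> [d|d _]; rewrite linear0 //.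
  exact: (stable0 (@image_stable C k Q n i c m (ltnW mn))).
have := @image_chain C k Q n i c m mn (fun b => if b is 0 then g else 0).
rewrite big_ord_recl big1 /= ?addr0; first by apply; case.
by move=> b _; rewrite !linear0.
Qed.
Lemma image_vs l u : (l <= m)%N -> image m.+1 u -> image m.+1 (vs Q c l u).
Proof.
case: l => [|l] hl /=; first exact: (stable_Th sI).
by apply: (stable_T sI); lia.
Qed.
Lemma image_vchain b g : (b <= (m.*2).+1)%N -> poly (image m) g ->
  image m.+1 (vchain Q c b (sig g)).
Proof.
elim: b => [|b IH] hb hg; first exact: image_sig.
by apply: image_vs; [rewrite /kap; case: ifP; lia|apply: IH => //; lia].
Qed.
Lemma image_echain b g : (b <= (m.*2).+1)%N -> poly (image m) g ->
  image m.+1 (echain Q c If N b (sig g)).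
Proof.
elim: b => [|b IH] hb hg /=; first exact: (stable0 sI).
case: eqP => [e|ne]; last first.
  by apply: image_vs; [rewrite /kap; case: ifP; lia|apply: IH => //; lia].
rewrite /vdelm; case: ifP => _; last exact: (stable0 sI).
apply: (stableZ sI); elim: (N _) => [|d IHd] /=; last exact: (stable_x sI).
by apply: image_vchain => //; lia.
Qed.

Lemma vd_chains (g : nat -> laurent (V m)) B : (B <= (m.*2).+2)%N ->
  vd m.+1 (\sum_(b < B) vchain Q c b (sig (g b))) =
  \sum_(b < B) (echain Q c If N b (sig (g b))
    + (-1) ^+ (m < b)%N *: vchain Q c b (sig (lmap (vd m) (g b)))).
Proof.
move=> hB; rewrite linear_sum /=; apply: eq_bigr => b _; apply: vd_chain.
by have := ltn_ord b; lia.
Qed.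
End ImageOps.

Lemma image_vd m u : (m <= n)%N -> image m u -> image m (vd m u).
Proof.
elim: m u => [|m IH] u mn hu.
  rewrite (_ : vd 0 u = 0); last by apply/funext.
  exact: (stable0 (@image_stable C k Q n i c 0 mn)).
have sI := @image_stable C k Q n i c m.+1 mn.
have [g hg ->] := image_expand ci mn hu; rewrite vd_chains //.
apply: (big_ind (image m.+1)); [exact: (stable0 sI)|exact: (stableD sI)|move=> b _].
have hb : (b <= (m.*2).+1)%N by have := ltn_ord b; lia.
apply: (stableD sI); first exact: image_echain.
apply: (stableZ sI); apply: image_vchain => //; have [h1 h2] := hg b.
split=> [d|d hd]; rewrite lcoef_map ?linear0 //; last by rewrite h2 ?linear0.
by apply: IH; [lia|exact: h1].
Qed.

Lemma image_allM m u : (m < n)%N -> image m.+1 u -> allM (image m) u.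
Proof.
move=> mn hu; have [g hg ->] := image_expand ci mn hu.
have sI := @image_stable C k Q n i c m (ltnW mn).
apply: (big_ind (allM (image m))) => [cc p hc||b _].
- by rewrite linear0; exact: (allc0 sI).
- exact: (allM_D sI).
- by apply: (allM_chain sI); [have := ltn_ord b; lia|apply: (allM_sig sI); have [] := hg b].
Qed.

Lemma vwF_comp m (u : V m.+1) cc b : vwF m.+1 u -> ~~ b || (c m \notin If) ->
  allc (vwF m) (comp cc b u).
Proof.
move=> hu hb d w; rewrite -lcoef_unfam unfam_comp.
have [h1 h2] := hu (ins cc w); case: b hb => /= hb; last exact: h1.
by case: h2 => [e|h2]; [rewrite e in hb|exact: h2].
Qed.

Lemma echain_notin m b (u : V m.+1) : c m \notin If -> echain Q c If N b u = 0.
Proof.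
move=> /negbTE e; elim: b => [|b IH] //=; rewrite /vdelm e IH linear0.
by case: eqP.
Qed.

(** In the base case there are no odd variables and [vwF] forces u = 0. *)
Lemma image_exact m u : (m <= n)%N -> image m u -> vwF m u -> vd m u = 0 ->
  exists2 u', image m u' & u = vd m u'.
Proof.
elim: m u => [|m IH] u mn hu hF hd.
  exists 0; first exact: (stable0 (@image_stable C k Q n i c 0 mn)).
  by rewrite linear0; apply/funext => w; exact: hF.
have sI := @image_stable C k Q n i c m.+1 mn.
have sI' := @image_stable C k Q n i c m (ltnW mn).
have sF := @vwF_stable C k Q c If m.
have IH' := fun v => IH v (ltnW mn).
have hM := image_allM mn hu.
(* If the colour of strand m is not in I_f, theta is closed along the chain, so the differential
   acts on the coefficients separately and induction applies to each of them. *)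
have [cm|cm] := boolP (c m \in If); last first.
  have [g hg eg] := image_expand ci mn hu.
  have hMF : allM (vwF m) u by move=> cc b hc; apply: vwF_comp; rewrite ?cm ?orbT.
  have [h hh eh] := chain_decomposition sF hMF.
  have egh : forall b, (b < (m.*2).+2)%N -> g b = h b by apply: (@chains_eq C k Q c m); rewrite -eg -eh.
  have dg b : (b < (m.*2).+2)%N -> lmap (vd m) (g b) = 0.
    move=> hb; pose gd b := (-1) ^+ (m < b)%N *: lmap (vd m) (g b).
    suff e0 : gd b = 0.
      have := congr1 (fun x => (-1) ^+ (m < b)%N *: x) e0.
      by rewrite /gd scalerA -signr_addb addbb scale1r scaler0.
    apply: (@chains_eq C k Q c m gd (fun=> 0)) => //.
    transitivity (vd m.+1 u); last by rewrite hd big1 // => b' _; rewrite chain_sig0.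
    rewrite eg vd_chains //; apply: eq_bigr => b' _.
    by rewrite (echain_notin _ _ cm) add0r chain_sigZ.
  have ex b : exists q : laurent (V m), poly (image m) q /\
      ((b < (m.*2).+2)%N -> lmap (vd m) q = g b).
    have [hb|hb] := boolP (b < (m.*2).+2)%N; last first.
      exists 0; split=> //; split=> [d|d _]; rewrite linear0 //; exact: (stable0 sI').
    have [h1 h2] := hg b.
    have [||q [hq eq hz]] := exact_coefs IH' (ltnW mn) h1; [by rewrite egh|exact: dg|].
    by exists q; split=> //; split=> // d hd'; apply: hz; exact: h2.
  have [q hq] := choice ex.
  pose q' b := (-1) ^+ (m < b)%N *: q b.
  exists (\sum_(b < (m.*2).+2) vchain Q c b (sig (q' b))).
    apply: (image_chain mn) => b; have [[h1 h2] _] := hq b; split=> d; rewrite linearZ /=.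
      by apply: (stableZ sI'); exact: h1.
    by move=> hd'; rewrite h2 ?scaler0.
  rewrite vd_chains // eg; apply: eq_bigr => b _; rewrite echain_notin // add0r.
  have [_ hb] := hq b; rewrite -hb // -linearZ -linearZ /=; congr (vchain _ _ _ (sig _)).
  apply: lcoefP => d; rewrite linearZ /= !lcoef_map ?linear0 // !linearZ /=.
  by rewrite scalerA -expr2 sqrr_sign scale1r.
pose sg : k := (-1) ^+ N (c m); pose e := (N (c m))%:Z.
have sgK x : sg *: (sg *: x) = x :> laurent (V m) by rewrite scalerA -expr2 sqrr_sign scale1r.
(* The contracting homotopy applied to the even part of u. Its differential has the right even part
   by construction, and the right odd part because u is a cycle. *)
pose w : V m.+1 :=
  glue (fun cc b => if b then sg *: lshift (- e) (comp cc false u) else 0).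
have cw cc b : (cc <= m)%N ->
    comp cc b w = if b then sg *: lshift (- e) (comp cc false u) else 0 by apply: comp_glue.
have topE (x : laurent (V m)) : wtop If N c m x = sg *: lshift e x by rewrite /wtop cm.
have vdw : vd m.+1 w = u.
  apply: compP => cc b hc; rewrite comp_vd !cw //; case: b.
    have := congr1 (comp cc false) hd; rewrite comp_vd linear0 topE => /eqP.
    rewrite addr_eq0 => /eqP ed.
    transitivity (- (sg *: lshift (- e) (lmap (vd m) (comp cc false u)))).
      by congr (- _); rewrite linearZ /= lmap_shift ?linear0.
    by rewrite ed linearN scalerN opprK linearZ /= sgK lshiftD addNr lshift0.
  by rewrite lmap0 ?linear0 // add0r topE linearZ /= sgK lshiftD subrr lshift0.
have wX : allM (image m) w.
  move=> cc b hc; rewrite cw //; case: b; last exact: (allc0 sI').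
  by apply: (allcZ sI'); apply: allc_shift; exact: hM.
have wF : allM (vwF m) w.
  move=> cc b hc; rewrite cw //; case: b; last exact: (allc0 sF).
  by apply: (allcZ sF); apply: allc_shift; apply: vwF_comp.
(* The same coefficients must come from the algebra and satisfy [vwF]: both are hypotheses of the
   induction. *)
have [h [hX hFh eh]] := chain_decomposition2 sI' sF wX wF.
pose hp b := ltrunc (fun d => 0 <= d) (h b); pose hn b := ltrunc (fun d => d < 0) (h b).
have split_pn (x : laurent (V m)) :
    x = ltrunc (fun d => 0 <= d) x + ltrunc (fun d => d < 0) x.
  apply: lcoefP => d; rewrite linearD /= !lcoef_trunc; case: ltP => _; rewrite ?addr0 ?add0r //.
have hpI b : poly (image m) (hp b).
  split=> d; rewrite lcoef_trunc; last by move=> lt; rewrite leNgt lt.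
  by case: ifP => _; [exact: hX|exact: (stable0 sI')].
have hnI b : allc (image m) (hn b).
  by move=> d; rewrite lcoef_trunc; case: ifP => _; [exact: hX|exact: (stable0 sI')].
have hnF b : (b < (m.*2).+2)%N -> allc (vwF m) (hn b).
  move=> hb d; rewrite lcoef_trunc.
  by case: ifP => _; [exact: (hFh b hb d)|exact: (stable0 sF)].
pose wp := \sum_(b < (m.*2).+2) vchain Q c b (sig (hp b)).
pose wn := \sum_(b < (m.*2).+2) vchain Q c b (sig (hn b)).
have ew : w = wp + wn.
  by rewrite eh -big_split; apply: eq_bigr => b _; rewrite /= -!linearD -split_pn.
have wpI : image m.+1 wp by apply: (image_chain mn).
have dwn : vd m.+1 wn = u - vd m.+1 wp by rewrite -vdw ew linearD addrAC subrr add0r.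
have [p hp' ep] : exists2 p : nat -> laurent (V m), (forall b, poly (image m) (p b)) &
    vd m.+1 wn = \sum_(b < (m.*2).+2) vchain Q c b (sig (p b)).
  apply: (image_expand ci mn); rewrite dwn -scaleN1r.
  by apply: (stableD sI) => //; apply: (stableZ sI); exact: image_vd.
(* The terms from d(theta) are even and contribute only chains with b <= m. For b > m this leaves
   [p b] = - vd ([hn b]), where the left side has no negative powers and the right side only
   negative ones, so both vanish. *)
have dhn b : (m < b < (m.*2).+2)%N -> lmap (vd m) (hn b) = 0.
  move=> hb; pose E := \sum_(b < (m.*2).+2) echain Q c If N b (sig (hn b)).
  have EX : allM (image m) E.
    apply: (big_ind (allM (image m))) => [cc q hc||b' _].
    - by rewrite linear0; exact: (allc0 sI').
    - exact: (allM_D sI').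
    - by apply: (allM_echain _ _ sI') => //; have := ltn_ord b'; lia.
  have Ev : even_part E.
    move=> cc hc; rewrite linear_sum big1 // => b' _; apply: even_echain => //.
    by have := ltn_ord b'; lia.
  have [g [_ hg eg]] := even_decomposition sI' EX Ev.
  pose gg b := g b + (-1) ^+ (m < b)%N *: lmap (vd m) (hn b).
  have pg : p b = gg b.
    apply: (@chains_eq C k Q c m p gg); last by lia.
    rewrite -ep vd_chains // big_split /= -/E eg -big_split; apply: eq_bigr => b' _.
    exact/esym/chain_sig_add.
  move: pg; rewrite /gg hg ?add0r; last lia.
  rewrite (_ : (m < b)%N); last lia.
  rewrite scaleN1r => /eqP; rewrite eq_sym eqr_oppLR => /eqP pg.
  apply: lcoefP => d; rewrite linear0; case: (ltP d 0) => hd'.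
    by rewrite pg linearN /= (proj2 (hp' b)) ?oppr0.
  by rewrite lcoef_map ?linear0 // lcoef_trunc ltNge hd' linear0.
have ex b : exists q : laurent (V m), allc (image m) q /\
    ((m < b < (m.*2).+2)%N -> lmap (vd m) q = hn b).
  have [hb|hb] := boolP (m < b < (m.*2).+2)%N; last by exists 0; split=> //; exact: (allc0 sI').
  have [||q [hq eq _]] := exact_coefs IH' (ltnW mn) (hnI b); [by apply: hnF; lia|exact: dhn|].
  by exists q.
have [q hq] := choice ex.
(* An even vector with the same differential as [wn]: for b > m, where [hn b] = vd ([q b]), the
   differential of the chain on [hn b] is [echain] on vd ([q b]), which is vd of [echain] on
   [q b]. *)
pose y := \sum_(b < (m.*2).+2) (if (b <= m)%N then vchain Q c b (sig (hn b))
                                else echain Q c If N b (sig (q b))).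
have dy : vd m.+1 y = vd m.+1 wn.
  rewrite vd_chains // linear_sum; apply: eq_bigr => b _ /=.
  have hb : (b <= (m.*2).+1)%N by have := ltn_ord b; lia.
  case: leqP => le; first by rewrite (vd_chain _ _ _ _ _ hb) ltnNge le.
  rewrite vd_echain // (proj2 (hq b)) ?dhn; try (have := ltn_ord b; lia).
  by rewrite chain_sig0 scaler0 addr0.
have yX : allM (image m) y.
  apply: (big_ind (allM (image m))) => [cc r hc||b _].
  - by rewrite linear0; exact: (allc0 sI').
  - exact: (allM_D sI').
  - have hb : (b <= (m.*2).+1)%N by have := ltn_ord b; lia.
    case: ifP => _; first by apply: (allM_chain sI' hb); apply: (allM_sig sI'); exact: hnI.
    by apply: (allM_echain _ _ sI' hb); have [] := hq b.
have yE : even_part y.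
  move=> cc hc; rewrite linear_sum big1 // => b _.
  have hb : (b <= (m.*2).+1)%N by have := ltn_ord b; lia.
  case: leqP => le; last exact: even_echain.
  by apply: (chain_lead _ _ (hn b) hb).1; rewrite /rank //; lia.
have [g [gX gz eg]] := even_decomposition sI' yX yE.
have dg b : (b < (m.*2).+2)%N -> p b = lmap (vd m) (g b).
  pose dg b := lmap (vd m) (g b); apply: (@chains_eq C k Q c m p dg).
  rewrite -ep -dy eg vd_chains //; apply: eq_bigr => b' _; rewrite /dg.
  case: (leqP b' m) => le; first by rewrite echain_low // add0r scale1r.
  by rewrite (gz _ le); exact: vd_chain_zero.
(* On even chains the differential acts coefficientwise, so vd ([g b]) = [p b] is polynomial. The
   negative part of [g b] is therefore closed, and dropping it brings the primitive back to the
   image of the algebra. *)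
pose gp b := ltrunc (fun d => 0 <= d) (g b).
have gpE b : (b < (m.*2).+2)%N -> lmap (vd m) (gp b) = lmap (vd m) (g b).
  move=> hb; apply: lcoefP => d; rewrite !lcoef_map ?linear0 // lcoef_trunc.
  case: ltP => // hd'; rewrite linear0 -(lcoef_map (phi := vd m)) ?linear0 // -dg //.
  by rewrite (proj2 (hp' b)).
exists (wp + \sum_(b < (m.*2).+2) vchain Q c b (sig (gp b))).
  apply: (stableD sI) => //; apply: (image_chain mn) => b; split=> d; rewrite lcoef_trunc.
    by case: ifP => _; [exact: gX|exact: (stable0 sI')].
  by move=> lt; rewrite leNgt lt.
rewrite linearD /= -(subrK (vd m.+1 wp) u) -dwn addrC; congr (_ + _).
rewrite -dy eg (vd_chains mn g (leqnn _)) (vd_chains mn gp (leqnn _)); apply: eq_bigr => b _; rewrite (gpE _ (ltn_ord b)).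
case: (leqP b m) => le; first by rewrite !echain_low.
suff -> : gp b = 0 by rewrite (gz _ le).
by apply: lcoefP => d; rewrite lcoef_trunc (gz _ le) linear0 if_same.
Qed.
End Exactness.

(** * Formality *)

Section QuotientMorphism.
Variables (k : comPzRingType) (A : grAlgType k) (J : hideal A).
Fact qpi_zmod_morphism : zmod_morphism (qpi J).
Proof. by move=> x y; rewrite qpiD qpiN. Qed.
Fact qpi_monoid_morphism : monoid_morphism (qpi J).
Proof. by split; [exact: qpi1|exact: qpiM]. Qed.
HB.instance Definition _ := GRing.isZmodMorphism.Build A (quot J) (qpi J) qpi_zmod_morphism.
HB.instance Definition _ := GRing.isMonoidMorphism.Build A (quot J) (qpi J) qpi_monoid_morphism.
Lemma qpi_eq0 x : qpi J x = 0 <-> J x.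
Proof. by rewrite -(qpi0 J); split=> [/qpiP|h]; [|apply/qpiP]; rewrite subr0. Qed.
End QuotientMorphism.

Lemma inj_surj_bij (T U : Type) (f : T -> U) :
  injective f -> (forall y, exists x, f x = y) -> bijective f.
Proof.
move=> fi /choice[g hg]; exists g => // x; apply: fi; exact: hg.
Qed.

Lemma step_to_zero_dg (k : comPzRingType) (A : dgAlg k) (B : grAlgType k)
    (f : {rmorphism A -> B}) : is_gr_hom f -> (forall y, f (dg_d y) = 0) ->
    (forall z, dg_d z = 0 -> f z = 0 -> exists y, z = dg_d y) ->
    (forall b, exists2 z, dg_d z = 0 & f z = b) ->
  quasi_iso_step A (zero_dg B).
Proof.
move=> fg fd fK fS.
have fP : @is_dg_hom k A (zero_dg B) f by split=> // x; exact: fd.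
exists f, fP; apply: inj_surj_bij.
- elim/quot_ind => z; elim/quot_ind => t; rewrite !homology_mapE => /qpiP [y ey].
  apply/qpiP; have [||y' ey'] := fK (val z - val t).
  + by rewrite dg_dD dg_dN !cycleP subrr.
  + by rewrite rmorphB; exact: ey.
  + by exists y'.
- elim/quot_ind => b; have [z dz ez] := fS (val b).
  have hz : z \in @is_cycle k A by apply/is_cycleP.
  exists (qpi (boundaries A) (exist _ z hz)); rewrite homology_mapE.
  by congr (qpi _ _); apply: val_inj.
Qed.

Section Criterion.
Variables (k : comPzRingType) (A : dgAlg k) (B : grAlgType k) (f : {rmorphism A -> B}).
Hypotheses (fg : is_gr_hom f) (fd : forall y, f (dg_d y) = 0).
Hypothesis fK : forall z, dg_d z = 0 -> f z = 0 -> exists y, z = dg_d y.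
Hypothesis fS : forall b, exists2 z, dg_d z = 0 & f z = b.

Definition on_homology (h : homology A) : B := f (val (repr h)).
Lemma on_homologyE z : on_homology (qpi (boundaries A) z) = f (val z).
Proof.
have [y ey] := quot_repr (boundaries A) z.
apply/eqP; rewrite -subr_eq0 -rmorphB; apply/eqP.
by rewrite -(fd y) -ey.
Qed.
Fact on_homology_zmod : zmod_morphism on_homology.
Proof.
elim/quot_ind => z; elim/quot_ind => t.
by rewrite -qpiN -qpiD !on_homologyE -rmorphB.
Qed.
Fact on_homology_monoid : monoid_morphism on_homology.
Proof.
split; first by rewrite -(qpi1 (boundaries A)) on_homologyE rmorph1.
by elim/quot_ind => z; elim/quot_ind => t; rewrite -qpiM !on_homologyE -rmorphM.
Qed.
HB.instance Definition _ := GRing.isZmodMorphism.Build (homology A) B on_homology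
  on_homology_zmod.
HB.instance Definition _ := GRing.isMonoidMorphism.Build (homology A) B on_homology
  on_homology_monoid.

Lemma on_homology_gr : is_gr_hom on_homology.
Proof.
have [f1 f2] := fg; split.
  move=> a; transitivity (on_homology (qpi (boundaries A) (ascal a))) => //.
  by rewrite on_homologyE; exact: f1.
move=> n; elim/quot_ind => z hz.
have e : qpi (boundaries A) z = qpi (boundaries A) (hcomp n z) by rewrite -qpi_hcomp.
by rewrite e; have := f2 n _ (homog_comp n (val z)); rewrite -val_hcomp -on_homologyE.
Qed.
Lemma on_homology_inj : injective on_homology.
Proof.
elim/quot_ind => z; elim/quot_ind => t; rewrite !on_homologyE => e.
apply/qpiP; apply: fK; first by rewrite cycleP.
by rewrite rmorphB e subrr.
Qed.
Lemma on_homology_surj b : exists h, on_homology h = b.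
Proof.
have [z dz <-] := fS b; have hz : z \in @is_cycle k A by apply/is_cycleP.
by exists (qpi (boundaries A) (exist _ z hz)); rewrite on_homologyE.
Qed.

(** The zigzag is A -> (B, 0) <- (H(A), 0): f itself is a quasi-isomorphism and so is the
    isomorphism it induces on homology. *)
Lemma formal_criterion : formal A /\ gr_iso (homology A) B.
Proof.
have bij := inj_surj_bij on_homology_inj on_homology_surj.
split; last by exists on_homology; split=> //; exact: on_homology_gr.
apply: rst_trans (rst_step _ _ _ _ _) _; first exact: (step_to_zero_dg fg fd fK fS).
apply: rst_sym; apply: rst_step.
apply: (@step_to_zero_dg k (zero_dg (homology A)) B on_homology on_homology_gr).
- by move=> y; exact: rmorph0.
- by move=> z _ /eqP; rewrite -(rmorph0 on_homology) => /eqP /on_homology_inj ->; exists 0.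
- by move=> b; have [h hb] := on_homology_surj b; exists h.
Qed.
End Criterion.

(** * The differential d_N in the representation *)

Section LiftDifferential.
Variables (C : cartanDatum) (k : comPzRingType) (c : nat -> C).
Variables (If : {set C}) (N : C -> nat) (n : nat).
Local Notation V p := (arr p -> Wt k p).
Local Notation vdN m := (@vd C k c If N m).

Lemma vd_emb m (u : V m) : vdN m.+1 (emb u) = emb (vdN m u).
Proof. by rewrite /emb vd_sig lmap_mon ?linear0. Qed.
Lemma lift_vd m (u : V m) : (m <= n)%N -> vdN n (lift_to n u) = lift_to n (vdN m u).
Proof.
move=> hm; move: m hm u.
apply: (lift_rec (P := fun m f => forall u : V m, vdN n (f u) = f (vdN m u))) => //.
by move=> m h IH u; rewrite !(lift_to_emb _ h) IH vd_emb.
Qed.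
Lemma vd_vac : vdN n (@vac k n) = 0.
Proof.
rewrite /vac lift_vd // (_ : vdN 0 _ = 0); last by apply/funext.
exact: lift0.
Qed.
End LiftDifferential.

Section DifferentialAction.
Variables (C : cartanDatum) (k : comPzRingType) (Q : klrScalars C k).
Variables (If : {set C}) (N : C -> nat) (n : nat) (dN : Rb Q n -> Rb Q n).
Hypothesis hdN : is_dN If N dN.
Local Notation A := (Rb Q n).
Let dP := dN_diff hdN.

Lemma dN_D y z : dN (y + z) = dN y + dN z. Proof. exact: (diffD dP). Qed.
Lemma dN_0 : dN 0 = 0. Proof. by apply: (addIr (dN 0)); rewrite -dN_D !add0r. Qed.
Lemma dN_N y : dN (- y) = - dN y.
Proof. by apply: (addIr (dN y)); rewrite -dN_D !addNr dN_0. Qed.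
Lemma dN_sum (J : Type) (r : seq J) (P : pred J) (E : J -> A) :
  dN (\sum_(j <- r | P j) E j) = \sum_(j <- r | P j) dN (E j).
Proof. by apply: big_morph; [exact: dN_D|exact: dN_0]. Qed.
Lemma dN_1 : dN 1 = 0. Proof. exact: (@dg_d1 k (DgAlg dP)). Qed.
Lemma dN_sign e y : dN ((-1) ^+ e * y) = (-1) ^+ e * dN y.
Proof. exact: (@dg_d_sign k (DgAlg dP)). Qed.
Lemma dN_M0 y z : homog 0 y -> dN y = 0 -> dN (y * z) = y * dN z.
Proof. by move=> hy dy; rewrite (diff_leibniz dP _ hy) dy mul0r add0r mul1r. Qed.
Lemma dN_Mr y z : dN z = 0 -> dN (y * z) = dN y * z.
Proof.
move=> dz; have [r _ e] := hcomp_sum y; rewrite {1}e mulr_suml dN_sum.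
under eq_bigr => d _ do rewrite (diff_leibniz dP _ (homog_comp d y)) dz !mulr0 addr0.
by rewrite -mulr_suml -dN_sum -e.
Qed.

Lemma homog_theta : homog 1 (theta Q n).
Proof.
apply: homog_sum => i _; apply: homog_sum => j _.
by apply: homogMr; [exact: homog_rb_om|exact: homog_rb_e].
Qed.
Lemma dN_theta_mul y : dN (theta Q n * y) = dN (theta Q n) * y - theta Q n * dN y.
Proof. by rewrite (diff_leibniz dP _ homog_theta) expr1 mulN1r. Qed.
Lemma dN_theta : dN (theta Q n) = \sum_i \sum_(j | colour i 1 j)
  if j \in If then (-1) ^+ N j * rb_x Q n 1 ^+ N j * rb_e Q i else 0.
Proof.
rewrite dN_sum; apply: eq_bigr => i _; rewrite dN_sum; apply: eq_bigr => j hj.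
exact: (dN_om hdN).
Qed.

Section Action.
Variable c : nat -> C.
Local Notation V p := (arr p -> Wt k p).
Local Notation vdN m := (@vd C k c If N m).

Lemma rho_dN_theta (u : V n) : (0 < n)%N -> rho c (dN (theta Q n)) u = vdel c If N u.
Proof.
move=> n0; have sgn e : (-1) ^+ e = ascal ((-1) ^+ e) :> A.
  by elim: e => [|e IH]; rewrite ?expr0 ?ascal1 // !exprS ascalM ascalN ascal1 IH.
have E j i w : rho c ((-1) ^+ N j * rb_x Q n 1 ^+ N j * rb_e Q i) u w =
    if col c w == i then (-1) ^+ N j *: iter (N j) (wX (st w 1)) (u w) else 0.
  rewrite -mulrA sgn rhoM rho_ascal rhoM rho_e vZE.
  have -> : rho c (rb_x Q n 1 ^+ N j) (vE c i u) w = iter (N j) (wX (st w 1)) (vE c i u w).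
    elim: (N j) w => [|e IH] w; first by rewrite expr0 -(ascal1 (s := A)) rho_ascal scale1r.
    by rewrite exprS rhoM rho_x // /vX IH.
  by rewrite vEE; case: ifP => // _; rewrite iter_linear0 scaler0.
apply/funext => w; rewrite dN_theta rho_sum vsumE (bigD1 (col c w)) //= [X in _ + X]big1 ?addr0.
  rewrite rho_sum vsumE (bigD1 (c (st w 1))) /=; last by rewrite colour_col n0 eqxx.
  rewrite big1 ?addr0; last first.
    by move=> j; rewrite colour_col eq_sym => /andP[/andP[_ /eqP ->]]; rewrite eqxx.
  rewrite /vdel /wtopX; case: ifP => _; last by rewrite rho0.
  by rewrite E eqxx.
move=> i ne; rewrite rho_sum vsumE big1 // => j _; case: ifP => _; last by rewrite rho0.
by rewrite E eq_sym (negbTE ne).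
Qed.

(** The vector [vac] is a cycle, and both sides change in the same way when a generator is
    multiplied on the left. *)
Lemma rho_dN y : rho c (dN y) (@vac k n) = vdN n (rho c y (@vac k n)).
Proof.
pose P z := rho c (dN z) (@vac k n) = vdN n (rho c z (@vac k n)).
suff h z : P 1 -> P (z * 1).
  move: (h y); rewrite mulr1; apply.
  by rewrite /P dN_1 rho0 -(ascal1 (s := A)) rho_ascal scale1r vd_vac.
apply: (Rb_left_ind (P := P)); rewrite /P.
- by move=> y1 y2 e1 e2; rewrite dN_D !rhoD linearD /= e1 e2.
- by move=> a y1 e1; rewrite (diffZ dP) !rhoM !rho_ascal e1 linearZ.
- move=> i y1 e1; rewrite dN_M0 ?(dN_e hdN) //; last exact: homog_rb_e.
  rewrite !rhoM !rho_e e1; apply/funext => w; rewrite /vd !vEE.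
  by case: ifP => _ //; rewrite linear0.
- move=> l y1 e1; rewrite dN_M0 ?(dN_x hdN) //; last exact: homog_rb_x.
  have [hl|hl] := boolP (0 < l <= n)%N; last by rewrite x_out // !mul0r rho0 linear0.
  by rewrite !rhoM !rho_x // e1 vd_vX.
- move=> l y1 e1; rewrite dN_M0 ?(dN_tau hdN) //; last exact: homog_rb_tau.
  have [hl|hl] := boolP (0 < l < n)%N; last by rewrite tau_out // !mul0r rho0 linear0.
  by rewrite !rhoM !rho_tau // e1 vd_vT.
- move=> y1 e1; case: (posnP n) => [n0|n0].
    have t0 : theta Q n = 0.
      rewrite /theta big1 // => i _; rewrite big1 // => j /colour_range; lia.
    by rewrite t0 !mul0r dN_0 rho0 linear0.
  rewrite dN_theta_mul rhoD rhoN !rhoM !rho_theta // rho_dN_theta // e1.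
  by rewrite vd_vTh.
Qed.

Lemma rho_vwF (y : A) (u : V n) : vwF c If u -> vwF c If (rho c y u).
Proof.
have sF := @vwF_stable C k Q c If n.
elim: {y}(Rb_generated y) u => [a|i|l|l||y z _ IHy _ IHz|y z _ IHy _ IHz] u hu.
- by rewrite rho_ascal; exact: (stableZ sF).
- by rewrite rho_e => w; rewrite vEE; case: ifP => _; [exact: hu|exact: wF0].
- have [hl|hl] := boolP (0 < l <= n)%N; last by rewrite x_out // rho0; exact: (stable0 sF).
  by rewrite rho_x //; exact: (stable_x sF).
- have [hl|hl] := boolP (0 < l < n)%N; last by rewrite tau_out // rho0; exact: (stable0 sF).
  by rewrite rho_tau //; exact: (stable_T sF).
- case: (posnP n) => [n0|n0]; last by rewrite rho_theta //; exact: (stable_Th sF).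
  rewrite /theta big1 ?rho0; first exact: (stable0 sF).
  by move=> i _; rewrite big1 // => j /colour_range; lia.
- by rewrite rhoD; apply: (stableD sF); [exact: IHy|exact: IHz].
- by rewrite rhoM; apply: IHy; exact: IHz.
Qed.

(** A generator of the ideal acts by zeta_p for the leftmost strand p, with colour in I_f, and the
    whole algebra preserves [vwF]. *)
Lemma Rp_ideal_vwF (y : A) (u : V n) : Rp_ideal Q n If y -> vwF c If (rho c y u).
Proof.
have sF := @vwF_stable C k Q c If n.
move=> h; elim: h u => {y} [y [i [j [hij hj ->]]] u||y z _ IHy _ IHz u|a y _ IH u|a y _ IH u].
- rewrite -(theta_e Q hij) rhoM rho_theta; last by have := colour_range hij; lia.
  move=> w; rewrite rho_e /vTh vEE; case: eqP => [e|_]; last by rewrite linear0; exact: wF0.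
  move: hij; rewrite -e colour_col => /andP[h1 /eqP h2].
  by apply: wF_wZ; [exact: st_lt|rewrite h2].
- by move=> u; rewrite rho0; exact: (stable0 sF).
- by rewrite rhoD; apply: (stableD sF); [exact: IHy|exact: IHz].
- by rewrite rhoM; apply: rho_vwF; exact: IH.
- by rewrite rhoM; exact: IH.
Qed.
End Action.

(** For each idempotent, a primitive is found for the action on [vac] and comes from an element of
    the algebra; faithfulness on [vac] turns this into an identity in the algebra. *)
Lemma Rp_ideal_exact r : Rp_ideal Q n If r -> dN r = 0 -> exists y, r = dN y.
Proof.
(* Labels beyond the n strands need a default colour c0. With no colours at all the ideal has no
   generators, so r = 0. *)
move=> hr dr; have [[c0 _]|nC] := pselect (exists c0 : C, True); last first.
  exists 0; rewrite dN_0.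
  elim: hr => {r dr} [y [i [j _]]||y z _ -> _ ->|a y _ ->|a y _ ->]; last 4 first.
  - by [].
  - by rewrite addr0.
  - by rewrite mulr0.
  - by rewrite mul0r.
  by case: nC; exists j.
suff H i : exists y, r * rb_e Q i = dN y.
  have [Y hY] := choice H; exists (\sum_i Y i).
  by rewrite dN_sum -[LHS]mulr1 -e_one mulr_sumr; apply: eq_bigr => i _.
pose c p := nth c0 i p.
have ci (p : 'I_n) : c p = tnth i p by rewrite (tnth_nth c0).
have rv z : rho c (z * rb_e Q i) (@vac k n) = rho c z (@vac k n).
  by rewrite rhoM rho_e_vac.
have hu : image Q i c (rho c r (@vac k n)).
  exists (r * rb_e Q i); first exact: normal_all.
  by rewrite /rep rv lift_to_n.
have [||u' [z' hz' ez'] eu] := image_exact ci (If := If) (N := N) (leqnn n) hu.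
- exact: Rp_ideal_vwF.
- by rewrite -rho_dN dr rho0.
exists (z' * rb_e Q i); rewrite dN_Mr; last exact: (dN_e hdN).
apply/eqP; rewrite -subr_eq0 -mulrBl; apply/eqP.
apply: (normal_inj ci (leqnn n)); first exact: normal_all.
rewrite rv rhoD rhoN rho_dN eu.
by move: ez'; rewrite /rep lift_to_n => ->; rewrite subrr.
Qed.
End DifferentialAction.

(** * The map onto the cyclotomic quotient *)

Section CyclotomicQuotient.
Variables (C : cartanDatum) (k : comPzRingType) (Q : klrScalars C k).
Variables (If : {set C}) (N : C -> nat) (n : nat) (dN : Rb Q n -> Rb Q n).
Hypothesis hdN : is_dN If N dN.
Local Notation A := (Rb Q n).
Local Notation J := (Rp_ideal Q n If).
Local Notation dg := (DgAlg (dN_diff hdN)).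

(** It suffices to treat generators, and of these only theta is not a cycle: modulo the ideal it is
    the sum of the tight floating dots with colours outside I_f, on which d_N vanishes. *)
Lemma cycle_mod_Rp_ideal y : exists2 a : A, dN a = 0 & J (y - a).
Proof.
have cycle a : dN a = 0 -> (a : dg) \in @is_cycle k dg by move=> e; apply/is_cycleP.
have cyc a : dN a = 0 -> exists2 a' : A, dN a' = 0 & J (a - a').
  by move=> e; exists a => //; rewrite subrr; exact: imem0.
elim: {y}(Rb_generated y) => [a|i|l|l||y z _ [a da ja] _ [b db jb]|y z _ [a da ja] _ [b db jb]].
- by apply: cyc; apply/(@is_cycleP k dg); exact: (@ascal_cycle k dg).
- by apply: cyc; exact: (dN_e hdN).
- by apply: cyc; exact: (dN_x hdN).
- by apply: cyc; exact: (dN_tau hdN).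
- exists (\sum_i \sum_(j | colour i 1 j && (j \notin If)) rb_om Q n 1 j 0 * rb_e Q i).
    rewrite (dN_sum hdN) big1 // => i _; rewrite (dN_sum hdN) big1 // => j /andP[hij hj].
    by rewrite (dN_om hdN) // (negbTE hj).
  rewrite /theta -sumrB; apply: (big_ind (imem J)); [exact: imem0|exact: imemD|move=> i _].
  rewrite (bigID (mem If)) /= addrK.
  apply: (big_ind (imem J)); [exact: imem0|exact: imemD|move=> j /andP[hij hj]].
  by apply: ideal_gen_in; exists i, j.
- exists (a + b); first by rewrite (dN_D hdN) da db addr0.
  by rewrite opprD addrACA; apply: imemD.
- exists (a * b).
    apply/(@is_cycleP k dg); have [_ _ h] := @is_cycle_subring k dg.
    exact: (h _ _ (cycle _ da) (cycle _ db)).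
  have -> : y * z - a * b = (y - a) * z + a * (z - b) by rewrite mulrBl mulrBr addrA subrK.
  by apply: imemD; [exact: imemMr|exact: imemMl].
Qed.

Definition to_RpN := qpi (RpN_ideal Q n If N) \o qpi J.
HB.instance Definition _ := GRing.RMorphism.on to_RpN.

Lemma to_RpN_Rp_ideal y : J y -> to_RpN y = 0.
Proof. by move=> /qpi_eq0 e; rewrite /to_RpN /= e qpi0. Qed.

Lemma to_RpN_dN_theta : to_RpN (dN (theta Q n)) = 0.
Proof.
rewrite (dN_theta hdN) raddf_sum big1 // => i _; rewrite raddf_sum big1 // => j hij.
case: ifP => hj; last exact: raddf0.
rewrite -mulrA.
transitivity (to_RpN ((-1) ^+ N j) * to_RpN (rb_x Q n 1 ^+ N j * rb_e Q i)).
  exact: rmorphM.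
rewrite [X in _ * X](_ : _ = 0) ?mulr0 //.
by apply/qpi_eq0; apply: ideal_gen_in; exists i, j.
Qed.

Lemma to_RpN_dN y : to_RpN (dN y) = 0.
Proof.
pose P y := to_RpN (dN y) = 0.
suff h z : P 1 -> P (z * 1).
  by move: (h y); rewrite mulr1; apply; rewrite /P (dN_1 hdN) rmorph0.
apply: (Rb_left_ind (P := P)); rewrite /P.
- by move=> y1 y2 e1 e2; rewrite (dN_D hdN) rmorphD /= e1 e2 addr0.
- by move=> a y1 e1; rewrite (diffZ (dN_diff hdN)) rmorphM /= e1 mulr0.
- move=> i y1 e1; rewrite (dN_M0 hdN) ?(dN_e hdN) //; last exact: homog_rb_e.
  by rewrite rmorphM /= e1 mulr0.
- move=> l y1 e1; rewrite (dN_M0 hdN) ?(dN_x hdN) //; last exact: homog_rb_x.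
  by rewrite rmorphM /= e1 mulr0.
- move=> l y1 e1; rewrite (dN_M0 hdN) ?(dN_tau hdN) //; last exact: homog_rb_tau.
  by rewrite rmorphM /= e1 mulr0.
- move=> y1 e1; rewrite (dN_theta_mul hdN) rmorphB !rmorphM /= e1 mulr0 subr0.
  by rewrite to_RpN_dN_theta mul0r.
Qed.

(** Each generator is up to sign the differential of a tight floating dot. Multipliers in R_p lift
    to cycles, and a cycle times a boundary is a boundary. *)
Lemma RpN_ideal_boundary u : RpN_ideal Q n If N u -> exists y, u = qpi J (dN y).
Proof.
elim=> {u} [u [i [j [hij hj ->]]]||u v _ [y ->] _ [z ->]|a u _ [y ->]|a u _ [y ->]].
- exists ((-1) ^+ N j * (rb_om Q n 1 j 0 * rb_e Q i)).
  by rewrite (dN_sign hdN) (dN_om hdN) // hj !mulrA -expr2 sqrr_sign mul1r.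
- by exists 0; rewrite (dN_0 hdN).
- by exists (y + z); rewrite (dN_D hdN) qpiD.
- elim/quot_ind: a => a; have [b db jb] := cycle_mod_Rp_ideal a.
  have hb : (b : dg) \in @is_cycle k dg by apply/is_cycleP.
  have hy : (dN y : dg) \in @is_cycle k dg by apply/is_cycleP; exact: (diff_sq (dN_diff hdN)).
  have [|z ez] := @boundaryMl k dg (exist _ b hb) (exist _ (dN y) hy); first by exists y.
  exists z; rewrite -[dN z]ez -qpiM; apply/qpiP => /=.
  by rewrite -mulrBl; apply: (imemMr (h := J)).
- elim/quot_ind: a => a; have [b db jb] := cycle_mod_Rp_ideal a.
  exists (y * b); rewrite (dN_Mr hdN) // -qpiM; apply/qpiP.
  by rewrite -mulrBr; apply: (imemMl (h := J)).
Qed.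

(** Subtracting a suitable boundary moves z into the ideal defining R_p, where [Rp_ideal_exact]
    applies. *)
Lemma to_RpN_exact z : dN z = 0 -> to_RpN z = 0 -> exists y, z = dN y.
Proof.
move=> dz /qpi_eq0 /RpN_ideal_boundary[y /qpiP hr].
have [|y' ey] := Rp_ideal_exact hdN hr.
  by rewrite (dN_D hdN) (dN_N hdN) dz (diff_sq (dN_diff hdN)) subrr.
by exists (y' + y); rewrite (dN_D hdN) -ey subrK.
Qed.

Lemma to_RpN_cycles b : exists2 z, dN z = 0 & to_RpN z = b.
Proof.
elim/quot_ind: b; elim/quot_ind => y; have [a da ja] := cycle_mod_Rp_ideal y.
have e : to_RpN y - to_RpN a = 0.
  by rewrite -(to_RpN_Rp_ideal ja); apply/esym; exact: rmorphB.
by exists a => //; apply/esym/eqP; rewrite -subr_eq0; apply/eqP.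
Qed.

Lemma to_RpN_gr : is_gr_hom to_RpN.
Proof. by split=> // d y hy; apply: homog_qpi; exact: homog_qpi. Qed.
End CyclotomicQuotient.

Unset Implicit Arguments.

(* The family N is a total function of which only the values on If are used. *)
Theorem theorem4p4 (C : cartanDatum) (k : comPzRingType) (Q : klrScalars C k)
    (If : {set C}) (N : C -> nat) (m : nat)
    (dN : Rb Q m -> Rb Q m) (hdN : is_dN If N dN) :
  formal (DgAlg (dN_diff hdN)) /\
  gr_iso (homology (DgAlg (dN_diff hdN))) (RpN Q m If N).
Proof.
apply: (@formal_criterion k (DgAlg (dN_diff hdN)) _ (@to_RpN C k Q If N m)).
- exact: to_RpN_gr.
- exact: to_RpN_dN.
- exact: to_RpN_exact.
- exact: to_RpN_cycles.
Qed.
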